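(* Let $g$ be an analytic circle diffeomorphism with irrational rotation number $\alpha$, and let $(p_n/q_n)_{n\ge 0}$ be the sequence of convergents of $\alpha$ given by the continued fraction algorithm. Given $C_0>0$ there is $n_0\ge 0$ large enough such that there is a sequence $(\gamma_n)_{n\ge n_0}$ of Jordan curves in $\mathbb{C}-\overline{\mathbb{D}}$, homotopic to $\mathbb{S}^1$ and exterior to $\overline{\mathbb{D}}$, such that for every $n\ge n_0$: (1) all the iterates $g^j$, $0\le j\le q_n$, are defined on a neighborhood of the closure of the annulus $U_n$ bounded by $\mathbb{S}^1$ and $\gamma_n$; (2) for all $0\le j\le q_n$, $\mathcal{D}_P(g^j(\gamma_n),\gamma_n)\le C_0$; (3) for every $z\in\gamma_n$, $d_P(g^{q_n}(z),z)\le C_0$.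
   Context: $\mathbb{D}$ is the open unit disk in $\mathbb{C}$ and $\mathbb{S}^1=\partial\mathbb{D}$. An analytic circle diffeomorphism is an orientation-preserving real-analytic diffeomorphism of $\mathbb{S}^1$; it extends holomorphically to a neighborhood of $\mathbb{S}^1$ in $\mathbb{C}$, and $g$ and its iterates $g^j$ also denote this extension where defined. $d_P$ is the Poincaré (hyperbolic) distance in $\mathbb{C}-\overline{\mathbb{D}}$, and $\mathcal{D}_P$ is the Hausdorff distance between compact subsets of $\mathbb{C}-\overline{\mathbb{D}}$ associated to $d_P$. The curves $\gamma_n$ are called quasi-invariant curves for $g$. *)

(* Defs.v *)
From Stdlib Require Import Reals ZArith.
From Coquelicot Require Import Coquelicot.

Open Scope R_scope.

(** * Plane topology *)

Definition unit_circle (z : C) : Prop := Cmod z = 1.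
Definition outside_disk (z : C) : Prop := 1 < Cmod z.

Definition expi (t : R) : C := (cos (2 * PI * t), sin (2 * PI * t)).

Definition unit_interval (t : R) : Prop := 0 <= t <= 1.

Definition closure (A : C -> Prop) (z : C) : Prop :=
  forall D : C -> Prop, locally z D -> exists w, D w /\ A w.

Definition image (f : C -> C) (A : C -> Prop) (w : C) : Prop :=
  exists z, A z /\ w = f z.

(** Closed curves are parametrised by [0,1]; values elsewhere are irrelevant. *)
Definition trace (gamma : R -> C) (z : C) : Prop :=
  exists t, unit_interval t /\ z = gamma t.

Definition jordan_curve (gamma : R -> C) : Prop :=
  continuous_on unit_interval gamma /\
  gamma 0 = gamma 1 /\
  (forall s t, 0 <= s < 1 -> 0 <= t < 1 -> gamma s = gamma t -> s = t).

(** Free homotopy of closed curves inside [X]; the pair is (time, parameter). *)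
Definition homotopic_loops (X : C -> Prop) (gamma0 gamma1 : R -> C) : Prop :=
  exists H : R * R -> C,
    continuous_on (fun p => unit_interval (fst p) /\ unit_interval (snd p)) H /\
    (forall s t, unit_interval s -> unit_interval t -> X (H (s, t))) /\
    (forall t, unit_interval t -> H (0, t) = gamma0 t) /\
    (forall t, unit_interval t -> H (1, t) = gamma1 t) /\
    (forall s, unit_interval s -> H (s, 0) = H (s, 1)).

(** Path component of [z] in [A].  For open [A], such as the complement of a
    Jordan curve, these are the connected components. *)
Definition component (A : C -> Prop) (z w : C) : Prop :=
  exists p : R -> C,
    continuous_on unit_interval p /\ p 0 = z /\ p 1 = w /\
    (forall t, unit_interval t -> A (p t)).

Definition bounded_set (A : C -> Prop) : Prop :=
  exists M, forall z, A z -> Cmod z <= M.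

(** Points in a bounded component of the complement of the curve. *)
Definition inside (gamma : R -> C) (z : C) : Prop :=
  ~ trace gamma z /\ bounded_set (component (fun w => ~ trace gamma w) z).

(** Open annulus bounded by the unit circle and a Jordan curve around it. *)
Definition annulus (gamma : R -> C) (z : C) : Prop :=
  outside_disk z /\ inside gamma z.

(** * Poincaré distance of the complement of the closed unit disk *)

Definition cexp (z : C) : C :=
  (exp (Re z) * cos (Im z), exp (Re z) * sin (Im z)).

(** Hyperbolic distance of the right half-plane (curvature -1):
    sinh (d/2) = |u - v| / (2 sqrt (Re u Re v)). *)
Definition dist_halfplane (u v : C) : R :=
  2 * arcsinh (Cmod (u - v) / (2 * sqrt (Re u * Re v))).

(** [cexp] is the universal covering of {|z| > 1} by {Re > 0}; the Poincaré
    distance is the quotient distance.  Only meaningful outside the closed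
    disk: elsewhere the set of lifts is empty and the value is junk. *)
Definition dist_P (z w : C) : R :=
  real (Glb_Rbar (fun d => exists u v : C,
    0 < Re u /\ 0 < Re v /\ cexp u = z /\ cexp v = w /\
    d = dist_halfplane u v)).

Definition dist_P_set (z : C) (A : C -> Prop) : R :=
  real (Glb_Rbar (fun d => exists w, A w /\ d = dist_P z w)).

(** The supremum over the union is the maximum of the two one-sided suprema;
    it is taken in [Rbar] so that an unbounded family yields [p_infty].
    Meant for nonempty compact subsets of {|z| > 1}. *)
Definition hausdorff_P (A B : C -> Prop) : Rbar :=
  Lub_Rbar (fun d =>
    (exists a, A a /\ d = dist_P_set a B) \/
    (exists b, B b /\ d = dist_P_set b A)).

(** * Analytic circle diffeomorphisms

    A circle map is the restriction to the unit circle of some [g : C -> C];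
    the definitions of this section never look at [g] elsewhere. *)

Definition circle_map (g : C -> C) : Prop :=
  forall z, unit_circle z -> unit_circle (g z).

(** Real-analyticity in the angular coordinate: local sums of power series with
    real variable and complex coefficients. *)
Definition circle_analytic (g : C -> C) : Prop :=
  forall t0 : R, exists (a : nat -> C) (r : R), 0 < r /\
    forall t, Rabs (t - t0) < r ->
      @is_pseries R_AbsRing C_R_NormedModule a (t - t0) (g (expi t)).

Definition circle_lift (g : C -> C) (F : R -> R) : Prop :=
  (forall x, continuous F x) /\ (forall x, g (expi x) = expi (F x)).

Definition orientation_preserving (g : C -> C) : Prop :=
  exists F, circle_lift g F /\ forall x y, x < y -> F x < F y.

Definition analytic_circle_diffeo (g : C -> C) : Prop :=
  circle_map g /\ circle_analytic g /\
  (exists h, circle_map h /\ circle_analytic h /\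
     (forall z, unit_circle z -> h (g z) = z) /\
     (forall z, unit_circle z -> g (h z) = z)) /\
  orientation_preserving g.

(** The rotation number is a class in R/Z, obtained by varying the lift;
    [alpha] may be any real representative of it. *)
Definition rotation_number (g : C -> C) (alpha : R) : Prop :=
  exists F, circle_lift g F /\
    forall x, is_lim_seq (fun n => (Nat.iter n F x - x) / INR n) alpha.

(** [(W, g)] is a holomorphic extension of the circle map [g] to the
    neighbourhood [W] of the unit circle. *)
Definition holomorphic_near_circle (W : C -> Prop) (g : C -> C) : Prop :=
  open W /\ (forall z, unit_circle z -> W z) /\
  (forall z, W z -> @ex_derive C_AbsRing C_NormedModule g z).

(** The iterate of order [j] of the partial map [g], with domain [W], is defined
    at [z]. *)
Definition iterate_defined (W : C -> Prop) (g : C -> C) (j : nat) (z : C) : Prop :=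
  forall i, (i < j)%nat -> W (Nat.iter i g z).

(** * Continued fractions *)

Definition irrational (x : R) : Prop :=
  forall p q : Z, q <> 0%Z -> x <> IZR p / IZR q.

Fixpoint cf_rem (alpha : R) (n : nat) : R :=
  match n with
  | O => frac_part alpha
  | S m => frac_part (/ cf_rem alpha m)
  end.

Definition cf_coef (alpha : R) (n : nat) : Z :=
  match n with
  | O => Int_part alpha
  | S m => Int_part (/ cf_rem alpha m)
  end.

(** [((p_n, q_n), (p_(n-1), q_(n-1)))], with p_(-1) = 1 and q_(-1) = 0. *)
Fixpoint cf_pairs (alpha : R) (n : nat) : (Z * Z) * (Z * Z) :=
  match n with
  | O => ((cf_coef alpha 0, 1), (1, 0))%Z
  | S m =>
      let '((p, q), (p', q')) := cf_pairs alpha m in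
      let a := cf_coef alpha (S m) in
      ((a * p + p', a * q + q'), (p, q))%Z
  end.

Definition convergent (alpha : R) (n : nat) : Z * Z := fst (cf_pairs alpha n).

(** The denominators are positive, so nothing is lost in [Z.to_nat]. *)
Definition convergent_den (alpha : R) (n : nat) : nat :=
  Z.to_nat (snd (convergent alpha n)).

(* Main.v *)
(** Let [F] be the lift of [g], let [m_n x = |F^(q_n) x - p_n - x|], and let [gamma_n] be the curve
    lying at height [c * m_n x] above [x] in the coordinate [z = exp (2 pi i w)], where [c] is a
    large multiple of [1 / C0].  For [j <= q_(n+1)] the intervals from [F^j x] to
    [F^j (F^(q_n) x - p_n)] have total length at most 1, hence (Denjoy) [F^j] has bounded
    distortion on the first of them.  By this bounded distortion the weights
    [DF^k x / sum_(k < q_n) DF^k x] are comparable to Lebesgue measure, and [D log DF] has mean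
    zero; so passing to a higher level contracts [D log DF^j / sum_(k < j) DF^k] by a definite
    factor, and this quotient tends to 0.  Consequently the distortion above tends to 0,
    [m_n (F^j x)] is close to [DF^j x * m_n x], and [DF^(q_n)] is close to 1.
    The displacement [w_j] of a complex orbit from the real one satisfies
    [DF^j x / w_j = 1 / w_0 - D log DF^j x / 2 + small], so [F^j] is nearly affine at the complex
    scale of [gamma_n] as well.  Off the circle, [g] is controlled through third-order Taylor
    estimates with uniform constants, which come from Cauchy's formula. *)

Require Import Defs.
From Stdlib Require Import Reals ZArith Lra Lia Psatz Classical ClassicalEpsilon.
From Coquelicot Require Import Coquelicot.

Open Scope R_scope.

(** The map g^(q_n) moves a point at height c m_n sideways by m_n, a hyperbolic displacement of
    about 1 / c; this fixes c. The obstacle is small [C0]: bounded distortion compares m_n (F^j x)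
    with DF^j x * m_n x only up to a fixed factor, so it bounds the Hausdorff distance by a
    constant, not by [C0]. Hence the distortion must be made to tend to 0. The contraction behind
    this is a positivity argument: if |D log DF^M| <= s S with S = sum_(k < M) DF^k, then s S - D
    log DF^M and s S + D log DF^M are nonnegative with mean s M, and their weighted orbit averages
    keep a definite share of that mean. All the errors are O(1 / n), because sum_(k < q_(n+1)) DF^k
    gains a fixed amount at each level while its product with m_n stays bounded. The regularity of F
    is read off second-order Taylor polynomials of the holomorphic lift whose cubic error is uniform
    along the circle: on the real axis they give DF, D log DF and a Lipschitz bound for it, off the
    axis they drive the complex orbits. As exp (2 pi i w) has modulus > 1 exactly when Im w < 0,
    heights are minus imaginary parts. *)

Lemma is_derive_continuity_pt (f : R -> R) (x l : R) : is_derive f x l -> continuity_pt f x.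
Proof.
  intros H; apply continuity_pt_filterlim, (@ex_derive_continuous R_AbsRing R_NormedModule).
  exists l; exact H.
Qed.

Lemma mean_value (f df : R -> R) (a b : R) :
  (forall x, is_derive f x (df x)) ->
  exists c, Rmin a b <= c <= Rmax a b /\ f b - f a = df c * (b - a).
Proof.
  intros H; apply MVT_gen; intros x _; [apply H|].
  eapply is_derive_continuity_pt, H.
Qed.

Lemma lipschitz_of_derivative (f df : R -> R) (M : R) :
  (forall x, is_derive f x (df x)) -> (forall x, Rabs (df x) <= M) ->
  forall x y, Rabs (f x - f y) <= M * Rabs (x - y).
Proof.
  intros Hd HM x y.
  destruct (mean_value f df y x Hd) as (c & _ & ->).
  rewrite Rabs_mult; apply Rmult_le_compat_r; [apply Rabs_pos|apply HM].
Qed.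

(** * Finite sums *)

Fixpoint psum (f : nat -> R) (n : nat) : R :=
  match n with O => 0 | S k => psum f k + f k end.

Lemma psum_ext (f g : nat -> R) (n : nat) :
  (forall k, (k < n)%nat -> f k = g k) -> psum f n = psum g n.
Proof.
  induction n as [|n IH]; intros H; simpl; [easy|].
  rewrite IH, H; [easy|lia|intros k Hk; apply H; lia].
Qed.

Lemma psum_le (f g : nat -> R) (n : nat) :
  (forall k, (k < n)%nat -> f k <= g k) -> psum f n <= psum g n.
Proof.
  induction n as [|n IH]; intros H; simpl; [lra|].
  apply Rplus_le_compat; [apply IH; intros k Hk; apply H; lia|apply H; lia].
Qed.

Lemma psum_plus (f g : nat -> R) (n : nat) :
  psum (fun k => f k + g k) n = psum f n + psum g n.
Proof. induction n as [|n IH]; simpl; [ring|rewrite IH; ring]. Qed.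

Lemma psum_minus (f g : nat -> R) (n : nat) :
  psum (fun k => f k - g k) n = psum f n - psum g n.
Proof. induction n as [|n IH]; simpl; [ring|rewrite IH; ring]. Qed.

Lemma psum_scal (c : R) (f : nat -> R) (n : nat) :
  psum (fun k => c * f k) n = c * psum f n.
Proof. induction n as [|n IH]; simpl; [ring|rewrite IH; ring]. Qed.

Lemma psum_const (c : R) (n : nat) : psum (fun _ => c) n = INR n * c.
Proof. induction n as [|n IH]; [simpl; ring|rewrite S_INR; simpl psum; rewrite IH; ring]. Qed.

Lemma psum_add (f : nat -> R) (a b : nat) :
  psum f (a + b) = psum f a + psum (fun k => f (a + k)%nat) b.
Proof.
  induction b as [|b IH]; simpl; [rewrite Nat.add_0_r; ring|].
  rewrite Nat.add_succ_r; simpl; rewrite IH; ring.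
Qed.

Lemma psum_nonneg (f : nat -> R) (n : nat) :
  (forall k, (k < n)%nat -> 0 <= f k) -> 0 <= psum f n.
Proof.
  intros H; replace 0 with (psum (fun _ => 0) n) by (rewrite psum_const; ring).
  now apply psum_le.
Qed.

Lemma psum_mono (f : nat -> R) (m n : nat) :
  (forall k, 0 <= f k) -> (m <= n)%nat -> psum f m <= psum f n.
Proof.
  intros H Hmn; replace n with (m + (n - m))%nat by lia; rewrite psum_add.
  assert (0 <= psum (fun k => f (m + k)%nat) (n - m)) by (apply psum_nonneg; auto).
  lra.
Qed.

Lemma psum_Rabs (f : nat -> R) (n : nat) : Rabs (psum f n) <= psum (fun k => Rabs (f k)) n.
Proof.
  induction n as [|n IH]; simpl; [rewrite Rabs_R0; lra|].
  eapply Rle_trans; [apply Rabs_triang|lra].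
Qed.

(** Both sides are the sum up to [a + b] minus the sums up to [a] and up to [b]. Applied to values
    along an orbit, this symmetry yields both the tiling identity and the averaging identity for
    cocycles. *)
Lemma psum_shift_comm (f : nat -> R) (a b : nat) :
  psum (fun k => f (k + a)%nat) b - psum f b = psum (fun k => f (k + b)%nat) a - psum f a.
Proof.
  assert (H := psum_add f a b); rewrite Nat.add_comm, psum_add in H.
  rewrite (psum_ext (fun k => f (k + a)%nat) (fun k => f (a + k)%nat)),
    (psum_ext (fun k => f (k + b)%nat) (fun k => f (b + k)%nat)); [lra| |];
    intros; now rewrite Nat.add_comm.
Qed.

Lemma is_derive_psum (f df : nat -> R -> R) (n : nat) (x : R) :
  (forall k, is_derive (f k) x (df k x)) ->
  is_derive (fun x => psum (fun k => f k x) n) x (psum (fun k => df k x) n).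
Proof.
  intros H; induction n as [|n IH]; simpl.
  - apply (is_derive_const (V := R_NormedModule)).
  - apply (is_derive_plus (V := R_NormedModule)); [exact IH|apply H].
Qed.

(** * Bounded Lipschitz functions *)

Definition bounded_lipschitz (f : R -> R) : Prop :=
  exists M, 0 <= M /\ (forall x, Rabs (f x) <= M) /\
    forall x y, Rabs (f x - f y) <= M * Rabs (x - y).

Lemma bounded_lipschitz_const (c : R) : bounded_lipschitz (fun _ => c).
Proof.
  exists (Rabs c); repeat split; [apply Rabs_pos|intros; lra|].
  intros x y; replace (c - c) with 0 by ring; rewrite Rabs_R0.
  apply Rmult_le_pos; apply Rabs_pos.
Qed.

Lemma bounded_lipschitz_plus (f g : R -> R) :
  bounded_lipschitz f -> bounded_lipschitz g -> bounded_lipschitz (fun x => f x + g x).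
Proof.
  intros (M & HM & Hf & Hf') (N & HN & Hg & Hg'); exists (M + N); repeat split; [lra| |].
  - intros x; eapply Rle_trans; [apply Rabs_triang|]; specialize (Hf x); specialize (Hg x); lra.
  - intros x y; replace (f x + g x - (f y + g y)) with ((f x - f y) + (g x - g y)) by ring.
    eapply Rle_trans; [apply Rabs_triang|]; specialize (Hf' x y); specialize (Hg' x y); lra.
Qed.

Lemma bounded_lipschitz_mult (f g : R -> R) :
  bounded_lipschitz f -> bounded_lipschitz g -> bounded_lipschitz (fun x => f x * g x).
Proof.
  intros (M & HM & Hf & Hf') (N & HN & Hg & Hg'); exists (2 * (M * N)).
  assert (HMN := Rmult_le_pos _ _ HM HN).
  repeat split; [lra| |].
  - intros x; rewrite Rabs_mult.
    apply Rle_trans with (M * N); [apply Rmult_le_compat; auto; apply Rabs_pos|lra].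
  - intros x y; replace (f x * g x - f y * g y) with (f x * (g x - g y) + (f x - f y) * g y) by ring.
    eapply Rle_trans; [apply Rabs_triang|]; rewrite 2!Rabs_mult.
    replace (2 * (M * N) * Rabs (x - y))
      with (M * (N * Rabs (x - y)) + M * Rabs (x - y) * N) by ring.
    apply Rplus_le_compat; apply Rmult_le_compat; auto; apply Rabs_pos.
Qed.

Lemma bounded_lipschitz_comp (f g : R -> R) (M : R) :
  bounded_lipschitz f -> 0 <= M -> (forall x y, Rabs (g x - g y) <= M * Rabs (x - y)) ->
  bounded_lipschitz (fun x => f (g x)).
Proof.
  intros (N & HN & Hf & Hf') HM Hg; exists (N + N * M).
  assert (HMN := Rmult_le_pos _ _ HN HM).
  repeat split; [lra| |].
  - intros x; specialize (Hf (g x)); lra.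
  - intros x y; eapply Rle_trans; [apply Hf'|].
    specialize (Hg x y); assert (0 <= Rabs (x - y)) by apply Rabs_pos; nra.
Qed.

Lemma bounded_lipschitz_psum (f : nat -> R -> R) (n : nat) :
  (forall k, bounded_lipschitz (f k)) -> bounded_lipschitz (fun x => psum (fun k => f k x) n).
Proof.
  intros H; induction n as [|n IH]; simpl; [apply bounded_lipschitz_const|].
  now apply bounded_lipschitz_plus.
Qed.

Lemma bounded_lipschitz_ext (f g : R -> R) :
  (forall x, f x = g x) -> bounded_lipschitz f -> bounded_lipschitz g.
Proof.
  intros E (M & HM & H1 & H2); exists M; repeat split; [easy| |]; intros; rewrite <- !E; auto.
Qed.

(** Serves with [d = 1] for lifts of degree one and with [d = 0] for periodic functions. *)
Lemma periodic_IZR (f : R -> R) (d : R) :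
  (forall x, f (x + 1) = f x + d) -> forall x (k : Z), f (x + IZR k) = f x + IZR k * d.
Proof.
  intros H.
  assert (Hn : forall (k : nat) x, f (x + INR k) = f x + INR k * d).
  { induction k as [|k IH]; intros x; [simpl; rewrite Rplus_0_r; ring|].
    rewrite S_INR, <- Rplus_assoc, H, IH; ring. }
  intros x [|k|k].
  - rewrite Rplus_0_r; ring.
  - now rewrite <- positive_nat_Z, <- INR_IZR_INZ.
  - assert (E := Hn (Pos.to_nat k) (x + IZR (Z.neg k))).
    rewrite INR_IZR_INZ, positive_nat_Z in E.
    replace (x + IZR (Z.neg k) + IZR (Z.pos k)) with x in E
      by (change (Z.neg k) with (- Z.pos k)%Z; rewrite opp_IZR; ring).
    change (Z.neg k) with (- Z.pos k)%Z in *; rewrite opp_IZR in *; lra.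
Qed.

(** * Real dynamics: iterates of the lift, their derivatives and nonlinearities *)

Section RealDynamics.

Variables (F ld psi : R -> R) (V Lp : R).
Hypothesis F1 : forall x, F (x + 1) = F x + 1.
Hypothesis dF : forall x, is_derive F x (exp (ld x)).
Hypothesis dld : forall x, is_derive ld x (psi x).
Hypothesis ld1 : forall x, ld (x + 1) = ld x.
Hypothesis psiV : forall x, Rabs (psi x) <= V.
Hypothesis psiL : forall x y, Rabs (psi x - psi y) <= Lp * Rabs (x - y).

Definition fiter (k : nat) (x : R) : R := Nat.iter k F x.
(** [ld] is log DF and [psi] its derivative, so by the chain rule these are log DF^k, DF^k, sum_(i <
    k) DF^i and D log DF^k. Taking the sums as definitions makes the cocycle relations purely
    algebraic; that they are derivatives is proved afterwards. *)
Definition logD (k : nat) (x : R) : R := psum (fun i => ld (fiter i x)) k.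
Definition Diter (k : nat) (x : R) : R := exp (logD k x).
Definition Dsum (k : nat) (x : R) : R := psum (fun i => Diter i x) k.
Definition nonlin (k : nat) (x : R) : R := psum (fun i => psi (fiter i x) * Diter i x) k.

Lemma V_nonneg : 0 <= V.
Proof. eapply Rle_trans; [apply Rabs_pos|apply (psiV 0)]. Qed.

Lemma Diter_pos (k : nat) (x : R) : 0 < Diter k x.
Proof. apply exp_pos. Qed.

Lemma Diter_S (k : nat) (x : R) : Diter (S k) x = Diter k x * exp (ld (fiter k x)).
Proof. unfold Diter, logD; simpl; apply exp_plus. Qed.

Lemma fiter_add (i j : nat) (x : R) : fiter (i + j) x = fiter j (fiter i x).
Proof. unfold fiter; rewrite Nat.add_comm; apply Nat.iter_add. Qed.

Lemma logD_add (i j : nat) (x : R) : logD (i + j) x = logD i x + logD j (fiter i x).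
Proof.
  unfold logD; rewrite psum_add; f_equal; apply psum_ext; intros; now rewrite fiter_add.
Qed.

Lemma Diter_add (i j : nat) (x : R) : Diter (i + j) x = Diter i x * Diter j (fiter i x).
Proof. unfold Diter; rewrite logD_add; apply exp_plus. Qed.

(** [Dsum] and [nonlin] obey the same additivity twisted by [Diter]. This common cocycle law is what
    allows one to be measured against the other. *)
Lemma Dsum_add (i j : nat) (x : R) : Dsum (i + j) x = Dsum i x + Diter i x * Dsum j (fiter i x).
Proof.
  unfold Dsum; rewrite psum_add, <- psum_scal; f_equal; apply psum_ext; intros; now rewrite Diter_add.
Qed.

Lemma nonlin_add (i j : nat) (x : R) : nonlin (i + j) x = nonlin i x + Diter i x * nonlin j (fiter i x).
Proof.
  unfold nonlin; rewrite psum_add, <- psum_scal; f_equal; apply psum_ext; intros.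
  rewrite Diter_add, fiter_add; ring.
Qed.

Lemma fiter_IZR (k : nat) (x : R) (l : Z) : fiter k (x + IZR l) = fiter k x + IZR l.
Proof.
  induction k as [|k IH]; [easy|]; unfold fiter in *; simpl; rewrite IH.
  rewrite (periodic_IZR F 1 F1); ring.
Qed.

Lemma ld_IZR (x : R) (l : Z) : ld (x + IZR l) = ld x.
Proof. rewrite (periodic_IZR ld 0); [ring|intros; rewrite ld1; ring]. Qed.

Lemma logD_IZR (k : nat) (x : R) (l : Z) : logD k (x + IZR l) = logD k x.
Proof. unfold logD; apply psum_ext; intros; now rewrite fiter_IZR, ld_IZR. Qed.

Lemma fiter_derive (k : nat) (x : R) : is_derive (fiter k) x (Diter k x).
Proof.
  induction k as [|k IH].
  - unfold Diter, logD; simpl; rewrite exp_0; apply (is_derive_id (K := R_AbsRing)).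
  - rewrite Diter_S; apply (is_derive_comp F (fiter k)); [apply dF|apply IH].
Qed.

Lemma logD_derive (k : nat) (x : R) : is_derive (logD k) x (nonlin k x).
Proof.
  unfold logD, nonlin; apply (is_derive_psum (fun i x => ld (fiter i x)) (fun i x => psi (fiter i x) * Diter i x)).
  intros i; rewrite Rmult_comm.
  apply (is_derive_comp (V := R_NormedModule) ld (fiter i)); [apply dld|apply fiter_derive].
Qed.

Lemma fiter_mono (k : nat) (x y : R) : x <= y -> fiter k x <= fiter k y.
Proof.
  intros H; destruct (mean_value (fiter k) (Diter k) x y (fiter_derive k)) as (c & _ & E).
  assert (0 <= Diter k c * (y - x)) by (apply Rmult_le_pos; [apply Rlt_le, Diter_pos|lra]); lra.
Qed.

Lemma ld_lip (x y : R) : Rabs (ld x - ld y) <= V * Rabs (x - y).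
Proof. apply (lipschitz_of_derivative ld psi); auto. Qed.

Lemma nonlin_le_Dsum (k : nat) (x : R) : Rabs (nonlin k x) <= V * Dsum k x.
Proof.
  unfold nonlin, Dsum; rewrite <- psum_scal; eapply Rle_trans; [apply psum_Rabs|].
  apply psum_le; intros i _; rewrite Rabs_mult, (Rabs_pos_eq (Diter i x)) by apply Rlt_le, Diter_pos.
  apply Rmult_le_compat_r; [apply Rlt_le, Diter_pos|apply psiV].
Qed.

Lemma Dsum_nonneg (k : nat) (x : R) : 0 <= Dsum k x.
Proof. apply psum_nonneg; intros; apply Rlt_le, Diter_pos. Qed.

Lemma Dsum_mono (j k : nat) (x : R) : (j <= k)%nat -> Dsum j x <= Dsum k x.
Proof. apply (psum_mono (fun i => Diter i x)); intros; apply Rlt_le, Diter_pos. Qed.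

Lemma Dsum_pos (k : nat) (x : R) : (1 <= k)%nat -> 1 <= Dsum k x.
Proof.
  intros H; eapply Rle_trans; [|apply (Dsum_mono 1 k x H)].
  unfold Dsum, Diter, logD; simpl; rewrite exp_0; lra.
Qed.

Lemma ld_bounded (x : R) : Rabs (ld x) <= Rabs (ld 0) + V.
Proof.
  rewrite <- (ld_IZR x (- Int_part x)).
  assert (Hf := base_fp x); unfold frac_part in Hf; rewrite opp_IZR.
  set (y := x + - IZR (Int_part x)).
  assert (Hy : Rabs (y - 0) <= 1) by (apply Rabs_le; unfold y; lra).
  assert (H := ld_lip y 0); assert (HV := V_nonneg).
  replace (ld y) with ((ld y - ld 0) + ld 0) by ring.
  eapply Rle_trans; [apply Rabs_triang|]; nra.
Qed.

Lemma exp_ld_bl : bounded_lipschitz (fun x => exp (ld x)).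
Proof.
  set (B := Rabs (ld 0) + V); assert (HV := V_nonneg).
  assert (HE : forall x, exp (ld x) <= exp B).
  { intros x; assert (H := ld_bounded x); fold B in H.
    destruct (Rle_lt_or_eq_dec (ld x) B) as [Hl| ->]; [|apply Rlt_le, exp_increasing; easy|lra].
    eapply Rle_trans; [apply Rle_abs|easy]. }
  exists (exp B + V * exp B).
  assert (HB := exp_pos B); assert (0 <= V * exp B) by (apply Rmult_le_pos; lra).
  repeat split; [lra| |].
  - intros x; rewrite Rabs_pos_eq; [specialize (HE x); lra|apply Rlt_le, exp_pos].
  - intros x y.
    eapply Rle_trans; [apply (lipschitz_of_derivative (fun x => exp (ld x))
      (fun x => psi x * exp (ld x)) (V * exp B))|].
    + intros z; apply (is_derive_comp exp ld); [|apply dld].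
      apply is_derive_Reals, derivable_pt_lim_exp.
    + intros z; rewrite Rabs_mult, (Rabs_pos_eq (exp _)) by apply Rlt_le, exp_pos.
      apply Rmult_le_compat; auto; [apply Rabs_pos|apply Rlt_le, exp_pos].
    + apply Rmult_le_compat_r; [apply Rabs_pos|lra].
Qed.

Lemma fiter_lip (k : nat) : exists M, 0 <= M /\ forall x y, Rabs (fiter k x - fiter k y) <= M * Rabs (x - y).
Proof.
  induction k as [|k (M & HM & H)].
  - exists 1; split; [lra|intros; simpl; lra].
  - destruct exp_ld_bl as (N & HN & HB & _); exists (N * M); split; [now apply Rmult_le_pos|].
    intros x y; rewrite Rmult_assoc.
    eapply Rle_trans; [apply (lipschitz_of_derivative F (fun x => exp (ld x)) N); auto|].
    apply Rmult_le_compat_l; auto; apply H.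
Qed.

Lemma Diter_bl (k : nat) : bounded_lipschitz (Diter k).
Proof.
  induction k as [|k IH].
  - apply (bounded_lipschitz_ext (fun _ => 1)); [|apply bounded_lipschitz_const].
    intros; unfold Diter, logD; simpl; now rewrite exp_0.
  - apply (bounded_lipschitz_ext (fun x => Diter k x * exp (ld (fiter k x)))); [intros; now rewrite Diter_S|].
    destruct (fiter_lip k) as (M & HM & H).
    apply bounded_lipschitz_mult; [exact IH|].
    apply (bounded_lipschitz_comp (fun x => exp (ld x)) (fiter k) M exp_ld_bl HM H).
Qed.

Lemma psi_bl : 0 <= Lp -> bounded_lipschitz psi.
Proof.
  intros HL; exists (V + Lp); assert (HV := V_nonneg); repeat split; [lra| |].
  - intros x; specialize (psiV x); lra.
  - intros x y; specialize (psiL x y); assert (0 <= Rabs (x - y)) by apply Rabs_pos; nra.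
Qed.

Lemma Lp_nonneg : 0 <= Lp.
Proof.
  assert (H := psiL 1 0); replace (1 - 0) with 1 in H by ring; rewrite Rabs_R1 in H.
  assert (0 <= Rabs (psi 1 - psi 0)) by apply Rabs_pos; lra.
Qed.

(** The constant depends on [k] in an uncontrolled way. It is used only at a fixed length [M], while
    the level [n] tends to infinity. *)
Lemma Dsum_bl (k : nat) : bounded_lipschitz (Dsum k).
Proof. apply (bounded_lipschitz_psum Diter), Diter_bl. Qed.

Lemma nonlin_bl (k : nat) : bounded_lipschitz (nonlin k).
Proof.
  apply (bounded_lipschitz_psum (fun i x => psi (fiter i x) * Diter i x)); intros i.
  apply bounded_lipschitz_mult; [|apply Diter_bl].
  destruct (fiter_lip i) as (M & HM & H).
  apply (bounded_lipschitz_comp psi (fiter i) M (psi_bl Lp_nonneg) HM H).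
Qed.

(** * Closest returns: tilings, distortion and Denjoy bounds *)

Variables (q : nat -> nat) (p : nat -> Z).
Hypothesis q_pos : forall n, (1 <= q n)%nat.
Hypothesis q_le : forall n, (q n <= q (S n))%nat.
Hypothesis q_lt : forall n, (q (S n) < q (S (S n)))%nat.
Hypothesis pq_det : forall n, IZR (p (S n)) * INR (q n) - IZR (p n) * INR (q (S n)) = (-1) ^ n.
Hypothesis pq_sign : forall n x, 0 < (-1) ^ n * (fiter (q n) x - IZR (p n) - x).


Definition nxt (n : nat) (x : R) : R := fiter (q n) x - IZR (p n).
(** The quantity m_n of the overview, see [gap_abs]; the sign (-1)^n replaces the absolute value
    because closest returns alternate sides. *)
Definition gap (n : nat) (x : R) : R := (-1) ^ n * (nxt n x - x).

Lemma sign_cases (n : nat) : (-1) ^ n = 1 \/ (-1) ^ n = -1.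
Proof. induction n as [|n [IH|IH]]; simpl; lra. Qed.

Lemma gap_pos (n : nat) (x : R) : 0 < gap n x.
Proof. apply pq_sign. Qed.

Lemma gap_abs (n : nat) (x : R) : Rabs (nxt n x - x) = gap n x.
Proof.
  assert (H := gap_pos n x); unfold gap in *.
  destruct (sign_cases n) as [E|E]; rewrite E in *.
  - rewrite Rabs_pos_eq; lra.
  - rewrite Rabs_left; lra.
Qed.

Lemma fiter_nxt (k n : nat) (x : R) : fiter k (nxt n x) = nxt n (fiter k x).
Proof.
  unfold nxt; replace (fiter (q n) x - IZR (p n)) with (fiter (q n) x + IZR (- p n))
    by (rewrite opp_IZR; ring).
  rewrite fiter_IZR, <- !fiter_add; rewrite opp_IZR, Nat.add_comm; ring.
Qed.

Lemma gap_it (k n : nat) (x : R) : gap n (fiter k x) = Rabs (fiter k (nxt n x) - fiter k x).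
Proof. now rewrite fiter_nxt, gap_abs. Qed.

(* The intervals between [F^k x] and [F^k (nxt n x)] for [k < q (n+1)], together with those between
   [F^k (nxt (n+1) x)] and [F^k x] for [k < q n], tile the circle.  All that is ever used of this
   fact is the telescoping identity below, which is purely algebraic. *)
Lemma tiling (L : R -> R) (d : R) (n : nat) (x : R) :
  (forall y, L (y + 1) = L y + d) ->
  psum (fun k => (-1) ^ n * (L (fiter k (nxt n x)) - L (fiter k x))) (q (S n)) +
  psum (fun k => (-1) ^ n * (L (fiter k x) - L (fiter k (nxt (S n) x)))) (q n) = d.
Proof.
  intros HL.
  assert (E : forall m k, L (fiter k (nxt m x)) = L (fiter (k + q m) x) - IZR (p m) * d).
  { intros m k; rewrite fiter_nxt; unfold nxt.
    rewrite <- fiter_add.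
    replace (fiter (k + q m) x - IZR (p m)) with (fiter (k + q m) x + IZR (- p m))
      by (rewrite opp_IZR; ring).
    rewrite (periodic_IZR L d HL), opp_IZR; ring. }
  rewrite 2!psum_scal, <- Rmult_plus_distr_l.
  rewrite (psum_ext _ (fun k => (L (fiter (k + q n) x) - L (fiter k x)) - IZR (p n) * d) (q (S n)))
    by (intros; rewrite E; ring).
  rewrite (psum_ext (fun k => _ - L (fiter k (nxt (S n) x)))
    (fun k => IZR (p (S n)) * d - (L (fiter (k + q (S n)) x) - L (fiter k x))) (q n))
    by (intros; rewrite E; ring).
  rewrite !psum_minus, !psum_const.
  assert (H := psum_shift_comm (fun k => L (fiter k x)) (q n) (q (S n))); simpl in H.
  assert (Hd := pq_det n).
  transitivity ((-1) ^ n * (d * (IZR (p (S n)) * INR (q n) - IZR (p n) * INR (q (S n))))).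
  - f_equal; lra.
  - rewrite Hd; destruct (sign_cases n) as [-> | ->]; ring.
Qed.

Lemma tiling_length (n : nat) (x : R) :
  psum (fun k => gap n (fiter k x)) (q (S n)) + psum (fun k => gap (S n) (fiter k x)) (q n) = 1.
Proof.
  rewrite <- (tiling (fun y => y) 1 n x) by easy.
  f_equal; apply psum_ext; intros k _; rewrite fiter_nxt; unfold gap; simpl; ring.
Qed.

Lemma sum_gap_le (n j : nat) (x : R) :
  (j <= q (S n))%nat -> psum (fun k => gap n (fiter k x)) j <= 1.
Proof.
  intros Hj; rewrite <- (tiling_length n x).
  assert (0 <= psum (fun k => gap (S n) (fiter k x)) (q n))
    by (apply psum_nonneg; intros; apply Rlt_le, gap_pos).
  assert (psum (fun k => gap n (fiter k x)) j <= psum (fun k => gap n (fiter k x)) (q (S n)))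
    by (apply psum_mono; [intros; apply Rlt_le, gap_pos|easy]).
  lra.
Qed.

Definition between (x y a : R) : Prop := Rmin x y <= a <= Rmax x y.

Lemma between_l (x y : R) : between x y x.
Proof. split; [apply Rmin_l|apply Rmax_l]. Qed.

Lemma between_r (x y : R) : between x y y.
Proof. split; [apply Rmin_r|apply Rmax_r]. Qed.

Lemma between_dist (x y a b : R) :
  between x y a -> between x y b -> Rabs (a - b) <= Rabs (y - x).
Proof.
  unfold between, Rmin, Rmax; destruct (Rle_dec x y); intros.
  - rewrite (Rabs_pos_eq (y - x)) by lra; apply Rabs_le; lra.
  - rewrite (Rabs_left (y - x)) by lra; apply Rabs_le; lra.
Qed.

Lemma between_it (k : nat) (x y a : R) : between x y a -> between (fiter k x) (fiter k y) (fiter k a).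
Proof.
  assert (M := fiter_mono k).
  unfold between, Rmin, Rmax.
  destruct (Rle_dec x y) as [H|H]; intros [H1 H2].
  - assert (fiter k x <= fiter k y) by now apply M.
    destruct (Rle_dec (fiter k x) (fiter k y)); [|lra].
    split; now apply M.
  - assert (fiter k y <= fiter k x) by (apply M; lra).
    destruct (Rle_dec (fiter k x) (fiter k y)).
    + assert (fiter k y <= fiter k a) by now apply M. assert (fiter k a <= fiter k x) by now apply M. lra.
    + split; now apply M.
Qed.

(** For these [j] the intervals met along the way are tiles of a single tiling, so their lengths add
    up to at most 1. *)
Definition distortion (n : nat) (v : R) : Prop :=
  forall x a b j, (j <= q (S n))%nat -> between x (nxt n x) a -> between x (nxt n x) b ->
    Rabs (logD j a - logD j b) <= v.

(** log DF is [V]-Lipschitz, the points F^k a and F^k b lie in one tile, and the tiles have total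
    length at most 1. *)
Lemma denjoy_distortion (n : nat) : distortion n V.
Proof.
  intros x a b j Hj Ha Hb; assert (HV := V_nonneg).
  unfold logD; rewrite <- psum_minus; eapply Rle_trans; [apply psum_Rabs|].
  apply Rle_trans with (psum (fun k => V * gap n (fiter k x)) j).
  - apply psum_le; intros k _; eapply Rle_trans; [apply ld_lip|].
    apply Rmult_le_compat_l; [easy|].
    rewrite gap_it; apply between_dist; now apply between_it.
  - rewrite psum_scal; assert (H := sum_gap_le n j x Hj); nra.
Qed.
Lemma exp_le_compat (x y : R) : x <= y -> exp x <= exp y.
Proof. intros [H| ->]; [now apply Rlt_le, exp_increasing|lra]. Qed.

Lemma gap_ratio (n j : nat) (v x : R) : distortion n v -> (j <= q (S n))%nat ->
  exp (- v) * (Diter j x * gap n x) <= gap n (fiter j x) <= exp v * (Diter j x * gap n x).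
Proof.
  intros Hv Hj.
  destruct (mean_value (fiter j) (Diter j) x (nxt n x) (fiter_derive j)) as (c & Hc & E).
  rewrite gap_it, E, Rabs_mult, gap_abs, (Rabs_pos_eq (Diter j c)) by apply Rlt_le, Diter_pos.
  assert (H := Hv x c x j Hj Hc (between_l _ _)); apply Rabs_le_between in H.
  assert (HG := gap_pos n x).
  rewrite <- !Rmult_assoc; unfold Diter; rewrite <- !exp_plus.
  split; (apply Rmult_le_compat_r; [lra|apply exp_le_compat; lra]).
Qed.

(** F^k commutes with F^(q_n), so by the chain rule the difference equals log DF^k at F^(q_n) x
    minus log DF^k at x. Up to an integer these are the two ends of the interval from [x] to
    [nxt n x]. *)
Lemma logD_return (n k : nat) (v x : R) : distortion n v -> (k <= q (S n))%nat ->
  Rabs (logD (q n) (fiter k x) - logD (q n) x) <= v.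
Proof.
  intros Hv Hk.
  assert (E := logD_add k (q n) x); rewrite Nat.add_comm, logD_add in E.
  replace (logD (q n) (fiter k x) - logD (q n) x) with (logD k (fiter (q n) x) - logD k x) by lra.
  replace (fiter (q n) x) with (nxt n x + IZR (p n)) by (unfold nxt; ring).
  rewrite logD_IZR; apply (Hv x); [easy|apply between_r|apply between_l].
Qed.

(** F^(q_n) carries the tiling based at [x] to the one based at F^(q_n) x. Each tile is multiplied
    by DF^(q_n) x up to a factor exp (2 v), and both tilings have total length 1, so DF^(q_n) x is
    itself within that factor of 1. *)
Lemma logD_q_bound (n : nat) (v x : R) : distortion n v -> distortion (S n) v ->
  Rabs (logD (q n) x) <= 2 * v.
Proof.
  intros Hv HSv.
  (* One [v] pays for replacing the tile ratio by a derivative at its endpoint F^k x, the other for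
     moving the derivative of F^(q_n) from F^k x back to [x]. *)
  assert (B : forall m k, (m = n \/ m = S n) -> (k <= q (S n))%nat ->
    exp (- (2 * v)) * Diter (q n) x * gap m (fiter k x) <= gap m (fiter k (fiter (q n) x))
      <= exp (2 * v) * Diter (q n) x * gap m (fiter k x)).
  { intros m k Hm Hk.
    replace (fiter k (fiter (q n) x)) with (fiter (q n) (fiter k x)) by (now rewrite <- !fiter_add, Nat.add_comm).
    assert (Hr : exp (- v) * (Diter (q n) (fiter k x) * gap m (fiter k x)) <= gap m (fiter (q n) (fiter k x))
      <= exp v * (Diter (q n) (fiter k x) * gap m (fiter k x))).
    { destruct Hm as [-> | ->]; apply gap_ratio; auto.
      apply (Nat.le_trans _ (q (S n))); auto. }
    assert (HG := gap_pos m (fiter k x)).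
    assert (H := logD_return n k v x Hv Hk); apply Rabs_le_between in H.
    rewrite <- !Rmult_assoc in Hr; unfold Diter in Hr |- *; rewrite <- !exp_plus in Hr |- *.
    split; [eapply Rle_trans; [|apply Hr]|eapply Rle_trans; [apply Hr|]];
      (apply Rmult_le_compat_r; [lra|apply exp_le_compat; lra]). }
  assert (T1 := tiling_length n x); assert (T2 := tiling_length n (fiter (q n) x)).
  assert (L : exp (- (2 * v)) * Diter (q n) x <= 1).
  { rewrite <- T2, <- (Rmult_1_r (_ * _)), <- T1, Rmult_plus_distr_l, <- !psum_scal.
    apply Rplus_le_compat; apply psum_le; intros k Hk; apply B; auto; [lia|].
    specialize (q_le n); lia. }
  assert (U : 1 <= exp (2 * v) * Diter (q n) x).
  { rewrite <- T2, <- (Rmult_1_r (_ * Diter _ _)), <- T1, Rmult_plus_distr_l, <- !psum_scal.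
    apply Rplus_le_compat; apply psum_le; intros k Hk; apply B; auto; [lia|].
    specialize (q_le n); lia. }
  unfold Diter in L, U; rewrite <- exp_plus, <- exp_0 in L, U.
  assert (L' : - (2 * v) + logD (q n) x <= 0) by (apply Rnot_lt_le; intros H%exp_increasing; lra).
  assert (U' : 0 <= 2 * v + logD (q n) x) by (apply Rnot_lt_le; intros H%exp_increasing; lra).
  apply Rabs_le; lra.
Qed.

Lemma Diter_q_bounds (n : nat) (x : R) : exp (- (2 * V)) <= Diter (q n) x <= exp (2 * V).
Proof.
  assert (H := logD_q_bound n V x (denjoy_distortion n) (denjoy_distortion (S n))).
  apply Rabs_le_between in H; unfold Diter; split; apply exp_le_compat; lra.
Qed.

Lemma Diter_gap_le (n k : nat) (x : R) : (k <= q (S n))%nat ->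
  Diter k x * gap n x <= exp V * gap n (fiter k x).
Proof.
  intros Hk; destruct (gap_ratio n k V x (denjoy_distortion n) Hk) as [H _].
  apply (Rmult_le_compat_l (exp V)) in H; [|apply Rlt_le, exp_pos].
  rewrite <- Rmult_assoc, <- exp_plus, Rplus_opp_r, exp_0 in H; lra.
Qed.

Lemma gap_Dsum_le (n j : nat) (x : R) : (j <= q (S n))%nat -> gap n x * Dsum j x <= exp V.
Proof.
  intros Hj; unfold Dsum; rewrite <- psum_scal.
  apply Rle_trans with (psum (fun k => exp V * gap n (fiter k x)) j).
  - apply psum_le; intros k Hk; rewrite Rmult_comm; apply Diter_gap_le; lia.
  - rewrite psum_scal; assert (H := sum_gap_le n j x Hj); assert (HV := exp_pos V); nra.
Qed.

(** Passing from q_(n+1) to q_(n+2) adds at least the term of index q_(n+1), which Denjoy's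
    inequality bounds below. *)
Lemma Dsum_growth (n : nat) (x : R) : INR n * exp (- (2 * V)) <= Dsum (q (S n)) x.
Proof.
  induction n as [|n IH]; [simpl; rewrite Rmult_0_l; apply Dsum_nonneg|].
  rewrite S_INR; apply Rle_trans with (Dsum (S (q (S n))) x).
  - change (Dsum (S (q (S n))) x) with (Dsum (q (S n)) x + Diter (q (S n)) x).
    destruct (Diter_q_bounds (S n) x); lra.
  - apply Dsum_mono, q_lt.
Qed.

(** A growing [Dsum] times [gap] stays bounded, so the tiles shrink at rate 1 / n, uniformly in [x].
    Every later o(1) comes from this rate. *)
Lemma gap_small (n : nat) (x : R) : INR n * gap n x <= exp (3 * V).
Proof.
  assert (H1 := Dsum_growth n x); assert (H2 := gap_Dsum_le n (q (S n)) x (Nat.le_refl _)).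
  assert (HG := gap_pos n x).
  replace (3 * V) with (V + 2 * V) by ring; rewrite exp_plus.
  replace (INR n * gap n x) with (gap n x * (INR n * exp (- (2 * V))) * exp (2 * V)).
  - apply Rmult_le_compat_r; [apply Rlt_le, exp_pos|].
    eapply Rle_trans; [apply Rmult_le_compat_l; [lra|exact H1]|easy].
  - transitivity (INR n * gap n x * (exp (- (2 * V)) * exp (2 * V))); [ring|].
    rewrite <- exp_plus; replace (- (2 * V) + 2 * V) with 0 by ring; rewrite exp_0; ring.
Qed.

Lemma gap_S_small (n : nat) (x : R) : INR n * gap (S n) x <= exp (3 * V).
Proof.
  assert (H := gap_small (S n) x); rewrite S_INR in H; assert (HG := gap_pos (S n) x); lra.
Qed.

Lemma gap_it_le (n k : nat) (x : R) : (k <= q (S n))%nat ->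
  gap n (fiter k x) <= exp V * (Diter k x * gap n x).
Proof. intros Hk; now destruct (gap_ratio n k V x (denjoy_distortion n) Hk). Qed.

Lemma gap_S_it_le (n k : nat) (x : R) : (k <= q (S n))%nat ->
  gap (S n) (fiter k x) <= exp V * (Diter k x * gap (S n) x).
Proof. intros Hk; apply gap_it_le; specialize (q_le (S n)); lia. Qed.

(** Converse of [gap_Dsum_le]: the tiles cover the circle, and each is at most exp V times the
    corresponding derivative times its initial tile. *)
Lemma Dsum_lower (n : nat) (x : R) : 1 <= exp V * (gap n x + gap (S n) x) * Dsum (q (S n)) x.
Proof.
  rewrite <- (tiling_length n x).
  assert (G1 := gap_pos n x); assert (G2 := gap_pos (S n) x); assert (HV := exp_pos V).
  rewrite Rmult_plus_distr_l, Rmult_plus_distr_r.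
  apply Rplus_le_compat.
  - unfold Dsum; rewrite <- psum_scal; apply psum_le; intros k Hk.
    eapply Rle_trans; [apply gap_it_le; lia|]; right; ring.
  - apply Rle_trans with (exp V * gap (S n) x * Dsum (q n) x).
    + unfold Dsum; rewrite <- psum_scal; apply psum_le; intros k Hk.
      eapply Rle_trans; [apply gap_S_it_le; specialize (q_le n); lia|]; right; ring.
    + apply Rmult_le_compat_l; [apply Rmult_le_pos; lra|apply Dsum_mono, q_le].
Qed.

(** A single term is a fraction O(1 / n) of the whole sum: DF^k x times the two initial tiles is
    comparable to two tiles at F^k x, each O(1 / n), and [Dsum_lower] converts this into a share of
    [Dsum]. The exponent 5 V is V + 3 V + V. *)
Lemma Diter_le_Dsum (n k : nat) (x : R) : (k <= q (S n))%nat ->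
  INR n * Diter k x <= 2 * exp (5 * V) * Dsum (q (S n)) x.
Proof.
  intros Hk.
  assert (H1 := Diter_gap_le n k x Hk).
  assert (H2 : Diter k x * gap (S n) x <= exp V * gap (S n) (fiter k x))
    by (apply Diter_gap_le; specialize (q_le (S n)); lia).
  assert (H3 := gap_small n (fiter k x)); assert (H4 := gap_S_small n (fiter k x)).
  assert (H5 := Dsum_lower n x); assert (HD := Diter_pos k x).
  assert (HV := exp_pos V); assert (Hn := pos_INR n); assert (Hs := Dsum_nonneg (q (S n)) x).
  assert (E5 : exp (5 * V) = exp V * exp V * exp (3 * V)) by (rewrite <- !exp_plus; f_equal; ring).
  assert (H6 : INR n * (Diter k x * (gap n x + gap (S n) x)) <= exp V * (2 * exp (3 * V))).
  { apply Rle_trans with (exp V * (INR n * gap n (fiter k x) + INR n * gap (S n) (fiter k x))).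
    - replace (exp V * _) with (INR n * (exp V * gap n (fiter k x) + exp V * gap (S n) (fiter k x))) by ring.
      apply Rmult_le_compat_l; [easy|]; lra.
    - apply Rmult_le_compat_l; lra. }
  rewrite E5.
  apply Rle_trans with (INR n * Diter k x * (exp V * (gap n x + gap (S n) x) * Dsum (q (S n)) x)).
  - rewrite <- (Rmult_1_r (INR n * Diter k x)) at 1; apply Rmult_le_compat_l; [|easy].
    apply Rmult_le_pos; lra.
  - replace (INR n * Diter k x * _)
      with (INR n * (Diter k x * (gap n x + gap (S n) x)) * (exp V * Dsum (q (S n)) x)) by ring.
    replace (2 * _ * _) with (exp V * (2 * exp (3 * V)) * (exp V * Dsum (q (S n)) x)) by ring.
    apply Rmult_le_compat_r; [apply Rmult_le_pos; lra|easy].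
Qed.

(** * Averaging along orbits and contraction of the nonlinearity *)

(** By the cocycle law the summand is X (k + M) - X k, so the sum telescopes in steps of length [M].
    A weighted orbit average of [X M] is thus [M] copies of [X N], up to boundary terms. *)
Lemma cocycle_average (X : nat -> R -> R) (M N : nat) (x : R) :
  (forall i j x, X (i + j)%nat x = X i x + Diter i x * X j (fiter i x)) ->
  psum (fun k => Diter k x * X M (fiter k x)) N =
  INR M * X N x + psum (fun l => Diter N x * X l (fiter N x) - X l x) M.
Proof.
  intros HX.
  rewrite (psum_ext _ (fun k => X (k + M)%nat x - X k x)) by (intros; rewrite HX; ring).
  rewrite psum_minus, (psum_shift_comm (fun k => X k x)), <- psum_const, <- psum_minus, <- psum_plus.
  apply psum_ext; intros k _; rewrite Nat.add_comm, HX; ring.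
Qed.

(** At a time q_n the derivative is at most exp (2 V), so the boundary terms are bounded
    independently of the level. *)
Lemma cocycle_error (X : nat -> R -> R) (M n : nat) (B x : R) :
  (forall l y, (l < M)%nat -> Rabs (X l y) <= B) ->
  Rabs (psum (fun l => Diter (q n) x * X l (fiter (q n) x) - X l x) M) <= INR M * ((exp (2 * V) + 1) * B).
Proof.
  intros HB; eapply Rle_trans; [apply psum_Rabs|]; rewrite <- psum_const; apply psum_le.
  intros l Hl; unfold Rminus; eapply Rle_trans; [apply Rabs_triang|].
  rewrite Rabs_Ropp, Rabs_mult, (Rabs_pos_eq (Diter _ _)) by apply Rlt_le, Diter_pos.
  rewrite Rmult_plus_distr_r, Rmult_1_l; apply Rplus_le_compat; [|now apply HB].
  apply Rmult_le_compat; [apply Rlt_le, Diter_pos|apply Rabs_pos|apply Diter_q_bounds|now apply HB].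
Qed.
(* If [h = G' >= 0] has mean [s M], then the weights [Diter k x], [k < q (n+1)], being comparable to the
   lengths of tiles, see a definite proportion of that mean. *)
Lemma weighted_mean_lower (G h : R -> R) (d Ch : R) (n : nat) (x : R) :
  (forall y, is_derive G y (h y)) -> (forall y, G (y + 1) = G y + d) ->
  (forall y, 0 <= h y) -> 0 <= Ch -> (forall y z, Rabs (h y - h z) <= Ch * Rabs (y - z)) ->
  INR n * d * Dsum (q (S n)) x <=
  INR n * (2 * exp (2 * V) * psum (fun k => Diter k x * h (fiter k x)) (q (S n)))
  + Ch * exp (3 * V) * Dsum (q (S n)) x.
Proof.
  intros HG HG1 Hh HCh HhL.
  set (N := q (S n)); set (S0 := psum (fun k => Diter k x * h (fiter k x)) N).
  assert (HV := exp_pos V); assert (Hn := pos_INR n).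
  assert (HS : 0 <= S0).
  { apply psum_nonneg; intros; apply Rmult_le_pos; [apply Rlt_le, Diter_pos|apply Hh]. }
  (* The mean value theorem evaluates [h] inside the tile. Moving it to the endpoint [z] costs
     [Ch * gap], and the resulting squared gap loses one factor to [INR n * gap <= exp (3 * V)]. *)
  assert (tile : forall m z, (m = n \/ m = S n) ->
    INR n * ((-1) ^ m * (G (nxt m z) - G z)) <=
    INR n * (h z * gap m z) + Ch * exp (3 * V) * gap m z).
  { intros m z Hm; destruct (mean_value G h z (nxt m z) HG) as (c & Hc & ->).
    replace ((-1) ^ m * (h c * (nxt m z - z))) with (h c * gap m z) by (unfold gap; ring).
    assert (Hm' := gap_pos m z).
    assert (INR n * gap m z <= exp (3 * V)) by (destruct Hm as [-> | ->];
      [apply gap_small|apply gap_S_small]).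
    assert (Hd := HhL c z); apply Rabs_le_between in Hd.
    assert (Hd' := between_dist _ _ _ _ Hc (between_l _ _)); rewrite gap_abs in Hd'.
    assert (Hd2 : h c <= h z + Ch * gap m z) by nra.
    apply Rle_trans with (INR n * ((h z + Ch * gap m z) * gap m z)).
    - apply Rmult_le_compat_l; [easy|]; apply Rmult_le_compat_r; lra.
    - replace (INR n * ((h z + Ch * gap m z) * gap m z))
        with (INR n * (h z * gap m z) + Ch * (INR n * gap m z) * gap m z) by ring.
      apply Rplus_le_compat_l, Rmult_le_compat_r; [lra|].
      apply Rmult_le_compat_l; easy. }
  assert (HT : INR n * d <=
    INR n * (psum (fun k => h (fiter k x) * gap n (fiter k x)) N
             + psum (fun k => h (fiter k x) * gap (S n) (fiter k x)) (q n)) + Ch * exp (3 * V)).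
  { rewrite <- (tiling G d n x HG1), <- (Rmult_1_r (Ch * _)), <- (tiling_length n x).
    rewrite !Rmult_plus_distr_l, <- !psum_scal.
    apply Rle_trans with
      (psum (fun k => INR n * (h (fiter k x) * gap n (fiter k x)) + Ch * exp (3 * V) * gap n (fiter k x)) N +
       psum (fun k => INR n * (h (fiter k x) * gap (S n) (fiter k x))
                      + Ch * exp (3 * V) * gap (S n) (fiter k x)) (q n)).
    - apply Rplus_le_compat; apply psum_le; intros k _; rewrite fiter_nxt.
      + apply tile; auto.
      + replace ((-1) ^ n * (G (fiter k x) - G (nxt (S n) (fiter k x))))
          with ((-1) ^ S n * (G (nxt (S n) (fiter k x)) - G (fiter k x))) by (simpl; ring).
        apply tile; auto.
    - rewrite !psum_plus; fold N; lra. }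
  assert (HS1 : psum (fun k => h (fiter k x) * gap n (fiter k x)) N <= exp V * gap n x * S0).
  { unfold S0; rewrite <- psum_scal; apply psum_le; intros k Hk.
    replace (exp V * gap n x * (Diter k x * h (fiter k x)))
      with (h (fiter k x) * (exp V * (Diter k x * gap n x))) by ring.
    apply Rmult_le_compat_l; [apply Hh|apply gap_it_le; unfold N in Hk; lia]. }
  assert (HS2 : psum (fun k => h (fiter k x) * gap (S n) (fiter k x)) (q n) <= exp V * gap (S n) x * S0).
  { apply Rle_trans with (psum (fun k => h (fiter k x) * gap (S n) (fiter k x)) N).
    - apply psum_mono; [|apply q_le].
      intros k; apply Rmult_le_pos; [apply Hh|apply Rlt_le, gap_pos].
    - unfold S0; rewrite <- psum_scal; apply psum_le; intros k Hk.
      replace (exp V * gap (S n) x * (Diter k x * h (fiter k x)))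
        with (h (fiter k x) * (exp V * (Diter k x * gap (S n) x))) by ring.
      apply Rmult_le_compat_l; [apply Hh|apply gap_S_it_le; unfold N in Hk; lia]. }
  assert (Hs := Dsum_nonneg N x).
  assert (A1 : gap n x * Dsum N x <= exp V) by (apply gap_Dsum_le; easy).
  assert (A2 : gap (S n) x * Dsum N x <= exp V) by (apply gap_Dsum_le; unfold N; apply q_le).
  apply Rle_trans with ((INR n * (exp V * gap n x * S0 + exp V * gap (S n) x * S0)
     + Ch * exp (3 * V)) * Dsum N x).
  { apply Rmult_le_compat_r; [easy|]; eapply Rle_trans; [exact HT|].
    apply Rplus_le_compat_r, Rmult_le_compat_l; lra. }
  rewrite Rmult_plus_distr_r; apply Rplus_le_compat_r.
  rewrite Rmult_assoc; apply Rmult_le_compat_l; [easy|].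
  replace (2 * V) with (V + V) by ring; rewrite exp_plus.
  replace ((exp V * gap n x * S0 + exp V * gap (S n) x * S0) * Dsum N x)
    with (exp V * S0 * (gap n x * Dsum N x + gap (S n) x * Dsum N x)) by ring.
  replace (2 * (exp V * exp V) * S0) with (exp V * S0 * (exp V + exp V)) by ring.
  apply Rmult_le_compat_l; [apply Rmult_le_pos; lra|lra].
Qed.

(** For each sign, s times [Dsum M] minus the signed [nonlin M] is nonnegative. The averaging
    identity turns its weighted sum along the orbit into M times the same expression at time
    q_(n+1), and the lower bound for weighted means keeps at least the share exp (-2 V) / 2 of s.
    What is kept is exactly what the new bound gains over s. *)
Lemma contraction (M : nat) (s : R) : (1 <= M)%nat ->
  (forall x, Rabs (nonlin M x) <= s * Dsum M x) ->
  exists C, forall n x, (1 <= n)%nat ->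
    Rabs (nonlin (q (S n)) x) <= ((1 - exp (- (2 * V)) / 2) * s + C / INR n) * Dsum (q (S n)) x.
Proof.
  intros HM Hs.
  destruct (Dsum_bl M) as (C0 & HC0 & HC0b & HC0l).
  destruct (nonlin_bl M) as (C1 & HC1 & HC1b & HC1l).
  assert (Hs0 : 0 <= s).
  { specialize (Hs 0); assert (0 <= Rabs (nonlin M 0)) by apply Rabs_pos.
    assert (1 <= Dsum M 0) by now apply Dsum_pos. nra. }
  assert (HV := V_nonneg).
  set (E := exp (2 * V)); assert (HE : 0 < E) by apply exp_pos.
  assert (HEa : exp (- (2 * V)) = / E) by apply exp_Ropp.
  set (B := (s + V) * ((E + 1) * C0)).
  assert (HB : 0 <= B) by (unfold B; apply Rmult_le_pos; [lra|apply Rmult_le_pos; lra]).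
  set (Ch := s * C0 + C1).
  assert (HCh : 0 <= Ch) by (unfold Ch; assert (0 <= s * C0) by (now apply Rmult_le_pos); lra).
  set (C := B * E + Ch * exp (3 * V) / E).
  exists C; intros n x Hn.
  assert (Hn0 : 0 < INR n) by (apply lt_0_INR; lia).
  assert (HMR : 1 <= INR M) by (change 1 with (INR 1); apply le_INR; lia).
  set (N := q (S n)).
  assert (Hsg := Dsum_nonneg N x).
  assert (Hsl : forall l y, (l < M)%nat -> Rabs (Dsum l y) <= C0).
  { intros l y Hl; eapply Rle_trans; [|apply (HC0b y)].
    rewrite 2!Rabs_pos_eq by apply Dsum_nonneg; apply Dsum_mono; lia. }
  assert (Hpl : forall l y, (l < M)%nat -> Rabs (nonlin l y) <= V * C0).
  { intros l y Hl; eapply Rle_trans; [apply nonlin_le_Dsum|]; apply Rmult_le_compat_l; [easy|].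
    eapply Rle_trans; [apply Rle_abs|now apply Hsl]. }
  assert (main : forall e, e = 1 \/ e = -1 ->
    e * nonlin N x <= ((1 - exp (- (2 * V)) / 2) * s + C / INR n) * Dsum N x).
  { intros e He.
    (* [h] is the derivative of s times the sum of F^l over l < M, minus e log DF^M. Over one period
       this primitive increases by s M, since each F^l has degree one and log DF^M is periodic. *)
    set (h := fun y => s * Dsum M y - e * nonlin M y).
    assert (Hh : forall y, 0 <= h y).
    { intros y; assert (H := Hs y); apply Rabs_le_between in H; unfold h.
      destruct He as [-> | ->]; lra. }
    assert (W := weighted_mean_lower
      (fun y => s * psum (fun l => fiter l y) M - e * logD M y) h (s * INR M) Ch n x).
    fold N in W; fold E in W.
    assert (HS : psum (fun k => Diter k x * h (fiter k x)) N <=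
       INR M * (s * Dsum N x - e * nonlin N x) + INR M * B).
    { rewrite (psum_ext _ (fun k => s * (Diter k x * Dsum M (fiter k x)) - e * (Diter k x * nonlin M (fiter k x))))
        by (intros; unfold h; ring).
      rewrite psum_minus, !psum_scal, (cocycle_average Dsum), (cocycle_average nonlin)
        by (intros; try apply Dsum_add; apply nonlin_add).
      assert (K1 := cocycle_error Dsum M (S n) C0 x Hsl).
      assert (K2 := cocycle_error nonlin M (S n) (V * C0) x Hpl).
      fold N in K1, K2; fold E in K1, K2.
      apply Rabs_le_between in K1; apply Rabs_le_between in K2.
      assert (K3 := Rmult_le_compat_l s _ _ Hs0 (proj2 K1)).
      unfold B; destruct He as [-> | ->]; lra. }
    assert (W' : INR n * (s * INR M) * Dsum N x <=
      INR n * (2 * E * psum (fun k => Diter k x * h (fiter k x)) N) + Ch * exp (3 * V) * Dsum N x).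
    { apply W; [| |exact Hh|exact HCh|].
      - intros y; unfold h.
        apply (is_derive_minus (V := R_NormedModule) (fun y => s * psum (fun l => fiter l y) M)
          (fun y => e * logD M y)).
        + apply (is_derive_scal (fun y => psum (fun l => fiter l y) M)).
          apply (is_derive_psum fiter Diter); intros; apply fiter_derive.
        + apply (is_derive_scal (logD M)), logD_derive.
      - intros y.
        rewrite (psum_ext (fun l => fiter l (y + 1)) (fun l => fiter l y + 1))
          by (intros; apply (fiter_IZR _ _ 1)).
        rewrite (logD_IZR M y 1), psum_plus, psum_const; ring.
      - intros y z; unfold h.
        replace (s * Dsum M y - e * nonlin M y - (s * Dsum M z - e * nonlin M z))
          with (s * (Dsum M y - Dsum M z) - e * (nonlin M y - nonlin M z)) by ring.
        eapply Rle_trans; [apply Rabs_triang|].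
        rewrite Rabs_Ropp, 2!Rabs_mult, (Rabs_pos_eq s) by easy.
        replace (Rabs e) with 1 by (destruct He as [-> | ->]; [now rewrite Rabs_R1|
          rewrite Rabs_left; lra]).
        specialize (HC0l y z); specialize (HC1l y z); unfold Ch.
        assert (K := Rmult_le_compat_l s _ _ Hs0 HC0l); lra. }
    (* Turns the absolute boundary error [B] into the relative error [B * E / INR n]. *)
    assert (G : INR n <= E * Dsum N x).
    { assert (K := Dsum_growth n x); fold N in K; rewrite HEa in K.
      apply (Rmult_le_compat_l E) in K; [|lra].
      replace (E * (INR n * / E)) with (INR n) in K by (field; lra); exact K. }
    assert (X : INR n * INR M * (s * Dsum N x) <=
      2 * E * INR n * INR M * (s * Dsum N x - e * nonlin N x + B) + INR M * (Ch * exp (3 * V) * Dsum N x)).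
    { assert (K := Rmult_le_compat_l (2 * E * INR n) _ _
        (Rlt_le _ _ (Rmult_lt_0_compat _ _ (Rmult_lt_0_compat 2 E ltac:(lra) HE) Hn0)) HS).
      assert (0 <= Ch * exp (3 * V) * Dsum N x).
      { apply Rmult_le_pos; [apply Rmult_le_pos; [easy|apply Rlt_le, exp_pos]|easy]. }
      assert (1 * (Ch * exp (3 * V) * Dsum N x) <= INR M * (Ch * exp (3 * V) * Dsum N x))
        by now apply Rmult_le_compat_r.
      lra. }
    assert (Y : INR n * (s * Dsum N x) <=
      2 * E * INR n * (s * Dsum N x - e * nonlin N x + B) + Ch * exp (3 * V) * Dsum N x).
    { apply (Rmult_le_reg_l (INR M)); lra. }
    assert (Z : INR n * (e * nonlin N x) <=
      INR n * ((1 - / E / 2) * s * Dsum N x) + INR n * B + Ch * exp (3 * V) / (2 * E) * Dsum N x).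
    { apply (Rmult_le_reg_l (2 * E)); [lra|].
      replace (2 * E * (INR n * ((1 - / E / 2) * s * Dsum N x) + INR n * B
         + Ch * exp (3 * V) / (2 * E) * Dsum N x))
        with (2 * E * INR n * (s * Dsum N x + B) - INR n * (s * Dsum N x) + Ch * exp (3 * V) * Dsum N x)
        by (field; lra).
      lra. }
    assert (T : INR n * B <= B * E * Dsum N x).
    { replace (B * E * Dsum N x) with (E * Dsum N x * B) by ring; now apply Rmult_le_compat_r. }
    assert (T2 : Ch * exp (3 * V) / (2 * E) * Dsum N x <= Ch * exp (3 * V) / E * Dsum N x).
    { apply Rmult_le_compat_r; [easy|]; unfold Rdiv; apply Rmult_le_compat_l.
      - apply Rmult_le_pos; [easy|apply Rlt_le, exp_pos].
      - apply Rinv_le_contravar; lra. }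
    rewrite HEa; apply (Rmult_le_reg_l (INR n)); [easy|].
    replace (INR n * (((1 - / E / 2) * s + C / INR n) * Dsum N x))
      with (INR n * ((1 - / E / 2) * s * Dsum N x) + C * Dsum N x) by (field; lra).
    unfold C; lra. }
  apply Rabs_le; split; [specialize (main (-1) (or_intror eq_refl))|
    specialize (main 1 (or_introl eq_refl))]; lra.
Qed.

Lemma nonlin_q_small (eps : R) : 0 < eps -> exists M, (1 <= M)%nat /\
  forall x, Rabs (nonlin M x) <= eps * Dsum M x.
Proof.
  intros Heps; assert (HV := V_nonneg).
  set (c := exp (- (2 * V)) / 2).
  assert (Hc : 0 < c <= 1 / 2).
  { unfold c; assert (H := exp_pos (- (2 * V))).
    assert (exp (- (2 * V)) <= exp 0) by (apply exp_le_compat; lra); rewrite exp_0 in *; lra. }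
  (* Starting from [V + 1] rather than [V] keeps [s] positive. Half of the gain is spent on the
     error: the factor [1 - c] is relaxed to [1 - c / 2], and the level is raised until [C / n] is
     at most [c * s / 2]. *)
  assert (step : forall k, exists M, (1 <= M)%nat /\
    forall x, Rabs (nonlin M x) <= (V + 1) * (1 - c / 2) ^ k * Dsum M x).
  { induction k as [|k (M & HM & IH)].
    - exists 1%nat; split; [lia|]; intros x; simpl; rewrite Rmult_1_r.
      eapply Rle_trans; [apply nonlin_le_Dsum|]; apply Rmult_le_compat_r; [apply Dsum_nonneg|lra].
    - set (s := (V + 1) * (1 - c / 2) ^ k) in *.
      assert (Hs : 0 < s) by (apply Rmult_lt_0_compat; [lra|apply pow_lt; lra]).
      destruct (contraction M s HM IH) as [C HC].
      assert (Hd : 0 < c * s / 2) by (apply Rdiv_lt_0_compat; [apply Rmult_lt_0_compat; lra|lra]).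
      destruct (nfloor_ex (Rabs C / (c * s / 2))) as (n & Hn).
      { apply Rmult_le_pos; [apply Rabs_pos|now apply Rlt_le, Rinv_0_lt_compat]. }
      exists (q (S (S n))); split; [apply q_pos|]; intros x.
      eapply Rle_trans; [apply HC; lia|].
      apply Rmult_le_compat_r; [apply Dsum_nonneg|].
      assert (HR : 0 < INR (S n)) by (apply lt_0_INR; lia).
      assert (C / INR (S n) <= c * s / 2).
      { apply (Rmult_le_reg_r (INR (S n))); [easy|].
        unfold Rdiv at 1; rewrite Rmult_assoc, Rinv_l, Rmult_1_r by lra.
        rewrite <- S_INR in Hn; destruct Hn as [_ Hn].
        assert (E := Rmult_lt_compat_r _ _ _ Hd Hn).
        unfold Rdiv at 1 in E; rewrite Rmult_assoc, Rinv_l, Rmult_1_r in E by lra.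
        assert (H := Rle_abs C); lra. }
      replace ((V + 1) * (1 - c / 2) ^ S k) with ((1 - c) * s + c * s / 2)
        by (unfold s; simpl; field).
      unfold c in *; lra. }
  destruct (pow_lt_1_zero (1 - c / 2)) with (y := eps / (V + 1)) as [k Hk].
  - rewrite Rabs_pos_eq; lra.
  - apply Rdiv_lt_0_compat; lra.
  - destruct (step k) as (M & HM & H); exists M; split; [easy|]; intros x.
    eapply Rle_trans; [apply H|]; apply Rmult_le_compat_r; [apply Dsum_nonneg|].
    specialize (Hk k (Nat.le_refl k)); apply Rabs_def2 in Hk; destruct Hk as [Hk _].
    apply Rmult_lt_compat_l with (r := V + 1) in Hk; [|lra].
    replace ((V + 1) * (eps / (V + 1))) with eps in Hk by (field; lra); lra.
Qed.

(** An arbitrary time is cut into blocks of length [M], each satisfying the good bound. Only the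
    last incomplete block escapes it; it contributes at most a constant times the derivative at its
    starting time [k]. *)
Lemma nonlin_blocks (M : nat) (eps : R) : (1 <= M)%nat -> 0 <= eps ->
  (forall x, Rabs (nonlin M x) <= eps * Dsum M x) ->
  exists C, 0 <= C /\ forall i x, exists k, (k <= i)%nat /\
    Rabs (nonlin i x) <= eps * Dsum i x + C * Diter k x.
Proof.
  intros HM Heps HP; assert (HV := V_nonneg).
  destruct (Dsum_bl M) as (C0 & HC0 & HC0b & _).
  exists (V * C0); split; [now apply Rmult_le_pos|].
  induction i as [i IH] using lt_wf_ind; intros x.
  destruct (Nat.lt_ge_cases i M) as [Hi|Hi].
  - exists O; split; [lia|].
    assert (Diter 0 x = 1) as -> by (unfold Diter, logD; simpl; apply exp_0).
    assert (0 <= eps * Dsum i x) by (apply Rmult_le_pos; [easy|apply Dsum_nonneg]).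
    assert (V * Dsum i x <= V * C0).
    { apply Rmult_le_compat_l; [easy|]; eapply Rle_trans; [|eapply Rle_trans; [|apply (HC0b x)]].
      - apply (Dsum_mono i M); lia.
      - apply Rle_abs. }
    assert (H1 := nonlin_le_Dsum i x); lra.
  - destruct (IH (i - M)%nat ltac:(lia) (fiter M x)) as (k & Hk & H).
    exists (M + k)%nat; split; [lia|].
    replace i with (M + (i - M))%nat by lia.
    rewrite nonlin_add, Dsum_add, Diter_add.
    eapply Rle_trans; [apply Rabs_triang|].
    rewrite Rabs_mult, (Rabs_pos_eq (Diter M x)) by apply Rlt_le, Diter_pos.
    assert (K := Rmult_le_compat_l _ _ _ (Rlt_le _ _ (Diter_pos M x)) H).
    specialize (HP x); lra.
Qed.

(** The incomplete block costs a single derivative, hence a fraction O(1 / n) of the sum by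
    [Diter_le_Dsum]. *)
Lemma nonlin_small (eps : R) : 0 < eps -> exists n0, forall n i x, (n0 <= n)%nat ->
  (i <= q (S n))%nat -> Rabs (nonlin i x) <= eps * Dsum (q (S n)) x.
Proof.
  intros Heps.
  destruct (nonlin_q_small (eps / 2)) as (M & HM & HP); [lra|].
  destruct (nonlin_blocks M (eps / 2) HM ltac:(lra) HP) as (C & HC & HB).
  set (K := C * (2 * exp (5 * V))).
  assert (HK : 0 <= K) by (apply Rmult_le_pos; [easy|]; assert (H := exp_pos (5 * V)); lra).
  destruct (nfloor_ex (K / (eps / 2))) as (n0 & Hn0).
  { apply Rmult_le_pos; [easy|]; apply Rlt_le, Rinv_0_lt_compat; lra. }
  exists (S n0); intros n i x Hn Hi.
  destruct (HB i x) as (k & Hk & H).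
  assert (HD := Diter_le_Dsum n k x ltac:(lia)).
  assert (Hnn : K / (eps / 2) < INR n).
  { eapply Rlt_le_trans; [apply Hn0|]; rewrite <- S_INR; now apply le_INR. }
  assert (Hnp : 0 < INR n) by (apply lt_0_INR; lia).
  apply (Rmult_lt_compat_r (eps / 2)) in Hnn; [|lra].
  unfold Rdiv at 1 in Hnn; rewrite Rmult_assoc, Rinv_l, Rmult_1_r in Hnn by lra.
  assert (Hs := Dsum_nonneg (q (S n)) x).
  assert (HX : C * Diter k x <= eps / 2 * Dsum (q (S n)) x).
  { apply (Rmult_le_reg_l (INR n)); [easy|].
    apply Rle_trans with (K * Dsum (q (S n)) x).
    - apply (Rmult_le_compat_l C) in HD; [|easy]; unfold K; lra.
    - rewrite <- Rmult_assoc; apply Rmult_le_compat_r; lra. }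
  assert (HY : eps / 2 * Dsum i x <= eps / 2 * Dsum (q (S n)) x)
    by (apply Rmult_le_compat_l; [lra|now apply Dsum_mono]).
  lra.
Qed.

(** * Estimates holding at all large levels *)

Lemma Dsum_between (n : nat) (x y : R) : between x (nxt n x) y ->
  Dsum (q (S n)) y <= exp V * Dsum (q (S n)) x.
Proof.
  intros Hy; unfold Dsum; rewrite <- psum_scal; apply psum_le; intros k Hk.
  unfold Diter; rewrite <- exp_plus; apply exp_le_compat.
  assert (H := denjoy_distortion n x y x k ltac:(lia) Hy (between_l _ _)).
  apply Rabs_le_between in H; lra.
Qed.

Lemma nonlin_gap_small (eps : R) : 0 < eps -> exists n0, forall n i x, (n0 <= n)%nat ->
  (i <= q (S n))%nat -> Rabs (nonlin i x) * gap n x <= eps.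
Proof.
  intros Heps; assert (HV := exp_pos V).
  destruct (nonlin_small (eps / exp V)) as [n0 H]; [now apply Rdiv_lt_0_compat|].
  exists n0; intros n i x Hn Hi; specialize (H n i x Hn Hi).
  assert (HG := gap_pos n x); assert (HS := gap_Dsum_le n (q (S n)) x (Nat.le_refl _)).
  apply (Rmult_le_compat_r (gap n x)) in H; [|lra]; eapply Rle_trans; [apply H|].
  replace (eps / exp V * Dsum (q (S n)) x * gap n x)
    with (eps / exp V * (gap n x * Dsum (q (S n)) x)) by ring.
  replace eps with (eps / exp V * exp V) at 2 by (field; lra).
  apply Rmult_le_compat_l; [now apply Rlt_le, Rdiv_lt_0_compat|easy].
Qed.

(** The mean value theorem bounds the variation of log DF^j by [nonlin] at an intermediate point
    times the gap. [Dsum] there is comparable to [Dsum] at [x], whose product with the gap is at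
    most exp V. *)
Lemma small_distortion (v : R) : 0 < v -> exists n0, forall n, (n0 <= n)%nat -> distortion n v.
Proof.
  intros Hv; set (E := exp (2 * V)); assert (HE : 0 < E) by apply exp_pos.
  destruct (nonlin_small (v / E)) as [n0 H]; [now apply Rdiv_lt_0_compat|].
  exists n0; intros n Hn x a b j Hj Ha Hb.
  destruct (mean_value (logD j) (nonlin j) b a (logD_derive j)) as (c & Hc & ->).
  assert (Hcb : between x (nxt n x) c).
  { unfold between, Rmin, Rmax in *; destruct (Rle_dec x (nxt n x)), (Rle_dec b a); lra. }
  rewrite Rabs_mult.
  apply Rle_trans with (v / E * (exp V * Dsum (q (S n)) x) * gap n x).
  - apply Rmult_le_compat; [apply Rabs_pos|apply Rabs_pos| |].
    + eapply Rle_trans; [now apply (H n)|]; apply Rmult_le_compat_l; [now apply Rlt_le, Rdiv_lt_0_compat|].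
      now apply Dsum_between.
    + rewrite <- (gap_abs n x); now apply between_dist.
  - assert (HS := gap_Dsum_le n (q (S n)) x (Nat.le_refl _)).
    replace (v / E * (exp V * Dsum (q (S n)) x) * gap n x)
      with (v / E * (exp V * (gap n x * Dsum (q (S n)) x))) by ring.
    replace v with (v / E * E) at 2 by (field; lra).
    apply Rmult_le_compat_l; [now apply Rlt_le, Rdiv_lt_0_compat|].
    unfold E; replace (2 * V) with (V + V) by ring; rewrite exp_plus.
    apply Rmult_le_compat_l; [apply Rlt_le, exp_pos|easy].
Qed.

(** In the sum of squares one factor [Diter * gap] is O(1 / n), and the sum of the other factors is
    at most exp V. *)
Lemma square_sum_small (n j : nat) (x : R) : (j <= q (S n))%nat ->
  INR n * (psum (fun k => Diter k x ^ 2) j * gap n x ^ 2) <= exp (5 * V).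
Proof.
  intros Hj.
  assert (HG := gap_pos n x); assert (HV := exp_pos V); assert (Hn := pos_INR n).
  apply Rle_trans with (psum (fun k => exp (4 * V) * (Diter k x * gap n x)) j).
  - rewrite (Rmult_comm _ (gap n x ^ 2)), <- 2!psum_scal; apply psum_le; intros k Hk.
    assert (H1 := Diter_gap_le n k x ltac:(lia)); assert (H2 := gap_small n (fiter k x)).
    assert (H3 := Diter_pos k x).
    replace (INR n * (gap n x ^ 2 * Diter k x ^ 2))
      with (INR n * (Diter k x * gap n x) * (Diter k x * gap n x)) by ring.
    apply Rmult_le_compat_r; [apply Rmult_le_pos; lra|].
    replace (4 * V) with (V + 3 * V) by ring; rewrite exp_plus.
    apply Rle_trans with (exp V * (INR n * gap n (fiter k x))).
    + apply (Rmult_le_compat_l (INR n)) in H1; [lra|easy].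
    + apply Rmult_le_compat_l; lra.
  - rewrite psum_scal.
    rewrite (psum_ext _ (fun k => gap n x * Diter k x)) by (intros; ring).
    rewrite psum_scal; replace (5 * V) with (4 * V + V) by ring; rewrite exp_plus.
    apply Rmult_le_compat_l; [apply Rlt_le, exp_pos|]; now apply gap_Dsum_le.
Qed.
Lemma exp_small_bounds (k : R) : 0 <= k <= 1 / 2 -> exp k <= 1 + 2 * k /\ 1 - k <= exp (- k).
Proof.
  intros Hk; assert (H := exp_ineq1_le (- k)); split; [|lra].
  assert (E : exp k * exp (- k) = 1) by (rewrite <- exp_plus, Rplus_opp_r; apply exp_0).
  assert (P := exp_pos k); nra.
Qed.

(** The first clause compares the height of the curve over F^j x with the scaled height; the second
    makes DF^(q_n) close to 1. The third and fourth bound the two error terms of a complex orbit,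
    and the fifth keeps that orbit in the domain of the Taylor estimate. *)
Lemma eventual_estimates (k : R) : 0 < k -> exists n0, forall n, (n0 <= n)%nat ->
  (forall x j, (j <= q (S n))%nat ->
    exp (- k) * (Diter j x * gap n x) <= gap n (fiter j x) <= exp k * (Diter j x * gap n x)) /\
  (forall x, Rabs (logD (q n) x) <= k) /\
  (forall x j, (j <= q (S n))%nat -> Rabs (nonlin j x) * gap n x <= k) /\
  (forall x j, (j <= q (S n))%nat -> psum (fun i => Diter i x ^ 2) j * gap n x ^ 2 <= k) /\
  (forall x j, (j <= q (S n))%nat -> Diter j x * gap n x <= k).
Proof.
  intros Hk.
  destruct (small_distortion (k / 2)) as [n1 H1]; [lra|].
  destruct (nonlin_gap_small k Hk) as [n2 H2].
  (* One constant for both O(1 / n) bounds used below, of sizes exp (5 V) and exp (4 V). *)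
  set (E := exp (5 * V)); assert (HE : 0 < E) by apply exp_pos.
  assert (HV := V_nonneg).
  destruct (nfloor_ex (E / k)) as (n3 & Hn3).
  { apply Rlt_le, Rdiv_lt_0_compat; lra. }
  exists (Nat.max n1 (Nat.max n2 (S n3))); intros n Hn.
  assert (Hkn : E < INR n * k).
  { assert (L : E / k < INR n).
    { eapply Rlt_le_trans; [apply Hn3|]; rewrite <- S_INR; apply le_INR; lia. }
    apply (Rmult_lt_compat_r k) in L; [|easy].
    replace (E / k * k) with E in L by (field; lra); easy. }
  assert (Hn0 : 0 < INR n) by (apply lt_0_INR; lia).
  assert (small : forall y, INR n * y <= E -> y <= k).
  { intros y Hy; apply (Rmult_le_reg_l (INR n)); lra. }
  split; [|split; [|split; [|split]]].
  - intros x j Hj; apply gap_ratio; [|easy]; intros y a b i Hi Ha Hb.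
    eapply Rle_trans; [apply (H1 n ltac:(lia) y); easy|lra].
  - intros x; replace k with (2 * (k / 2)) by field; apply logD_q_bound; apply H1; lia.
  - intros x j Hj; apply H2; [lia|easy].
  - intros x j Hj; apply small, square_sum_small, Hj.
  - intros x j Hj; apply small.
    assert (A := Diter_gap_le n j x Hj); assert (B := gap_small n (fiter j x)).
    apply Rle_trans with (exp V * exp (3 * V)).
    + apply Rle_trans with (exp V * (INR n * gap n (fiter j x))).
      * apply (Rmult_le_compat_l (INR n)) in A; lra.
      * apply Rmult_le_compat_l; [apply Rlt_le, exp_pos|easy].
    + rewrite <- exp_plus; apply exp_le_compat; lra.
Qed.

Lemma gap_periodic (n : nat) (x : R) (k : Z) : gap n (x + IZR k) = gap n x.
Proof. unfold gap, nxt; rewrite fiter_IZR; ring. Qed.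

Lemma gap_lip (n : nat) : exists M, 0 <= M /\ forall x y, Rabs (gap n x - gap n y) <= M * Rabs (x - y).
Proof.
  destruct (fiter_lip (q n)) as (M & HM & H); exists (M + 1); split; [lra|]; intros x y.
  unfold gap, nxt.
  replace ((-1) ^ n * (fiter (q n) x - IZR (p n) - x) - (-1) ^ n * (fiter (q n) y - IZR (p n) - y))
    with ((-1) ^ n * ((fiter (q n) x - fiter (q n) y) - (x - y))) by ring.
  rewrite Rabs_mult.
  replace (Rabs ((-1) ^ n)) with 1
    by (destruct (sign_cases n) as [-> | ->]; [now rewrite Rabs_R1|rewrite Rabs_left; lra]).
  rewrite Rmult_1_l; unfold Rminus at 1; eapply Rle_trans; [apply Rabs_triang|].
  rewrite Rabs_Ropp; specialize (H x y); lra.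
Qed.

End RealDynamics.

(** * Goursat's bisection *)

Section Bisection.

Variables (Q : R -> R -> R -> R -> C) (a b c d : R).
Hypothesis Hab : a <= b.
Hypothesis Hcd : c <= d.
Hypothesis Q_add_l : forall s1 m s2 t1 t2, a <= s1 -> s1 <= m <= s2 -> s2 <= b ->
  c <= t1 -> t1 <= t2 -> t2 <= d -> (Q s1 s2 t1 t2 = Q s1 m t1 t2 + Q m s2 t1 t2)%C.
Hypothesis Q_add_r : forall s1 s2 t1 n t2, a <= s1 -> s1 <= s2 -> s2 <= b ->
  c <= t1 -> t1 <= n <= t2 -> t2 <= d -> (Q s1 s2 t1 t2 = Q s1 s2 t1 n + Q s1 s2 n t2)%C.
Hypothesis Q_local : forall ps pt, a <= ps <= b -> c <= pt <= d -> forall eps, 0 < eps ->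
  exists delta, 0 < delta /\ forall s1 s2 t1 t2, a <= s1 <= ps -> ps <= s2 <= b ->
    c <= t1 <= pt -> pt <= t2 <= d -> s2 - s1 < delta -> t2 - t1 < delta ->
    Cmod (Q s1 s2 t1 t2) <= eps * ((s2 - s1) + (t2 - t1)) ^ 2.

Let rect : Type := (R * R * (R * R))%type.

Definition small_on (e : R) (r : rect) : Prop :=
  let '((s1, s2), (t1, t2)) := r in Cmod (Q s1 s2 t1 t2) <= e * ((s2 - s1) + (t2 - t1)) ^ 2.

Definition small_dec (e : R) (r : rect) : {small_on e r} + {~ small_on e r}.
Proof. destruct r as ((s1, s2), (t1, t2)); apply Rle_dec. Defined.

(** Selects a quadrant violating the bound. The fourth one is taken untested: the bound scales like
    the square of the size, so four good quadrants would make the whole rectangle good by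
    additivity. *)
Definition quarter (e : R) (r : rect) : rect :=
  let '((s1, s2), (t1, t2)) := r in
  let m := (s1 + s2) / 2 in let n := (t1 + t2) / 2 in
  if small_dec e ((s1, m), (t1, n)) then
    if small_dec e ((m, s2), (t1, n)) then
      if small_dec e ((s1, m), (n, t2)) then ((m, s2), (n, t2)) else ((s1, m), (n, t2))
    else ((m, s2), (t1, n))
  else ((s1, m), (t1, n)).

Definition sub_rect (r : rect) : Prop :=
  let '((s1, s2), (t1, t2)) := r in a <= s1 /\ s1 <= s2 /\ s2 <= b /\ c <= t1 /\ t1 <= t2 /\ t2 <= d.

Lemma quarter_spec (e : R) (r : rect) : sub_rect r -> ~ small_on e r ->
  sub_rect (quarter e r) /\ ~ small_on e (quarter e r) /\
  fst (fst r) <= fst (fst (quarter e r)) /\ snd (fst (quarter e r)) <= snd (fst r) /\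
  fst (snd r) <= fst (snd (quarter e r)) /\ snd (snd (quarter e r)) <= snd (snd r) /\
  snd (fst (quarter e r)) - fst (fst (quarter e r)) = (snd (fst r) - fst (fst r)) / 2 /\
  snd (snd (quarter e r)) - fst (snd (quarter e r)) = (snd (snd r) - fst (snd r)) / 2.
Proof.
  destruct r as ((s1, s2), (t1, t2)); intros (H1 & H2 & H3 & H4 & H5 & H6) Hbad.
  unfold quarter; set (m := (s1 + s2) / 2); set (n := (t1 + t2) / 2).
  assert (Hm : s1 <= m <= s2) by (unfold m; lra).
  assert (Hn : t1 <= n <= t2) by (unfold n; lra).
  destruct (small_dec e ((s1, m), (t1, n))) as [G1|G1];
    [destruct (small_dec e ((m, s2), (t1, n))) as [G2|G2];
      [destruct (small_dec e ((s1, m), (n, t2))) as [G3|G3]|]|]; simpl;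
    (split; [lra|split; [|unfold m, n; lra]]); try assumption.
  intros G4; apply Hbad; simpl in *.
  rewrite (Q_add_l s1 m s2 t1 t2), (Q_add_r s1 m t1 n t2), (Q_add_r m s2 t1 n t2) by lra.
  eapply Rle_trans; [apply Cmod_triangle|].
  eapply Rle_trans; [apply Rplus_le_compat; apply Cmod_triangle|].
  replace (m - s1) with ((s2 - s1) / 2) in * by (unfold m; field).
  replace (s2 - m) with ((s2 - s1) / 2) in * by (unfold m; field).
  replace (n - t1) with ((t2 - t1) / 2) in * by (unfold n; field).
  replace (t2 - n) with ((t2 - t1) / 2) in * by (unfold n; field).
  replace (e * (s2 - s1 + (t2 - t1)) ^ 2)
    with (e * ((s2 - s1) / 2 + (t2 - t1) / 2) ^ 2 + e * ((s2 - s1) / 2 + (t2 - t1) / 2) ^ 2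
      + (e * ((s2 - s1) / 2 + (t2 - t1) / 2) ^ 2 + e * ((s2 - s1) / 2 + (t2 - t1) / 2) ^ 2))
    by field.
  lra.
Qed.

Lemma nested_limit (u v : nat -> R) : (forall k, u k <= u (S k)) -> (forall k, v (S k) <= v k) ->
  (forall k, u k <= v k) -> exists l, forall k, u k <= l <= v k.
Proof.
  intros Hu Hv Huv.
  assert (Mu : forall i j, (i <= j)%nat -> u i <= u j) by
    (intros i j Hij; induction Hij; [lra|specialize (Hu m); lra]).
  assert (Mv : forall i j, (i <= j)%nat -> v j <= v i) by
    (intros i j Hij; induction Hij; [lra|specialize (Hv m); lra]).
  assert (M : forall i j, u i <= v j).
  { intros i j; apply Rle_trans with (u (Nat.max i j)); [apply Mu; lia|].
    apply Rle_trans with (v (Nat.max i j)); [apply Huv|apply Mv; lia]. }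
  destruct (completeness (fun x => exists k, x = u k)) as [l [Hl1 Hl2]].
  - exists (v O); intros x [k ->]; apply M.
  - exists (u O), O; easy.
  - exists l; intros k; split; [apply Hl1; now exists k|].
    apply Hl2; intros x [i ->]; apply M.
Qed.

(** If the quadratic bound with constant [e] failed on the whole rectangle, nested bad rectangles
    would shrink to a point and contradict [Q_local] there. As [e] is arbitrary, [Q] vanishes. *)
Lemma bisection_zero : Q a b c d = 0%C.
Proof.
  assert (H : forall e, 0 < e -> small_on e ((a, b), (c, d))).
  { intros e He; destruct (small_dec e ((a, b), (c, d))) as [Hs|Hs]; [easy|exfalso].
    set (r := fun k => Nat.iter k (quarter e) ((a, b), (c, d))).
    assert (Hr : forall k, sub_rect (r k) /\ ~ small_on e (r k)).
    { induction k as [|k [IH1 IH2]]; [split; [simpl; lra|exact Hs]|].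
      destruct (quarter_spec e (r k) IH1 IH2) as (K1 & K2 & _); now split. }
    assert (Hq := fun k => quarter_spec e (r k) (proj1 (Hr k)) (proj2 (Hr k))).
    destruct (nested_limit (fun k => fst (fst (r k))) (fun k => snd (fst (r k)))) as [ps Hps];
      [intros k; simpl; apply (Hq k)|intros k; simpl; apply (Hq k)| |].
    { intros k; destruct (Hr k) as [K _]; destruct (r k) as ((s1, s2), (t1, t2)); simpl in *; lra. }
    destruct (nested_limit (fun k => fst (snd (r k))) (fun k => snd (snd (r k)))) as [pt Hpt];
      [intros k; simpl; apply (Hq k)|intros k; simpl; apply (Hq k)| |].
    { intros k; destruct (Hr k) as [K _]; destruct (r k) as ((s1, s2), (t1, t2)); simpl in *; lra. }
    assert (Hsize : forall k, snd (fst (r k)) - fst (fst (r k)) = (b - a) * (1 / 2) ^ k /\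
      snd (snd (r k)) - fst (snd (r k)) = (d - c) * (1 / 2) ^ k).
    { induction k as [|k [IH1 IH2]]; [simpl; lra|].
      destruct (Hq k) as (_ & _ & _ & _ & _ & _ & E1 & E2).
      change (r (S k)) with (quarter e (r k)); rewrite E1, E2, IH1, IH2; simpl; split; field. }
    destruct (Q_local ps pt) with (eps := e) as (delta & Hdelta & HQ); [| |easy|].
    { specialize (Hps O); simpl in Hps; lra. }
    { specialize (Hpt O); simpl in Hpt; lra. }
    destruct (pow_lt_1_zero (1 / 2)) with (y := delta / (b - a + (d - c) + 1)) as [k Hk].
    { rewrite Rabs_pos_eq; lra. }
    { apply Rdiv_lt_0_compat; lra. }
    specialize (Hk k (Nat.le_refl k)); apply Rabs_def2 in Hk; destruct Hk as [Hk _].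
    apply (Rmult_lt_compat_l (b - a + (d - c) + 1)) in Hk; [|lra].
    replace ((b - a + (d - c) + 1) * (delta / (b - a + (d - c) + 1))) with delta in Hk
      by (field; lra).
    destruct (Hr k) as [K1 K2]; apply K2.
    specialize (Hps k); specialize (Hpt k); specialize (Hsize k).
    destruct (r k) as ((s1, s2), (t1, t2)); simpl in *.
    apply HQ; try lra; nra. }
  destruct (Req_dec (Cmod (Q a b c d)) 0) as [E|E]; [now apply Cmod_eq_0|exfalso].
  assert (Hpos : 0 < Cmod (Q a b c d)) by (assert (K := Cmod_ge_0 (Q a b c d)); lra).
  set (L := (b - a + (d - c)) ^ 2 + 1).
  assert (HL : 0 < L) by (unfold L; assert (0 <= (b - a + (d - c)) ^ 2) by apply pow2_ge_0; lra).
  assert (K := H (Cmod (Q a b c d) / (2 * L)) ltac:(apply Rdiv_lt_0_compat; lra)); simpl small_on in K.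
  assert (Cmod (Q a b c d) / (2 * L) * (b - a + (d - c)) ^ 2 <= Cmod (Q a b c d) / (2 * L) * L).
  { apply Rmult_le_compat_l; [apply Rlt_le, Rdiv_lt_0_compat; lra|unfold L; lra]. }
  replace (Cmod (Q a b c d) / (2 * L) * L) with (Cmod (Q a b c d) / 2) in * by (field; lra).
  lra.
Qed.

End Bisection.
(** * Complex-valued functions of a real variable *)

Definition cderive (f : C -> C) (z l : C) : Prop :=
  forall eps, 0 < eps -> exists delta, 0 < delta /\ forall w, Cmod (w - z) < delta ->
    Cmod (f w - f z - l * (w - z)) <= eps * Cmod (w - z).

Definition cdiff (f : C -> C) (z : C) : Prop := exists l, cderive f z l.

Lemma ex_derive_cdiff (f : C -> C) (z : C) :
  @ex_derive C_AbsRing C_NormedModule f z -> cdiff f z.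
Proof.
  intros [l [_ H]]; exists l; intros eps Heps.
  destruct (H z (fun P h => h) (mkposreal eps Heps)) as [delta Hd].
  exists delta; split; [apply delta|]; intros w Hw.
  specialize (Hd w Hw); simpl in Hd.
  change (Cmod (f w - f z - (w - z) * l) <= eps * Cmod (w - z)) in Hd.
  now rewrite (Cmult_comm l).
Qed.

Lemma cdiff_continuous (f : C -> C) (z : C) : cdiff f z -> forall eps, 0 < eps ->
  exists delta, 0 < delta /\ forall w, Cmod (w - z) < delta -> Cmod (f w - f z) < eps.
Proof.
  intros [l H] eps Heps; destruct (H 1 Rlt_0_1) as (d & Hd & Hw).
  set (M := Cmod l + 1); assert (HM : 0 < M) by (unfold M; assert (K := Cmod_ge_0 l); lra).
  exists (Rmin d (eps / M)); split; [apply Rmin_glb_lt; [easy|now apply Rdiv_lt_0_compat]|].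
  intros w Hmin.
  assert (H1 := Rlt_le_trans _ _ _ Hmin (Rmin_l _ _)).
  assert (H2 := Rlt_le_trans _ _ _ Hmin (Rmin_r _ _)).
  specialize (Hw w H1).
  replace (f w - f z)%C with ((f w - f z - l * (w - z)) + l * (w - z))%C by ring.
  eapply Rle_lt_trans; [apply Cmod_triangle|].
  rewrite Cmod_mult; apply Rle_lt_trans with (M * Cmod (w - z)); [unfold M; lra|].
  apply (Rmult_lt_compat_l M) in H2; [|easy].
  replace (M * (eps / M)) with eps in H2 by (field; lra); easy.
Qed.

Lemma Cmod_le_components (z : C) : Cmod z <= Rabs (fst z) + Rabs (snd z).
Proof.
  destruct z as [x y]; simpl.
  replace ((x, y) : C) with (RtoC x + Ci * RtoC y)%C
    by (unfold RtoC, Ci, Cplus, Cmult; simpl; f_equal; ring).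
  eapply Rle_trans; [apply Cmod_triangle|].
  rewrite Cmod_mult, Cmod_Ci, !Cmod_R; lra.
Qed.

Lemma fst_le_Cmod (z : C) : Rabs (fst z) <= Cmod z.
Proof. apply re_le_Cmod. Qed.

Lemma snd_le_Cmod (z : C) : Rabs (snd z) <= Cmod z.
Proof. eapply Rle_trans; [apply Rmax_r|apply (Rmax_Cmod z)]. Qed.

(** Componentwise, because the complex integral is also obtained from its two components. *)
Definition ccont (h : R -> C) (t : R) : Prop :=
  continuous (fun t => fst (h t)) t /\ continuous (fun t => snd (h t)) t.

Lemma continuous_eps (f : R -> R) (t : R) : continuous f t <->
  forall eps, 0 < eps -> exists delta, 0 < delta /\ forall u, Rabs (u - t) < delta ->
    Rabs (f u - f t) < eps.
Proof.
  split.
  - intros H eps Heps.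
    assert (K := proj1 (filterlim_locally f (f t)) H (mkposreal eps Heps)).
    destruct K as [d Hd]; exists d; split; [apply d|]; intros u Hu; apply (Hd u Hu).
  - intros H; apply filterlim_locally; intros [eps Heps].
    destruct (H eps Heps) as (d & Hd & K); exists (mkposreal d Hd); intros u Hu; apply (K u Hu).
Qed.

Lemma ccont_eps (h : R -> C) (t : R) : ccont h t <->
  forall eps, 0 < eps -> exists delta, 0 < delta /\ forall u, Rabs (u - t) < delta ->
    Cmod (h u - h t) < eps.
Proof.
  unfold ccont; rewrite !continuous_eps; split.
  - intros [H1 H2] eps Heps.
    destruct (H1 (eps / 2)) as (d1 & Hd1 & K1); [lra|].
    destruct (H2 (eps / 2)) as (d2 & Hd2 & K2); [lra|].
    exists (Rmin d1 d2); split; [now apply Rmin_glb_lt|]; intros u Hu.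
    eapply Rle_lt_trans; [apply Cmod_le_components|].
    specialize (K1 u (Rlt_le_trans _ _ _ Hu (Rmin_l _ _))).
    specialize (K2 u (Rlt_le_trans _ _ _ Hu (Rmin_r _ _))); simpl.
    unfold Rminus in *; lra.
  - intros H; split; intros eps Heps; destruct (H eps Heps) as (d & Hd & K);
      exists d; (split; [easy|]); intros u Hu; (eapply Rle_lt_trans; [|apply (K u Hu)]).
    + apply (fst_le_Cmod (h u - h t)).
    + apply (snd_le_Cmod (h u - h t)).
Qed.

Lemma ccont_const (z : C) (t : R) : ccont (fun _ => z) t.
Proof. split; apply continuous_const. Qed.

Lemma ccont_plus (g h : R -> C) (t : R) : ccont g t -> ccont h t -> ccont (fun t => (g t + h t)%C) t.
Proof.
  intros [G1 G2] [H1 H2]; split; simpl;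
    [apply (continuous_plus (fun t => fst (g t)) (fun t => fst (h t)))|
     apply (continuous_plus (fun t => snd (g t)) (fun t => snd (h t)))]; easy.
Qed.

Lemma ccont_mult (g h : R -> C) (t : R) : ccont g t -> ccont h t -> ccont (fun t => (g t * h t)%C) t.
Proof.
  intros [G1 G2] [H1 H2]; split; simpl.
  - apply (continuous_minus (fun t => fst (g t) * fst (h t)) (fun t => snd (g t) * snd (h t)));
      [apply (continuous_mult (fun t => fst (g t)) (fun t => fst (h t)))|
       apply (continuous_mult (fun t => snd (g t)) (fun t => snd (h t)))]; easy.
  - apply (continuous_plus (fun t => fst (g t) * snd (h t)) (fun t => snd (g t) * fst (h t)));
      [apply (continuous_mult (fun t => fst (g t)) (fun t => snd (h t)))|
       apply (continuous_mult (fun t => snd (g t)) (fun t => fst (h t)))]; easy.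
Qed.

Lemma ccont_minus (g h : R -> C) (t : R) :
  ccont g t -> ccont h t -> ccont (fun t => (g t - h t)%C) t.
Proof.
  intros [G1 G2] [H1 H2]; split; simpl;
    [apply (continuous_minus (fun t => fst (g t)) (fun t => fst (h t)))|
     apply (continuous_minus (fun t => snd (g t)) (fun t => snd (h t)))]; easy.
Qed.

Lemma ccont_RtoC (f : R -> R) (t : R) : continuous f t -> ccont (fun t => RtoC (f t)) t.
Proof. intros H; split; [exact H|apply continuous_const]. Qed.

Lemma ccont_inv (h : R -> C) (t : R) : ccont h t -> h t <> 0%C -> ccont (fun t => (/ h t)%C) t.
Proof.
  rewrite !ccont_eps; intros H Hz eps Heps.
  apply Cmod_gt_0 in Hz; set (m := Cmod (h t)) in *.
  destruct (H (Rmin (m / 2) (eps * (m * m / 2)))) as (d & Hd & K).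
  { apply Rmin_glb_lt; [lra|]; apply Rmult_lt_0_compat; [easy|].
    assert (0 < m * m) by now apply Rmult_lt_0_compat. lra. }
  exists d; split; [easy|]; intros u Hu; specialize (K u Hu).
  assert (K1 := Rlt_le_trans _ _ _ K (Rmin_l _ _)).
  assert (K2 := Rlt_le_trans _ _ _ K (Rmin_r _ _)).
  assert (Hm : m / 2 < Cmod (h u)).
  { assert (T := Cmod_triangle (h u) (h t - h u)).
    replace (h u + (h t - h u))%C with (h t) in T by ring; fold m in T.
    rewrite <- Cmod_opp in K1; replace (- (h u - h t))%C with (h t - h u)%C in K1 by ring; lra. }
  assert (Hu0 : h u <> 0%C) by (apply Cmod_gt_0; lra).
  assert (Ht0 : h t <> 0%C) by (apply Cmod_gt_0; fold m; lra).
  replace (/ h u - / h t)%C with (- ((h u - h t) / (h u * h t)))%C by (field; now split).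
  rewrite Cmod_opp, Cmod_div, Cmod_mult by now apply Cmult_neq_0.
  fold m; apply (Rmult_lt_reg_r (Cmod (h u) * m)); [apply Rmult_lt_0_compat; lra|].
  unfold Rdiv; rewrite Rmult_assoc, Rinv_l, Rmult_1_r
    by (apply Rgt_not_eq, Rmult_lt_0_compat; lra).
  eapply Rlt_trans; [exact K2|]; apply Rmult_lt_compat_l; [easy|].
  replace (m * m / 2) with (m / 2 * m) by field; now apply Rmult_lt_compat_r.
Qed.

Lemma ccont_comp (f : C -> C) (h : R -> C) (t : R) :
  cdiff f (h t) -> ccont h t -> ccont (fun t => f (h t)) t.
Proof.
  rewrite !ccont_eps; intros Hf Hh eps Heps.
  destruct (cdiff_continuous f (h t) Hf eps Heps) as (d & Hd & K).
  destruct (Hh d Hd) as (d' & Hd' & K'); exists d'; split; [easy|]; intros u Hu; auto.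
Qed.

(** * Complex-valued integrals *)

Definition CInt (h : R -> C) (a b : R) : C := RInt (V := C_R_CompleteNormedModule) h a b.
Definition is_CInt (h : R -> C) (a b : R) (l : C) : Prop :=
  is_RInt (V := C_R_NormedModule) h a b l.

Lemma ccont_ex_CInt (h : R -> C) (a b : R) : a <= b -> (forall t, a <= t <= b -> ccont h t) ->
  ex_RInt (V := C_R_NormedModule) h a b.
Proof.
  intros Hab H.
  assert (H1 : ex_RInt (V := R_CompleteNormedModule) (fun t => fst (h t)) a b).
  { apply ex_RInt_continuous; rewrite Rmin_left, Rmax_right by easy; intros t Ht; apply (H t Ht). }
  assert (H2 : ex_RInt (V := R_CompleteNormedModule) (fun t => snd (h t)) a b).
  { apply ex_RInt_continuous; rewrite Rmin_left, Rmax_right by easy; intros t Ht; apply (H t Ht). }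
  destruct H1 as [l1 H1], H2 as [l2 H2].
  exists (l1, l2); now apply (is_RInt_fct_extend_pair (U := R_NormedModule) (V := R_NormedModule)).
Qed.

Lemma ccont_is_CInt (h : R -> C) (a b : R) : a <= b -> (forall t, a <= t <= b -> ccont h t) ->
  is_CInt h a b (CInt h a b).
Proof. intros; now apply (RInt_correct (V := C_R_CompleteNormedModule)), ccont_ex_CInt. Qed.

Lemma is_CInt_unique (h : R -> C) (a b : R) (l l' : C) :
  is_CInt h a b l -> is_CInt h a b l' -> l = l'.
Proof.
  intros H H'; transitivity (CInt h a b); [symmetry|];
    now apply (is_RInt_unique (V := C_R_CompleteNormedModule)).
Qed.

Lemma is_CInt_plus (g h : R -> C) (a b : R) (k l : C) :
  is_CInt g a b k -> is_CInt h a b l -> is_CInt (fun t => (g t + h t)%C) a b (k + l)%C.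
Proof. apply (is_RInt_plus (V := C_R_NormedModule)). Qed.

Lemma is_CInt_minus (g h : R -> C) (a b : R) (k l : C) :
  is_CInt g a b k -> is_CInt h a b l -> is_CInt (fun t => (g t - h t)%C) a b (k - l)%C.
Proof. apply (is_RInt_minus (V := C_R_NormedModule)). Qed.

Lemma is_CInt_mult (c : C) (h : R -> C) (a b : R) (l : C) :
  is_CInt h a b l -> is_CInt (fun t => (c * h t)%C) a b (c * l)%C.
Proof.
  intros H.
  assert (H1 := is_RInt_fct_extend_fst (U := R_NormedModule) (V := R_NormedModule) h a b l H).
  assert (H2 := is_RInt_fct_extend_snd (U := R_NormedModule) (V := R_NormedModule) h a b l H).
  apply (is_RInt_fct_extend_pair (U := R_NormedModule) (V := R_NormedModule)); simpl.
  - apply (is_RInt_minus (V := R_NormedModule) (fun t => fst c * fst (h t))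
      (fun t => snd c * snd (h t))); now apply (is_RInt_scal (V := R_NormedModule)).
  - apply (is_RInt_plus (V := R_NormedModule) (fun t => fst c * snd (h t))
      (fun t => snd c * fst (h t))); now apply (is_RInt_scal (V := R_NormedModule)).
Qed.

Lemma is_CInt_bound (h : R -> C) (a b M : R) (l : C) : a <= b ->
  (forall t, a <= t <= b -> Cmod (h t) <= M) -> is_CInt h a b l -> Cmod l <= (b - a) * M.
Proof.
  intros Hab HM H; rewrite Cmod_norm.
  apply (norm_RInt_le_const (V := C_R_NormedModule) h a b l M Hab); [|easy].
  intros t Ht; rewrite <- Cmod_norm; auto.
Qed.

Lemma is_CInt_derive (h dh : R -> C) (a b : R) : a <= b ->
  (forall t, is_derive (fun t => fst (h t)) t (fst (dh t))) ->
  (forall t, is_derive (fun t => snd (h t)) t (snd (dh t))) ->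
  (forall t, ccont dh t) -> is_CInt dh a b (h b - h a)%C.
Proof.
  intros Hab H1 H2 Hc.
  apply (is_RInt_fct_extend_pair (U := R_NormedModule) (V := R_NormedModule)).
  - apply (is_RInt_derive (V := R_CompleteNormedModule) (fun t => fst (h t))); [easy|].
    intros t _; apply (Hc t).
  - apply (is_RInt_derive (V := R_CompleteNormedModule) (fun t => snd (h t))); [easy|].
    intros t _; apply (Hc t).
Qed.

Lemma is_CInt_const (c : C) (a b : R) : is_CInt (fun _ => c) a b (RtoC (b - a) * c)%C.
Proof.
  replace (RtoC (b - a) * c)%C with (scal (V := C_R_NormedModule) (b - a) c).
  - apply (is_RInt_const (V := C_R_NormedModule)).
  - unfold scal; simpl; unfold prod_scal, scal; simpl; unfold mult; simpl.
    unfold Cmult; simpl; f_equal; ring.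
Qed.

Lemma is_CInt_ext (g h : R -> C) (a b : R) (l : C) :
  (forall t, g t = h t) -> is_CInt g a b l -> is_CInt h a b l.
Proof. intros H; apply (is_RInt_ext (V := C_R_NormedModule)); auto. Qed.

Lemma is_CInt_Chasles (h : R -> C) (a b c : R) (k l : C) :
  is_CInt h a b k -> is_CInt h b c l -> is_CInt h a c (k + l)%C.
Proof. apply (is_RInt_Chasles (V := C_R_NormedModule)). Qed.

Lemma is_CInt_zero (a b : R) : is_CInt (fun _ => 0%C) a b 0%C.
Proof.
  assert (H := is_CInt_const 0 a b); now rewrite Cmult_0_r in H.
Qed.

(** * Cauchy's theorem on a star-shaped region *)

Section StarCauchy.

Variables (f : C -> C) (v : C) (E Ed : R -> C) (M : R).
Hypothesis dE1 : forall t, is_derive (fun t => fst (E t)) t (fst (Ed t)).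
Hypothesis dE2 : forall t, is_derive (fun t => snd (E t)) t (snd (Ed t)).
Hypothesis Ed_cont : forall t, ccont Ed t.
Hypothesis E_closed : E 0 = E 1.
Hypothesis E_neq0 : forall t, E t <> 0%C.
Hypothesis M_pos : 0 < M.
Hypothesis E_bound : forall t, Cmod (E t) <= M.
Hypothesis E_lip : forall s t, Cmod (E s - E t) <= M * Rabs (s - t).
Hypothesis k_bound : forall t, Cmod (Ed t / E t) <= M.
Hypothesis f_diff : forall s t, 0 <= s <= 1 -> cdiff f (v + RtoC s * E t).

Let zeta (s t : R) : C := (v + RtoC s * E t)%C.
Let k (t : R) : C := (Ed t / E t)%C.

Lemma E_ccont (t : R) : ccont E t.
Proof.
  split; apply (@ex_derive_continuous R_AbsRing R_NormedModule); eexists; [apply dE1|apply dE2].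
Qed.

Lemma k_ccont (t : R) : ccont k t.
Proof. apply ccont_mult; [apply Ed_cont|apply ccont_inv; [apply E_ccont|apply E_neq0]]. Qed.

Lemma f_zeta_ccont_l (s t : R) : 0 <= s <= 1 -> ccont (fun s => f (zeta s t)) s.
Proof.
  intros Hs; apply (ccont_comp f (fun s => zeta s t)); [now apply f_diff|].
  apply ccont_plus; [apply ccont_const|apply ccont_mult; [|apply ccont_const]].
  apply ccont_RtoC, continuous_id.
Qed.

Lemma f_zeta_ccont_r (s t : R) : 0 <= s <= 1 -> ccont (fun t => f (zeta s t)) t.
Proof.
  intros Hs; apply (ccont_comp f (fun t => zeta s t)); [now apply f_diff|].
  apply ccont_plus; [apply ccont_const|apply ccont_mult; [apply ccont_const|apply E_ccont]].
Qed.

Let hor (t1 t2 s : R) : C := (RtoC (/ s) * (f (zeta s t1) - f (zeta s t2)))%C.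
Let ver (s1 s2 t : R) : C := ((f (zeta s2 t) - f (zeta s1 t)) * k t)%C.

(* The integral of [f (zeta) d zeta / (zeta - v)] along the image of the boundary of a rectangle
   under [(s, t) |-> v + s E t], where [d zeta / (zeta - v) = ds / s + k dt]. *)
Let Q (s1 s2 t1 t2 : R) : C := (CInt (hor t1 t2) s1 s2 + CInt (ver s1 s2) t1 t2)%C.

Lemma hor_int (s1 s2 t1 t2 : R) : 0 < s1 -> s1 <= s2 -> s2 <= 1 ->
  is_CInt (hor t1 t2) s1 s2 (CInt (hor t1 t2) s1 s2).
Proof.
  intros H0 H1 H2; apply ccont_is_CInt; [easy|]; intros s Hs; apply ccont_mult.
  - apply ccont_RtoC, (continuous_comp (fun s => s) Rinv); [apply continuous_id|].
    apply continuous_Rinv; lra.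
  - apply ccont_minus; apply f_zeta_ccont_l; lra.
Qed.

Lemma ver_int (s1 s2 t1 t2 : R) : 0 <= s1 <= 1 -> 0 <= s2 <= 1 -> t1 <= t2 ->
  is_CInt (ver s1 s2) t1 t2 (CInt (ver s1 s2) t1 t2).
Proof.
  intros H1 H2 Ht; apply ccont_is_CInt; [easy|]; intros t _; apply ccont_mult; [|apply k_ccont].
  apply ccont_minus; now apply f_zeta_ccont_r.
Qed.

(** Complex differentiability replaces [f] by its affine part at the given point, whose boundary
    integral vanishes. The lower bound [a] keeps the form ds / s away from its pole. *)
Lemma Q_local_bound (a ps pt eps : R) : 0 < a -> a <= ps <= 1 -> 0 < eps ->
  exists delta, 0 < delta /\ forall s1 s2 t1 t2, a <= s1 <= ps -> ps <= s2 <= 1 ->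
    0 <= t1 <= pt -> pt <= t2 <= 1 -> s2 - s1 < delta -> t2 - t1 < delta ->
    Cmod (Q s1 s2 t1 t2) <= eps * ((s2 - s1) + (t2 - t1)) ^ 2.
Proof.
  intros Ha Hps Heps.
  destruct (f_diff ps pt) as [l Hl]; [lra|]; fold (zeta ps pt) in Hl; set (z0 := zeta ps pt) in *.
  (* Collects the losses: 2 for the two values of [f] in each difference, [M] from the distance
     [M * w] to the base point, and [/ a + M] from the factors [/ s] and [k]. *)
  set (K := 2 * M * (/ a + M)).
  assert (Ha' := Rinv_0_lt_compat a Ha).
  assert (HK : 0 < K) by (unfold K; apply Rmult_lt_0_compat; lra).
  destruct (Hl (eps / K)) as (d & Hd & Hr); [now apply Rdiv_lt_0_compat|].
  assert (HM2 : 0 < d / (2 * M)) by (apply Rdiv_lt_0_compat; lra).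
  exists (d / (2 * M)); split; [easy|].
  intros s1 s2 t1 t2 Hs1 Hs2 Ht1 Ht2 Hs Ht.
  set (w := (s2 - s1) + (t2 - t1)); assert (Hw : 0 <= w) by (unfold w; lra).
  assert (HwM : M * w < d).
  { apply Rlt_le_trans with (M * (2 * (d / (2 * M)))); [apply Rmult_lt_compat_l; unfold w; lra|].
    right; field; lra. }
  set (r := fun z => (f z - f z0 - l * (z - z0))%C).
  assert (Hrb : forall s t, s1 <= s <= s2 -> t1 <= t <= t2 ->
    Cmod (r (zeta s t)) <= eps / K * (M * w)).
  { intros s t Hs' Ht'.
    assert (Hz : Cmod (zeta s t - z0) <= M * w).
    { unfold z0, zeta.
      replace (v + RtoC s * E t - (v + RtoC ps * E pt))%C
        with (RtoC (s - ps) * E t + RtoC ps * (E t - E pt))%C by (rewrite RtoC_minus; ring).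
      eapply Rle_trans; [apply Cmod_triangle|]; rewrite 2!Cmod_mult, 2!Cmod_R.
      apply Rle_trans with ((s2 - s1) * M + 1 * (M * (t2 - t1))); [|unfold w; lra].
      apply Rplus_le_compat; apply Rmult_le_compat; try apply Rabs_pos; try apply Cmod_ge_0.
      - apply Rabs_le; lra.
      - apply E_bound.
      - apply Rabs_le; lra.
      - eapply Rle_trans; [apply E_lip|]; apply Rmult_le_compat_l; [lra|apply Rabs_le; lra]. }
    eapply Rle_trans; [apply Hr; lra|]; apply Rmult_le_compat_l; [|easy].
    now apply Rlt_le, Rdiv_lt_0_compat. }
  (* The constant part of [f] drops out of the differences. The linear part contributes
     [(s2 - s1) * lh] on the horizontal sides and its opposite on the vertical ones, so [Q] sees
     only the remainder [r]. *)
  set (lh := (l * (E t1 - E t2))%C).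
  assert (IH := is_CInt_minus _ _ _ _ _ _ (hor_int s1 s2 t1 t2 ltac:(lra) ltac:(lra) ltac:(lra))
    (is_CInt_const lh s1 s2)).
  assert (IV0 : is_CInt (fun t => (l * RtoC (s2 - s1) * Ed t)%C) t1 t2
    (l * RtoC (s2 - s1) * (E t2 - E t1))%C).
  { apply is_CInt_mult, is_CInt_derive; auto; lra. }
  assert (IV := is_CInt_minus _ _ _ _ _ _
    (ver_int s1 s2 t1 t2 ltac:(lra) ltac:(lra) ltac:(lra)) IV0).
  assert (BH : Cmod (CInt (hor t1 t2) s1 s2 - RtoC (s2 - s1) * lh)
    <= (s2 - s1) * (/ a * (2 * (eps / K * (M * w))))).
  { refine (is_CInt_bound _ s1 s2 _ _ _ _ IH); [lra|]; intros s Hs'.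
    assert (Hs0 : RtoC s <> 0%C) by (intros X; apply RtoC_inj in X; lra).
    replace (hor t1 t2 s - lh)%C with (RtoC (/ s) * (r (zeta s t1) - r (zeta s t2)))%C.
    - rewrite Cmod_mult, Cmod_R, Rabs_pos_eq by (apply Rlt_le, Rinv_0_lt_compat; lra).
      apply Rmult_le_compat; [apply Rlt_le, Rinv_0_lt_compat; lra|apply Cmod_ge_0| |].
      + apply Rinv_le_contravar; lra.
      + eapply Rle_trans; [apply Cmod_triangle|]; rewrite Cmod_opp.
        assert (B1 := Hrb s t1 Hs' ltac:(lra)); assert (B2 := Hrb s t2 Hs' ltac:(lra)); lra.
    - unfold hor, lh, r, zeta; rewrite RtoC_inv by lra; field; easy. }
  assert (BV : Cmod (CInt (ver s1 s2) t1 t2 - l * RtoC (s2 - s1) * (E t2 - E t1))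
    <= (t2 - t1) * (2 * (eps / K * (M * w)) * M)).
  { refine (is_CInt_bound _ t1 t2 _ _ _ _ IV); [lra|]; intros t Ht'.
    replace (ver s1 s2 t - l * RtoC (s2 - s1) * Ed t)%C
      with ((r (zeta s2 t) - r (zeta s1 t)) * k t)%C.
    - rewrite Cmod_mult; apply Rmult_le_compat; try apply Cmod_ge_0; [|apply k_bound].
      eapply Rle_trans; [apply Cmod_triangle|]; rewrite Cmod_opp.
      assert (B1 := Hrb s1 t ltac:(lra) Ht'); assert (B2 := Hrb s2 t ltac:(lra) Ht'); lra.
    - unfold ver, k, r, zeta; rewrite RtoC_minus; field; apply E_neq0. }
  replace (Q s1 s2 t1 t2) with ((CInt (hor t1 t2) s1 s2 - RtoC (s2 - s1) * lh)
    + (CInt (ver s1 s2) t1 t2 - l * RtoC (s2 - s1) * (E t2 - E t1)))%C by (unfold Q, lh; ring).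
  eapply Rle_trans; [apply Cmod_triangle|].
  eapply Rle_trans; [apply Rplus_le_compat; [exact BH|exact BV]|].
  set (X := eps / K * (M * w)).
  assert (HX : 0 <= X).
  { apply Rmult_le_pos; [now apply Rlt_le, Rdiv_lt_0_compat|apply Rmult_le_pos; lra]. }
  apply Rle_trans with (w * (2 * X * (/ a + M))).
  - assert (0 <= 2 * X * / a) by (apply Rmult_le_pos; lra).
    assert (0 <= 2 * X * M) by (apply Rmult_le_pos; lra).
    assert (P1 : (s2 - s1) * (2 * X * / a) <= w * (2 * X * / a))
      by (apply Rmult_le_compat_r; unfold w; lra).
    assert (P2 : (t2 - t1) * (2 * X * M) <= w * (2 * X * M))
      by (apply Rmult_le_compat_r; unfold w; lra).
    lra.
  - right; unfold X, K; field; split; [lra|]; split; [|lra].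
    apply Rgt_not_eq; assert (0 < M * a) by now apply Rmult_lt_0_compat. lra.
Qed.

Lemma Q_zero (a : R) : 0 < a <= 1 -> Q a 1 0 1 = 0%C.
Proof.
  intros Ha; apply (bisection_zero Q a 1 0 1); [lra|lra| | |].
  - intros s1 m s2 t1 t2 H1 H2 H3 H4 H5 H6; unfold Q.
    assert (A1 := hor_int s1 m t1 t2 ltac:(lra) ltac:(lra) ltac:(lra)).
    assert (A2 := hor_int m s2 t1 t2 ltac:(lra) ltac:(lra) ltac:(lra)).
    assert (A := hor_int s1 s2 t1 t2 ltac:(lra) ltac:(lra) ltac:(lra)).
    rewrite (is_CInt_unique _ _ _ _ _ A (is_CInt_Chasles _ _ _ _ _ _ A1 A2)).
    assert (B1 := ver_int s1 m t1 t2 ltac:(lra) ltac:(lra) ltac:(lra)).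
    assert (B2 := ver_int m s2 t1 t2 ltac:(lra) ltac:(lra) ltac:(lra)).
    assert (B := ver_int s1 s2 t1 t2 ltac:(lra) ltac:(lra) ltac:(lra)).
    assert (B' := is_CInt_plus _ _ _ _ _ _ B1 B2).
    apply (is_CInt_ext _ (ver s1 s2)) in B'; [|intros t; unfold ver; ring].
    rewrite (is_CInt_unique _ _ _ _ _ B B'); ring.
  - intros s1 s2 t1 n t2 H1 H2 H3 H4 H5 H6; unfold Q.
    assert (A1 := hor_int s1 s2 t1 n ltac:(lra) ltac:(lra) ltac:(lra)).
    assert (A2 := hor_int s1 s2 n t2 ltac:(lra) ltac:(lra) ltac:(lra)).
    assert (A := hor_int s1 s2 t1 t2 ltac:(lra) ltac:(lra) ltac:(lra)).
    assert (B1 := ver_int s1 s2 t1 n ltac:(lra) ltac:(lra) ltac:(lra)).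
    assert (B2 := ver_int s1 s2 n t2 ltac:(lra) ltac:(lra) ltac:(lra)).
    assert (B := ver_int s1 s2 t1 t2 ltac:(lra) ltac:(lra) ltac:(lra)).
    rewrite (is_CInt_unique _ _ _ _ _ B (is_CInt_Chasles _ _ _ _ _ _ B1 B2)).
    assert (A' := is_CInt_plus _ _ _ _ _ _ A1 A2).
    apply (is_CInt_ext _ (hor t1 t2)) in A'; [|intros s; unfold hor; ring].
    rewrite (is_CInt_unique _ _ _ _ _ A A'); ring.
  - intros ps pt Hps Hpt eps Heps; apply Q_local_bound; lra.
Qed.

(** On the rectangle [a, 1] x [0, 1] the two horizontal sides cancel because the curve is closed, so
    the integrals over the outer curve and over its copy scaled by [a] agree. As [a] tends to 0,
    continuity of [f] at [v] makes the inner one arbitrarily small. *)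
Lemma star_cauchy : is_CInt (fun t => ((f (v + E t) - f v) * (Ed t / E t))%C) 0 1 0%C.
Proof.
  assert (Hz0 : forall t, zeta 0 t = v) by (intros t; unfold zeta; ring).
  assert (I := ver_int 0 1 0 1 ltac:(lra) ltac:(lra) ltac:(lra)).
  assert (Z : CInt (ver 0 1) 0 1 = 0%C).
  { destruct (Req_dec (Cmod (CInt (ver 0 1) 0 1)) 0) as [X|X]; [now apply Cmod_eq_0|exfalso].
    assert (Hp : 0 < Cmod (CInt (ver 0 1) 0 1))
      by (assert (Y := Cmod_ge_0 (CInt (ver 0 1) 0 1)); lra).
    set (m := Cmod (CInt (ver 0 1) 0 1)) in *.
    assert (Hfv : cdiff f v) by (rewrite <- (Hz0 0); apply f_diff; lra).
    destruct (cdiff_continuous f v Hfv (m / (2 * M))) as (d & Hd & Hf);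
      [apply Rdiv_lt_0_compat; lra|].
    set (a := Rmin 1 (d / (2 * M))).
    assert (Ha : 0 < a <= 1).
    { split; [apply Rmin_glb_lt; [lra|apply Rdiv_lt_0_compat; lra]|apply Rmin_l]. }
    assert (Had : a * M < d).
    { apply Rle_lt_trans with (d / (2 * M) * M); [apply Rmult_le_compat_r; [lra|apply Rmin_r]|].
      replace (d / (2 * M) * M) with (d / 2) by (field; lra); lra. }
    assert (I0 := ver_int 0 a 0 1 ltac:(lra) ltac:(lra) ltac:(lra)).
    assert (I1 := ver_int a 1 0 1 ltac:(lra) ltac:(lra) ltac:(lra)).
    assert (Z1 : CInt (ver a 1) 0 1 = 0%C).
    { assert (HQ := Q_zero a Ha); unfold Q in HQ.
      assert (HH : CInt (hor 0 1) a 1 = 0%C).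
      { apply (is_CInt_unique (hor 0 1) a 1); [apply hor_int; lra|].
        apply (is_CInt_ext (fun _ => 0%C)); [|apply is_CInt_zero].
        intros s; unfold hor, zeta; rewrite E_closed; ring. }
      rewrite HH in HQ; rewrite <- HQ; ring. }
    assert (B : Cmod (CInt (ver 0 a) 0 1) <= (1 - 0) * (m / (2 * M) * M)).
    { refine (is_CInt_bound _ 0 1 _ _ _ _ I0); [lra|]; intros t _; unfold ver.
      rewrite Cmod_mult; apply Rmult_le_compat; try apply Cmod_ge_0; [|apply k_bound].
      rewrite Hz0; apply Rlt_le, Hf; unfold zeta.
      replace (v + RtoC a * E t - v)%C with (RtoC a * E t)%C by ring.
      rewrite Cmod_mult, Cmod_R, Rabs_pos_eq by lra.
      eapply Rle_lt_trans; [apply Rmult_le_compat_l; [lra|apply E_bound]|easy]. }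
    replace ((1 - 0) * (m / (2 * M) * M)) with (m / 2) in B by (field; lra).
    assert (S := is_CInt_plus _ _ _ _ _ _ I0 I1).
    apply (is_CInt_ext _ (ver 0 1)) in S; [|intros t; unfold ver; ring].
    assert (U := is_CInt_unique _ _ _ _ _ I S); rewrite Z1, Cplus_0_r in U.
    unfold m in *; rewrite U in *; lra. }
  rewrite Z in I; refine (is_CInt_ext _ _ _ _ _ _ I).
  intros t; unfold ver, k; rewrite Hz0; unfold zeta; now rewrite Cmult_1_l.
Qed.

End StarCauchy.
(** * Third-order Taylor estimates for holomorphic functions *)

Lemma expi_derive_fst (c t : R) :
  is_derive (fun t => fst (expi (c * t))) t (- (c * 2 * PI) * sin (2 * PI * (c * t))).
Proof. unfold expi; simpl; auto_derive; [easy|ring]. Qed.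

Lemma expi_derive_snd (c t : R) :
  is_derive (fun t => snd (expi (c * t))) t ((c * 2 * PI) * cos (2 * PI * (c * t))).
Proof. unfold expi; simpl; auto_derive; [easy|ring]. Qed.

Lemma Cmod_expi (t : R) : Cmod (expi t) = 1.
Proof.
  unfold Cmod, expi; simpl.
  replace (cos (2 * PI * t) * (cos (2 * PI * t) * 1) + sin (2 * PI * t) * (sin (2 * PI * t) * 1))
    with (Rsqr (sin (2 * PI * t)) + Rsqr (cos (2 * PI * t))) by (unfold Rsqr; ring).
  rewrite sin2_cos2; apply sqrt_1.
Qed.

Lemma expi_neq_0 (t : R) : expi t <> 0%C.
Proof. apply Cmod_gt_0; rewrite Cmod_expi; lra. Qed.

Lemma expi_plus (s t : R) : expi (s + t) = (expi s * expi t)%C.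
Proof.
  unfold expi, Cmult; simpl.
  rewrite Rmult_plus_distr_l, cos_plus, sin_plus; f_equal; ring.
Qed.

Lemma expi_0 : expi 0 = 1%C.
Proof. unfold expi; rewrite Rmult_0_r, cos_0, sin_0; easy. Qed.

Lemma expi_opp (t : R) : expi (- t) = (/ expi t)%C.
Proof.
  assert (H : (expi (- t) * expi t)%C = 1%C)
    by (rewrite <- expi_plus, Rplus_opp_l; apply expi_0).
  rewrite <- (Cmult_1_l (/ expi t)), <- H; field; apply expi_neq_0.
Qed.

Lemma expi_ccont (c t : R) : ccont (fun t => expi (c * t)) t.
Proof.
  split; apply (@ex_derive_continuous R_AbsRing R_NormedModule); eexists;
    [apply expi_derive_fst|apply expi_derive_snd].
Qed.

Lemma expi_pow (n : nat) (t : R) : (expi t ^ n)%C = expi (INR n * t).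
Proof.
  induction n as [|n IH]; [simpl; now rewrite Rmult_0_l, expi_0|].
  rewrite S_INR; change (expi t ^ S n)%C with (expi t * expi t ^ n)%C.
  rewrite IH, <- expi_plus; f_equal; ring.
Qed.

Lemma expi_INR (n : nat) : expi (INR n) = 1%C.
Proof.
  unfold expi; replace (2 * PI * INR n) with (0 + 2 * INR n * PI) by ring.
  now rewrite cos_period, sin_period, cos_0, sin_0.
Qed.

Lemma expi_lip (s t : R) : Cmod (expi s - expi t) <= 4 * PI * Rabs (s - t).
Proof.
  assert (HP := PI_RGT_0).
  assert (HL : forall c, Rabs c <= 1 -> Rabs (2 * PI * c) <= 2 * PI).
  { intros c Hc; rewrite Rabs_mult, (Rabs_pos_eq (2 * PI)) by lra; nra. }
  eapply Rle_trans; [apply Cmod_le_components|]; simpl.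
  assert (A := lipschitz_of_derivative (fun x => cos (2 * PI * x)) (fun x => 2 * PI * - sin (2 * PI * x)) (2 * PI)).
  assert (B := lipschitz_of_derivative (fun x => sin (2 * PI * x)) (fun x => 2 * PI * cos (2 * PI * x)) (2 * PI)).
  simpl in A, B; unfold Rminus in *.
  assert (A' := A ltac:(intros; auto_derive; [easy|ring])
    ltac:(intros; apply HL; rewrite Rabs_Ropp; apply Rabs_le, SIN_bound) s t).
  assert (B' := B ltac:(intros; auto_derive; [easy|ring])
    ltac:(intros; apply HL, Rabs_le, COS_bound) s t).
  lra.
Qed.

Lemma expi_inv_pow_int (n : nat) : (1 <= n)%nat ->
  is_CInt (fun t => (/ expi t ^ n)%C) 0 1 0%C.
Proof.
  intros Hn; assert (HP := PI_RGT_0); assert (Hn0 : 0 < INR n) by (apply lt_0_INR; lia).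
  set (c := - INR n).
  apply (is_CInt_ext (fun t => expi (c * t))).
  - intros t; rewrite expi_pow, <- expi_opp; f_equal; unfold c; ring.
  - set (h := fun t => (/ RtoC (c * 2 * PI) * (- Ci) * expi (c * t))%C).
    assert (Eh : (h 1 - h 0)%C = 0%C).
    { unfold h; rewrite Rmult_0_r, expi_0, Rmult_1_r; unfold c.
      rewrite expi_opp, expi_INR; field.
      intros X; apply RtoC_inj in X.
      assert (- INR n * 2 * PI < 0) by nra; lra. }
    rewrite <- Eh.
    assert (Hc : c * 2 * PI <> 0) by (unfold c; apply Rmult_integral_contrapositive; split; nra).
      apply is_CInt_derive; [lra| | |intros; apply expi_ccont]; intros t; unfold h;
        rewrite <- RtoC_inv by easy.
      * apply (is_derive_ext (fun t => / (c * 2 * PI) * snd (expi (c * t))));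
          [intros x; simpl; ring|].
        replace (fst (expi (c * t))) with (/ (c * 2 * PI) * (c * 2 * PI * cos (2 * PI * (c * t))))
          by (unfold expi; simpl; field; split; [lra|unfold c; lra]).
        apply (is_derive_scal (fun t => snd (expi (c * t)))), expi_derive_snd.
      * apply (is_derive_ext (fun t => - / (c * 2 * PI) * fst (expi (c * t))));
          [intros x; simpl; ring|].
        replace (snd (expi (c * t)))
          with (- / (c * 2 * PI) * (- (c * 2 * PI) * sin (2 * PI * (c * t))))
          by (unfold expi; simpl; field; split; [lra|unfold c; lra]).
        apply (is_derive_scal (fun t => fst (expi (c * t)))), expi_derive_fst.
Qed.

Section Taylor.

Variables (f : C -> C) (z0 : C) (r B : R).
Hypothesis r_pos : 0 < r.
Hypothesis f_diff : forall z, Cmod (z - z0) <= r -> cdiff f z.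
Hypothesis f_bound : forall z, Cmod (z - z0) <= r -> Cmod (f z) <= B.

Let u (t : R) : C := (/ (RtoC r * expi t))%C.
Let fc (t : R) : C := f (z0 + RtoC r * expi t)%C.

Lemma r_neq_0 : RtoC r <> 0%C.
Proof. intros X; apply RtoC_inj in X; lra. Qed.

Lemma circle_point (t : R) : Cmod (z0 + RtoC r * expi t - z0) = r.
Proof.
  replace (z0 + RtoC r * expi t - z0)%C with (RtoC r * expi t)%C by ring.
  rewrite Cmod_mult, Cmod_expi, Cmod_R, Rabs_pos_eq; lra.
Qed.

Lemma Cmod_u (t : R) : Cmod (u t) = / r.
Proof.
  unfold u; rewrite Cmod_inv by (apply Cmult_neq_0; [apply r_neq_0|apply expi_neq_0]).
  rewrite Cmod_mult, Cmod_expi, Cmod_R, Rabs_pos_eq; [f_equal; ring|lra].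
Qed.

Lemma expi_ccont' (t : R) : ccont expi t.
Proof.
  assert (H := expi_ccont 1 t); unfold ccont in *.
  split; [eapply (continuous_ext (fun t => fst (expi (1 * t))))|
    eapply (continuous_ext (fun t => snd (expi (1 * t))))]; try apply H;
    intros; now rewrite Rmult_1_l.
Qed.

Lemma u_ccont (t : R) : ccont u t.
Proof.
  apply ccont_inv; [|apply Cmult_neq_0; [apply r_neq_0|apply expi_neq_0]].
  apply ccont_mult; [apply ccont_const|apply expi_ccont'].
Qed.

Lemma fc_ccont (t : R) : ccont fc t.
Proof.
  apply (ccont_comp f (fun t => z0 + RtoC r * expi t)%C).
  - apply f_diff; rewrite circle_point; lra.
  - apply ccont_plus; [apply ccont_const|].
    apply ccont_mult; [apply ccont_const|apply expi_ccont'].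
Qed.

Lemma ccont_pow (h : R -> C) (n : nat) (t : R) : ccont h t -> ccont (fun t => (h t ^ n)%C) t.
Proof.
  intros H; induction n as [|n IH]; simpl; [apply ccont_const|].
  now apply (ccont_mult h (fun t => (h t ^ n)%C)).
Qed.

Section Kernel.

Variable v : C.
Hypothesis v_small : Cmod v <= r / 2.

Let E (t : R) : C := (RtoC r * expi t - v)%C.
Let k0 (t : R) : C := (RtoC r * expi t / E t)%C.

Lemma E_lower (t : R) : r / 2 <= Cmod (E t).
Proof.
  assert (H := Cmod_triangle (E t) v); unfold E in *.
  replace (RtoC r * expi t - v + v)%C with (RtoC r * expi t)%C in H by ring.
  rewrite Cmod_mult, Cmod_expi, Cmod_R, Rabs_pos_eq in H; lra.
Qed.

Lemma E_neq_0 (t : R) : E t <> 0%C.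
Proof. apply Cmod_gt_0; assert (H := E_lower t); lra. Qed.

Lemma k0_bound (t : R) : Cmod (k0 t) <= 2.
Proof.
  unfold k0; rewrite Cmod_div, Cmod_mult, Cmod_expi, Cmod_R, Rabs_pos_eq by (apply E_neq_0 || lra).
  assert (H := E_lower t).
  apply (Rmult_le_reg_r (Cmod (E t))); [lra|].
  unfold Rdiv; rewrite Rmult_assoc, Rinv_l by lra; lra.
Qed.

Lemma k0_ccont (t : R) : ccont k0 t.
Proof.
  assert (H : ccont (fun t => (RtoC r * expi t)%C) t)
    by (apply ccont_mult; [apply ccont_const|apply expi_ccont']).
  apply ccont_mult; [exact H|apply ccont_inv; [|apply E_neq_0]].
  apply ccont_minus; [exact H|apply ccont_const].
Qed.

(** One step of the geometric expansion of zeta / (zeta - v), where zeta = r exp (2 pi i t) and v u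
    = v / zeta. *)
Lemma k0_expand (t : R) : k0 t = (1 + v * u t * k0 t)%C.
Proof.
  assert (H := E_neq_0 t); unfold k0, u, E in *; field.
  split; [easy|split; [apply expi_neq_0|apply r_neq_0]].
Qed.

Lemma kernel_int (j : nat) :
  is_CInt (fun t => ((v * u t) ^ j * k0 t)%C) 0 1 (CInt (fun t => ((v * u t) ^ j * k0 t)%C) 0 1).
Proof.
  apply ccont_is_CInt; [lra|]; intros t _; apply ccont_mult; [|apply k0_ccont].
  apply (ccont_pow (fun t => v * u t)%C), ccont_mult; [apply ccont_const|apply u_ccont].
Qed.

Lemma vu_pow_int (j : nat) : (1 <= j)%nat -> is_CInt (fun t => ((v * u t) ^ j)%C) 0 1 0%C.
Proof.
  intros Hj; rewrite <- (Cmult_0_r ((v / RtoC r) ^ j)).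
  apply (is_CInt_ext (fun t => ((v / RtoC r) ^ j * / expi t ^ j)%C));
    [|now apply is_CInt_mult, expi_inv_pow_int].
  intros t; rewrite <- Cpow_inv, <- Cpow_mult_l by apply expi_neq_0; f_equal; unfold u; field.
  split; [apply expi_neq_0|apply r_neq_0].
Qed.

Lemma kernel_int_step (j : nat) : (1 <= j)%nat ->
  CInt (fun t => ((v * u t) ^ j * k0 t)%C) 0 1 = CInt (fun t => ((v * u t) ^ S j * k0 t)%C) 0 1.
Proof.
  intros Hj; apply (is_CInt_unique (fun t => ((v * u t) ^ j * k0 t)%C) 0 1); [apply kernel_int|].
  apply (is_CInt_ext (fun t => ((v * u t) ^ j + (v * u t) ^ S j * k0 t)%C)).
  - intros t; rewrite (k0_expand t) at 2; change ((v * u t) ^ S j)%C with (v * u t * (v * u t) ^ j)%C.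
    ring.
  - rewrite <- Cplus_0_l; apply is_CInt_plus; [now apply vu_pow_int|apply kernel_int].
Qed.

Lemma vu_bound (t : R) : Cmod (v * u t) <= Cmod v / r.
Proof. rewrite Cmod_mult, Cmod_u; lra. Qed.

(** Positive powers of [u] integrate to 0, so by [k0_expand] the integral does not change when the
    exponent is raised; yet it is at most 2 / 2^j. This computes the winding number as 1 without a
    logarithm. *)
Lemma kernel_int_zero : CInt (fun t => ((v * u t) ^ 1 * k0 t)%C) 0 1 = 0%C.
Proof.
  set (m := fun j => CInt (fun t => ((v * u t) ^ j * k0 t)%C) 0 1).
  assert (Hm : forall j, m (S j) = m 1%nat).
  { induction j as [|j IH]; [easy|]; rewrite <- IH; symmetry; apply kernel_int_step; lia. }
  assert (Hb : forall j, Cmod (m j) <= 2 * (1 / 2) ^ j).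
  { intros j; replace (2 * (1 / 2) ^ j) with ((1 - 0) * ((1 / 2) ^ j * 2)) by ring.
    refine (is_CInt_bound _ 0 1 _ _ _ _ (kernel_int j)); [lra|]; intros t _.
    rewrite Cmod_mult; apply Rmult_le_compat; try apply Cmod_ge_0; [|apply k0_bound].
    rewrite Cmod_pow; apply pow_incr; split; [apply Cmod_ge_0|].
    eapply Rle_trans; [apply vu_bound|]; apply (Rmult_le_reg_r r); [easy|].
    unfold Rdiv; rewrite Rmult_assoc, Rinv_l by lra; lra. }
  change (m 1%nat = 0%C).
  destruct (Req_dec (Cmod (m 1%nat)) 0) as [X|X]; [now apply Cmod_eq_0|exfalso].
  assert (Hp : 0 < Cmod (m 1%nat)) by (assert (Y := Cmod_ge_0 (m 1%nat)); lra).
  destruct (pow_lt_1_zero (1 / 2)) with (y := Cmod (m 1%nat) / 2) as [k Hk].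
  - rewrite Rabs_pos_eq; lra.
  - lra.
  - specialize (Hk (S k) ltac:(lia)); apply Rabs_def2 in Hk.
    specialize (Hb (S k)); rewrite Hm in Hb; lra.
Qed.

Lemma kernel_int_one : is_CInt k0 0 1 1%C.
Proof.
  apply (is_CInt_ext (fun t => (1 + (v * u t) ^ 1 * k0 t)%C)).
  - intros t; rewrite (k0_expand t) at 2; simpl; ring.
  - assert (X : (RtoC (1 - 0) * 1 + 0)%C = 1%C) by (rewrite Rminus_0_r; ring).
    refine (eq_ind _ (is_CInt _ 0 1) _ _ X); apply is_CInt_plus; [apply is_CInt_const|].
    rewrite <- kernel_int_zero; apply kernel_int.
Qed.

(** [star_cauchy] centred at z0 + v: seen from there the circle is [E], with E' / E = 2 pi i k0, and
    [k0] has integral 1. By convexity the segments to the circle stay in the disk. *)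
Lemma cauchy_formula : is_CInt (fun t => (fc t * k0 t)%C) 0 1 (f (z0 + v))%C.
Proof.
  assert (HP := PI_RGT_0).
  set (Ed := fun t => (2 * PI * r * - sin (2 * PI * t), 2 * PI * r * cos (2 * PI * t)) : C).
  assert (HEd : forall t, Ed t = (RtoC (2 * PI) * Ci * (RtoC r * expi t))%C).
  { intros t; unfold Ed, expi, Ci, RtoC, Cmult; simpl; f_equal; ring. }
  assert (HEdE : forall t, (Ed t / E t)%C = (RtoC (2 * PI) * Ci * k0 t)%C).
  { intros t; rewrite HEd; unfold k0; field; apply E_neq_0. }
  set (M := 4 * PI + 4 * PI * r + 2 * r).
  assert (HM : 4 * PI <= M /\ 4 * PI * r <= M /\ 2 * r <= M).
  { assert (0 < 4 * PI * r) by (apply Rmult_lt_0_compat; lra). unfold M; lra. }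
  assert (HS := star_cauchy f (z0 + v)%C E Ed M).
  assert (I : is_CInt (fun t => ((f (z0 + v + E t) - f (z0 + v)) * (Ed t / E t))%C) 0 1 0%C).
  { apply HS.
    - intros t; unfold E, Ed, expi; simpl; auto_derive; [easy|ring].
    - intros t; unfold E, Ed, expi; simpl; auto_derive; [easy|ring].
    - intros t; assert (K : ccont (fun t => (RtoC (2 * PI) * Ci * (RtoC r * expi t))%C) t).
      { apply ccont_mult; [apply ccont_const|].
        apply ccont_mult; [apply ccont_const|apply expi_ccont']. }
      destruct K as [K1 K2]; split;
        [revert K1; apply continuous_ext|revert K2; apply continuous_ext]; intros; now rewrite HEd.
    - unfold E; f_equal; f_equal; rewrite expi_0; symmetry; apply (expi_INR 1).
    - apply E_neq_0.
    - lra.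
    - intros t; unfold E; eapply Rle_trans; [apply Cmod_triangle|].
      rewrite Cmod_opp, Cmod_mult, Cmod_expi, Cmod_R, Rabs_pos_eq; lra.
    - intros s t; unfold E.
      replace (RtoC r * expi s - v - (RtoC r * expi t - v))%C
        with (RtoC r * (expi s - expi t))%C by ring.
      rewrite Cmod_mult, Cmod_R, Rabs_pos_eq by lra.
      assert (K := expi_lip s t); assert (A := Rabs_pos (s - t)).
      apply Rle_trans with (4 * PI * r * Rabs (s - t)); [|apply Rmult_le_compat_r; lra].
      apply (Rmult_le_compat_l r) in K; lra.
    - intros t; rewrite HEdE, !Cmod_mult, Cmod_Ci, Cmod_R, Rabs_pos_eq by lra.
      assert (K := k0_bound t); assert (K' := Cmod_ge_0 (k0 t)); nra.
    - intros s t Hs; apply f_diff; unfold E.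
      replace (z0 + v + RtoC s * (RtoC r * expi t - v) - z0)%C
        with (RtoC (1 - s) * v + RtoC s * (RtoC r * expi t))%C by (rewrite RtoC_minus; ring).
      eapply Rle_trans; [apply Cmod_triangle|].
      rewrite !Cmod_mult, Cmod_expi, !Cmod_R, !Rabs_pos_eq by lra.
      assert (K := Cmod_ge_0 v); nra. }
  assert (Hpi : (RtoC (2 * PI) * Ci)%C <> 0%C).
  { apply Cmult_neq_0; [intros X; apply RtoC_inj in X; lra|].
    intros X; injection X; lra. }
  assert (J := is_CInt_mult (/ (RtoC (2 * PI) * Ci))%C _ _ _ _ I); rewrite Cmult_0_r in J.
  assert (L := is_CInt_mult (f (z0 + v)%C) _ _ _ _ kernel_int_one); rewrite Cmult_1_r in L.
  assert (S := is_CInt_plus _ _ _ _ _ _ J L); rewrite Cplus_0_l in S.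
  revert S; apply is_CInt_ext; intros t; rewrite HEdE.
  unfold fc; replace (z0 + RtoC r * expi t)%C with (z0 + v + E t)%C by (unfold E; ring).
  field; split; [intros X; injection X; lra|intros X; apply RtoC_inj in X; lra].
Qed.

End Kernel.

(** The coefficients are the integrals of [fc * u ^ j]. The remainder is the integral of
    [fc * (v * u) ^ 3 * k0], and |k0| <= 2 is the origin of the factor 2. *)
Lemma taylor3 : exists a b, Cmod a <= B / r /\ Cmod b <= B / r ^ 2 /\
  forall v, Cmod v <= r / 2 ->
    Cmod (f (z0 + v) - f z0 - a * v - b * v ^ 2) <= 2 * B / r ^ 3 * Cmod v ^ 3.
Proof.
  set (cf := fun j => CInt (fun t => (fc t * u t ^ j)%C) 0 1).
  assert (Hfc : forall t, Cmod (fc t) <= B) by (intros t; apply f_bound; rewrite circle_point; lra).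
  assert (Hcf : forall j, is_CInt (fun t => (fc t * u t ^ j)%C) 0 1 (cf j)).
  { intros j; apply ccont_is_CInt; [lra|]; intros t _.
    apply ccont_mult; [apply fc_ccont|apply (ccont_pow u), u_ccont]. }
  assert (Hcfb : forall j, Cmod (cf j) <= B / r ^ j).
  { intros j; replace (B / r ^ j) with ((1 - 0) * (B * (/ r) ^ j))
      by (rewrite pow_inv; unfold Rdiv; ring).
    refine (is_CInt_bound _ 0 1 _ _ _ _ (Hcf j)); [lra|]; intros t _.
    rewrite Cmod_mult, Cmod_pow, Cmod_u; apply Rmult_le_compat_r; [|apply Hfc].
    now apply pow_le, Rlt_le, Rinv_0_lt_compat. }
  assert (main : forall v, Cmod v <= r / 2 ->
    Cmod (f (z0 + v) - cf 0%nat - cf 1%nat * v - cf 2%nat * v ^ 2) <= 2 * B / r ^ 3 * Cmod v ^ 3).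
  { intros v Hv.
    set (k0 := fun t => (RtoC r * expi t / (RtoC r * expi t - v))%C).
    assert (I := cauchy_formula v Hv); fold k0 in I.
    assert (S := is_CInt_minus _ _ _ _ _ _ (is_CInt_minus _ _ _ _ _ _
      (is_CInt_minus _ _ _ _ _ _ I (Hcf 0%nat)) (is_CInt_mult v _ _ _ _ (Hcf 1%nat)))
      (is_CInt_mult (v ^ 2)%C _ _ _ _ (Hcf 2%nat))).
    rewrite (Cmult_comm v), (Cmult_comm (v ^ 2)) in S.
    replace (2 * B / r ^ 3 * Cmod v ^ 3) with ((1 - 0) * (B * ((Cmod v / r) ^ 3 * 2)))
      by (field; lra).
    refine (is_CInt_bound _ 0 1 _ _ _ _ S); [lra|]; intros t _.
    change (RtoC r * expi t / (RtoC r * expi t - v))%C with (k0 t).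
    replace (fc t * k0 t - fc t * u t ^ 0 - v * (fc t * u t ^ 1) - v ^ 2 * (fc t * u t ^ 2))%C
      with (fc t * ((v * u t) ^ 3 * k0 t))%C.
    - rewrite 2!Cmod_mult; apply Rmult_le_compat; [apply Cmod_ge_0| |apply Hfc|].
      + apply Rmult_le_pos; apply Cmod_ge_0.
      + apply Rmult_le_compat; try apply Cmod_ge_0; [|now apply k0_bound].
        rewrite Cmod_pow; apply pow_incr; split; [apply Cmod_ge_0|apply vu_bound].
    (* Three expansions of the kernel leave 1 + v u + (v u)^2 plus the remainder. *)
    - assert (X : k0 t = (1 + v * u t * k0 t)%C) by now apply k0_expand.
      rewrite X at 2; rewrite X at 2; rewrite X at 2; simpl; ring. }
  exists (cf 1%nat), (cf 2%nat).
  split; [|split; [apply Hcfb|]].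
  - replace (B / r) with (B / r ^ 1) by (f_equal; ring); apply Hcfb.
  - assert (E0 : f z0 = cf 0%nat).
    { assert (K := main (RtoC 0)); rewrite Cmod_0 in K; specialize (K ltac:(lra)).
      replace (2 * B / r ^ 3 * 0 ^ 3) with 0 in K by ring.
      replace (f (z0 + 0) - cf 0%nat - cf 1%nat * 0 - cf 2%nat * 0 ^ 2)%C with (f z0 - cf 0%nat)%C in K
        by (rewrite Cplus_0_r; simpl; ring).
      assert (K' := Cmod_ge_0 (f z0 - cf 0%nat)).
      assert (K2 := Cmod_eq_0 _ (Rle_antisym _ _ K K')).
      replace (f z0) with (f z0 - cf 0%nat + cf 0%nat)%C by ring; rewrite K2; ring. }
    intros v Hv; rewrite E0; now apply main.
Qed.

End Taylor.

(** * Exponential coordinates near the circle *)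

(** The map exp (2 pi i w), from the coordinate w to the plane. The exterior of the disk corresponds
    to the lower half-plane. *)
Definition ecx (w : C) : C := (RtoC (exp (- (2 * PI) * snd w)) * expi (fst w))%C.

Lemma ecx_plus (u w : C) : ecx (u + w) = (ecx u * ecx w)%C.
Proof.
  unfold ecx; simpl; rewrite Rmult_plus_distr_l, exp_plus, expi_plus, RtoC_mult; ring.
Qed.

Lemma ecx_RtoC (x : R) : ecx (RtoC x) = expi x.
Proof. unfold ecx; simpl; rewrite Rmult_0_r, exp_0; ring. Qed.

Lemma ecx_0 : ecx 0 = 1%C.
Proof. rewrite ecx_RtoC; apply expi_0. Qed.

Lemma Cmod_ecx (w : C) : Cmod (ecx w) = exp (- (2 * PI) * snd w).
Proof.
  unfold ecx; rewrite Cmod_mult, Cmod_expi, Cmod_R, Rabs_pos_eq; [ring|apply Rlt_le, exp_pos].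
Qed.

Lemma ecx_neq_0 (w : C) : ecx w <> 0%C.
Proof. apply Cmod_gt_0; rewrite Cmod_ecx; apply exp_pos. Qed.

Lemma ecx_cexp (w : C) : ecx w = cexp (RtoC (2 * PI) * Ci * w)%C.
Proof.
  destruct w as [x y]; unfold ecx, cexp, expi, RtoC, Ci, Cmult; simpl.
  replace ((2 * PI * 0 - 0 * 1) * x - (2 * PI * 1 + 0 * 0) * y) with (- (2 * PI) * y) by ring.
  replace ((2 * PI * 0 - 0 * 1) * y + (2 * PI * 1 + 0 * 0) * x) with (2 * PI * x) by ring.
  f_equal; ring.
Qed.

Lemma derive_eps (f : R -> R) (x l : R) : is_derive f x l -> forall eps, 0 < eps ->
  exists delta, 0 < delta /\ forall y, Rabs (y - x) < delta ->
    Rabs (f y - f x - l * (y - x)) <= eps * Rabs (y - x).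
Proof.
  intros [_ H] eps Heps.
  destruct (H x (fun P h => h) (mkposreal eps Heps)) as [d Hd].
  exists d; split; [apply d|]; intros y Hy; specialize (Hd y Hy).
  change (Rabs (f y - f x - (y - x) * l) <= eps * Rabs (y - x)) in Hd.
  now rewrite (Rmult_comm l).
Qed.

Lemma exp_le_3_small (x : R) : Rabs x <= 1 -> exp x <= 3.
Proof.
  intros H; apply Rabs_le_between in H; eapply Rle_trans; [|apply exp_le_3].
  destruct (Rle_lt_or_eq_dec x 1) as [Hl| ->]; [easy| |lra].
  now apply Rlt_le, exp_increasing.
Qed.

Lemma cderive_ecx (w : C) : cderive ecx w (RtoC (2 * PI) * Ci * ecx w)%C.
Proof.
  assert (HP := PI_RGT_0); intros eps Heps.
  assert (He : 0 < Cmod (ecx w)) by (rewrite Cmod_ecx; apply exp_pos).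
  (* The four error terms below add up to at most [8 * e * m]; 22 is a comfortable majorant. *)
  set (e := eps / Cmod (ecx w) / 22).
  assert (He' : 0 < e) by (apply Rdiv_lt_0_compat; [now apply Rdiv_lt_0_compat|lra]).
  assert (He2 : 0 < Rmin e 1) by (apply Rmin_glb_lt; lra).
  assert (D1 : is_derive (fun y => exp (- (2 * PI) * y)) 0 (- (2 * PI))).
  { auto_derive; [easy|]; rewrite Rmult_0_r, exp_0; ring. }
  assert (D2 : is_derive (fun x => cos (2 * PI * x)) 0 0).
  { auto_derive; [easy|]; rewrite Rmult_0_r, sin_0; ring. }
  assert (D3 : is_derive (fun x => sin (2 * PI * x)) 0 (2 * PI)).
  { auto_derive; [easy|]; rewrite Rmult_0_r, cos_0; ring. }
  destruct (derive_eps _ _ _ D1 _ He2) as (d1 & Hd1 & K1).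
  destruct (derive_eps _ _ _ D2 _ He2) as (d2 & Hd2 & K2).
  destruct (derive_eps _ _ _ D3 _ He2) as (d3 & Hd3 & K3).
  set (d4 := e / (2 * PI * (2 * PI + 1))).
  assert (Hd4 : 0 < d4) by (apply Rdiv_lt_0_compat; [easy|apply Rmult_lt_0_compat; lra]).
  exists (Rmin (Rmin d1 d2) (Rmin (Rmin d3 (1 / (2 * PI))) d4)); split.
  { repeat apply Rmin_glb_lt; try lra; apply Rdiv_lt_0_compat; lra. }
  intros w' Hw'; set (k := (w' - w)%C) in *.
  assert (B1 := Rlt_le_trans _ _ _ Hw' (Rmin_l _ _)).
  assert (B2 := Rlt_le_trans _ _ _ Hw' (Rmin_r _ _)).
  assert (B3 := Rlt_le_trans _ _ _ B2 (Rmin_l _ _)).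
  assert (A1 := Rlt_le_trans _ _ _ B1 (Rmin_l _ _)).
  assert (A2 := Rlt_le_trans _ _ _ B1 (Rmin_r _ _)).
  assert (A3 := Rlt_le_trans _ _ _ B3 (Rmin_l _ _)).
  assert (A4 := Rlt_le_trans _ _ _ B3 (Rmin_r _ _)).
  assert (A5 := Rlt_le_trans _ _ _ B2 (Rmin_r _ _)); clear B1 B2 B3 Hw'.
  replace w' with (w + k)%C by (unfold k; ring).
  rewrite ecx_plus.
  replace (ecx w * ecx k - ecx w - RtoC (2 * PI) * Ci * ecx w * k)%C
    with (ecx w * (ecx k - 1 - RtoC (2 * PI) * Ci * k))%C by ring.
  rewrite Cmod_mult.
  assert (main : Cmod (ecx k - 1 - RtoC (2 * PI) * Ci * k) <= 22 * e * Cmod k).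
  { assert (Hx := fst_le_Cmod k); assert (Hy := snd_le_Cmod k); assert (Hk := Cmod_ge_0 k).
    destruct k as [x y]; simpl in Hx, Hy; set (m := Cmod (x, y)) in *.
    specialize (K1 y); specialize (K2 x); specialize (K3 x).
    rewrite !Rminus_0_r, !Rmult_0_r, exp_0 in K1.
    rewrite !Rminus_0_r, !Rmult_0_r, cos_0, Rmult_0_l, Rminus_0_r in K2.
    rewrite !Rminus_0_r, !Rmult_0_r, sin_0, Rminus_0_r in K3.
    assert (Ee : Rmin e 1 <= e) by apply Rmin_l.
    assert (E1 : Rmin e 1 <= 1) by apply Rmin_r.
    set (e0 := Rmin e 1) in *.
    assert (L1 : e0 * Rabs y <= e * m) by (apply Rmult_le_compat; [lra|apply Rabs_pos|lra|lra]).
    assert (L2 : e0 * Rabs x <= e * m) by (apply Rmult_le_compat; [lra|apply Rabs_pos|lra|lra]).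
    set (X := exp (- (2 * PI) * y)) in *.
    assert (HX : Rabs X <= 3).
    { unfold X; rewrite Rabs_pos_eq by apply Rlt_le, exp_pos; apply exp_le_3_small.
      rewrite Rabs_mult, Rabs_Ropp, (Rabs_pos_eq (2 * PI)) by lra.
      apply Rle_trans with (2 * PI * (1 / (2 * PI))); [apply Rmult_le_compat_l; lra|].
      right; field; lra. }
    assert (HX1 : Rabs (X - 1) <= (2 * PI + 1) * m).
    { replace (X - 1) with ((X - 1 - - (2 * PI) * y) + - (2 * PI) * y) by ring.
      eapply Rle_trans; [apply Rabs_triang|].
      rewrite Rabs_mult, Rabs_Ropp, (Rabs_pos_eq (2 * PI)) by lra.
      assert (e0 * Rabs y <= 1 * m) by (apply Rmult_le_compat; [lra|apply Rabs_pos|lra|lra]).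
      assert (2 * PI * Rabs y <= 2 * PI * m) by (apply Rmult_le_compat_l; lra). lra. }
    eapply Rle_trans; [apply Cmod_le_components|].
    unfold ecx, expi, RtoC, Ci; simpl; fold X.
    replace (X * cos (2 * PI * x) - 0 * sin (2 * PI * x) + - (1)
      + - ((2 * PI * 0 - 0 * 1) * x - (2 * PI * 1 + 0 * 0) * y))
      with ((X - 1 - - (2 * PI) * y) + X * (cos (2 * PI * x) - 1)) by ring.
    replace (X * sin (2 * PI * x) + 0 * cos (2 * PI * x) + - 0
      + - ((2 * PI * 0 - 0 * 1) * y + (2 * PI * 1 + 0 * 0) * x))
      with (X * (sin (2 * PI * x) - 2 * PI * x) + (X - 1) * (2 * PI * x)) by ring.
    assert (T1 := Rabs_triang (X - 1 - - (2 * PI) * y) (X * (cos (2 * PI * x) - 1))).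
    assert (T2 := Rabs_triang (X * (sin (2 * PI * x) - 2 * PI * x)) ((X - 1) * (2 * PI * x))).
    rewrite Rabs_mult in T1; rewrite 2!Rabs_mult in T2.
    assert (P1 : Rabs X * Rabs (cos (2 * PI * x) - 1) <= 3 * (e * m))
      by (apply Rmult_le_compat; try apply Rabs_pos; lra).
    assert (P2 : Rabs X * Rabs (sin (2 * PI * x) - 2 * PI * x) <= 3 * (e * m))
      by (apply Rmult_le_compat; try apply Rabs_pos; lra).
    assert (P3 : Rabs (X - 1) * Rabs (2 * PI * x) <= e * m).
    { rewrite Rabs_mult, (Rabs_pos_eq (2 * PI)) by lra.
      apply Rle_trans with ((2 * PI + 1) * d4 * (2 * PI * m)).
      - apply Rmult_le_compat; [apply Rabs_pos|apply Rmult_le_pos; [lra|apply Rabs_pos]| |].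
        + eapply Rle_trans; [exact HX1|apply Rmult_le_compat_l; lra].
        + apply Rmult_le_compat_l; lra.
      - right; unfold d4; field; lra. }
    assert (Hem : 0 <= e * m) by (apply Rmult_le_pos; lra).
    lra. }
  apply Rle_trans with (Cmod (ecx w) * (22 * e * Cmod k)); [apply Rmult_le_compat_l; lra|].
  right; unfold e; field; lra.
Qed.

Lemma cdiff_ecx (w : C) : cdiff ecx w.
Proof. eexists; apply cderive_ecx. Qed.

Lemma cdiff_comp (f g : C -> C) (z : C) : cdiff g z -> cdiff f (g z) -> cdiff (fun w => f (g w)) z.
Proof.
  intros Hg Hf; assert (Hgc := cdiff_continuous g z Hg).
  destruct Hg as [l Hl], Hf as [m Hm].
  exists (m * l)%C; intros eps Heps.
  set (A := Cmod l + 1); assert (HA : 0 < A) by (assert (H := Cmod_ge_0 l); unfold A; lra).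
  set (B := Cmod m + 1); assert (HB : 0 < B) by (assert (H := Cmod_ge_0 m); unfold B; lra).
  destruct (Hm (eps / (2 * A))) as (d1 & Hd1 & K1); [apply Rdiv_lt_0_compat; lra|].
  set (e2 := Rmin 1 (eps / (2 * B))).
  assert (He2 : 0 < e2) by (apply Rmin_glb_lt; [lra|apply Rdiv_lt_0_compat; lra]).
  destruct (Hl e2 He2) as (d2 & Hd2 & K2).
  destruct (Hgc d1 Hd1) as (d3 & Hd3 & K3).
  exists (Rmin d2 d3); split; [now apply Rmin_glb_lt|]; intros w Hw.
  specialize (K2 w (Rlt_le_trans _ _ _ Hw (Rmin_l _ _))).
  specialize (K3 w (Rlt_le_trans _ _ _ Hw (Rmin_r _ _))).
  specialize (K1 (g w) K3); clear K3 Hw.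
  set (t := Cmod (w - z)) in *; assert (Ht : 0 <= t) by apply Cmod_ge_0.
  assert (HG : Cmod (g w - g z) <= A * t).
  { replace (g w - g z)%C with ((g w - g z - l * (w - z)) + l * (w - z))%C by ring.
    eapply Rle_trans; [apply Cmod_triangle|]; rewrite Cmod_mult; fold t; unfold A.
    assert (e2 * t <= 1 * t) by (apply Rmult_le_compat_r; [easy|apply Rmin_l]). lra. }
  replace (f (g w) - f (g z) - m * l * (w - z))%C
    with ((f (g w) - f (g z) - m * (g w - g z)) + m * (g w - g z - l * (w - z)))%C by ring.
  eapply Rle_trans; [apply Cmod_triangle|]; rewrite (Cmod_mult m).
  assert (P1 : eps / (2 * A) * Cmod (g w - g z) <= eps / 2 * t).
  { apply Rle_trans with (eps / (2 * A) * (A * t)).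
    - apply Rmult_le_compat_l; [apply Rlt_le, Rdiv_lt_0_compat; lra|easy].
    - right; field; lra. }
  assert (P2 : Cmod m * Cmod (g w - g z - l * (w - z)) <= eps / 2 * t).
  { apply Rle_trans with (B * (eps / (2 * B) * t)).
    - apply Rmult_le_compat; try apply Cmod_ge_0; [unfold B; lra|].
      eapply Rle_trans; [exact K2|]; apply Rmult_le_compat_r; [easy|apply Rmin_r].
    - right; field; lra. }
  lra.
Qed.

Lemma cdiff_mult_const (c : C) (z : C) : cdiff (fun w => (c * w)%C) z.
Proof.
  exists c; intros eps Heps; exists 1; split; [lra|]; intros w _.
  replace (c * w - c * z - c * (w - z))%C with (RtoC 0) by ring; rewrite Cmod_0.
  apply Rmult_le_pos; [lra|apply Cmod_ge_0].
Qed.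

(** A nonzero derivative dominates the remainder near the point. Read backwards, this is a Lipschitz
    bound for a local inverse. *)
Lemma cderive_neq_0_expands (f : C -> C) (z l : C) : l <> 0%C -> cderive f z l ->
  exists delta, 0 < delta /\ forall w, Cmod (w - z) < delta ->
    Cmod (w - z) <= 2 / Cmod l * Cmod (f w - f z).
Proof.
  intros Hl H; apply Cmod_gt_0 in Hl.
  destruct (H (Cmod l / 2)) as (d & Hd & K); [lra|]; exists d; split; [easy|]; intros w Hw.
  specialize (K w Hw).
  assert (T := Cmod_triangle (f w - f z) (- (f w - f z - l * (w - z)))).
  replace (f w - f z + - (f w - f z - l * (w - z)))%C with (l * (w - z))%C in T by ring.
  rewrite Cmod_opp, Cmod_mult in T.
  apply (Rmult_le_reg_l (Cmod l / 2)); [lra|].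
  replace (Cmod l / 2 * (2 / Cmod l * Cmod (f w - f z))) with (Cmod (f w - f z)) by (field; lra).
  lra.
Qed.

(* The principal logarithm, divided by [2 pi i]; junk on the half-plane [Re z <= 0]. *)
Definition clog (z : C) : C :=
  (atan (snd z / fst z) / (2 * PI), - ln (fst z ^ 2 + snd z ^ 2) / (4 * PI)).

Lemma ecx_clog (z : C) : 0 < fst z -> ecx (clog z) = z.
Proof.
  assert (HP := PI_RGT_0); destruct z as [x y]; cbn [fst snd]; intros Hx.
  assert (HN : 0 < x ^ 2 + y ^ 2) by (assert (0 <= y ^ 2) by apply pow2_ge_0; nra).
  unfold ecx, clog, expi; cbn [fst snd].
  replace (2 * PI * (atan (y / x) / (2 * PI))) with (atan (y / x)) by (field; lra).
  replace (- (2 * PI) * (- ln (x ^ 2 + y ^ 2) / (4 * PI))) with (/ 2 * ln (x ^ 2 + y ^ 2)) by (field; lra).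
  assert (E : exp (/ 2 * ln (x ^ 2 + y ^ 2)) = x * sqrt (1 + (y / x) ^ 2)).
  { change (Rpower (x ^ 2 + y ^ 2) (/ 2) = x * sqrt (1 + (y / x) ^ 2)).
    rewrite Rpower_sqrt by easy.
    replace (x ^ 2 + y ^ 2) with (x ^ 2 * (1 + (y / x) ^ 2)) by (field; lra).
    rewrite sqrt_mult, sqrt_pow2; [easy|lra|nra|assert (H := pow2_ge_0 (y / x)); lra]. }
  rewrite E, cos_atan, sin_atan, Rsqr_pow2.
  assert (HS : 0 < sqrt (1 + (y / x) ^ 2)).
  { apply sqrt_lt_R0; assert (H := pow2_ge_0 (y / x)); lra. }
  unfold RtoC, Cmult; simpl; f_equal; field; split; simpl in HS; lra.
Qed.

Lemma clog_continuous (z : C) : 0 < fst z -> forall eps, 0 < eps ->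
  exists delta, 0 < delta /\ forall w, Cmod (w - z) < delta -> Cmod (clog w - clog z) < eps.
Proof.
  intros Hz eps Heps.
  assert (H1 : continuous (fun p : R * R => atan (snd p / fst p) / (2 * PI)) z).
  { unfold Rdiv; apply (continuous_mult (fun p : R * R => atan (snd p / fst p)) (fun _ => / (2 * PI)));
      [|apply continuous_const].
    apply (continuous_comp (fun p : R * R => snd p * / fst p) atan).
    - apply (continuous_mult (fun p : R * R => snd p) (fun p : R * R => / fst p));
        [apply continuous_snd|].
      apply (continuous_comp (fun p : R * R => fst p) Rinv); [apply continuous_fst|].
      apply continuous_Rinv; lra.
    - apply (@ex_derive_continuous R_AbsRing R_NormedModule).
      eexists; apply is_derive_Reals, derivable_pt_lim_atan. }
  assert (HN : 0 < fst z ^ 2 + snd z ^ 2) by (assert (0 <= snd z ^ 2) by apply pow2_ge_0; nra).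
  assert (H2 : continuous (fun p : R * R => - ln (fst p ^ 2 + snd p ^ 2) / (4 * PI)) z).
  { unfold Rdiv; apply (continuous_mult (fun p : R * R => - ln (fst p ^ 2 + snd p ^ 2)) (fun _ => / (4 * PI)));
      [|apply continuous_const].
    apply (continuous_opp (fun p : R * R => ln (fst p ^ 2 + snd p ^ 2))).
    apply (continuous_comp (fun p : R * R => fst p ^ 2 + snd p ^ 2) ln).
    - apply (continuous_plus (fun p : R * R => fst p ^ 2) (fun p : R * R => snd p ^ 2)); simpl.
      + apply (continuous_mult (fun p : R * R => fst p) (fun p : R * R => fst p * 1));
          [apply continuous_fst|].
        apply (continuous_mult (fun p : R * R => fst p) (fun _ => 1));
          [apply continuous_fst|apply continuous_const].
      + apply (continuous_mult (fun p : R * R => snd p) (fun p : R * R => snd p * 1));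
          [apply continuous_snd|].
        apply (continuous_mult (fun p : R * R => snd p) (fun _ => 1));
          [apply continuous_snd|apply continuous_const].
    - apply (@ex_derive_continuous R_AbsRing R_NormedModule).
      eexists; apply is_derive_Reals, derivable_pt_lim_ln; exact HN. }
  destruct (proj1 (filterlim_locally _ _) H1 (mkposreal (eps / 2) ltac:(lra))) as [d1 K1].
  destruct (proj1 (filterlim_locally _ _) H2 (mkposreal (eps / 2) ltac:(lra))) as [d2 K2].
  exists (Rmin d1 d2); split; [apply Rmin_glb_lt; apply cond_pos|]; intros w Hw.
  assert (B : forall d : posreal, Cmod (w - z) < d -> ball z d w).
  { intros d Hd; split; [eapply Rle_lt_trans; [apply (fst_le_Cmod (w - z))|easy]|
      eapply Rle_lt_trans; [apply (snd_le_Cmod (w - z))|easy]]. }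
  assert (L1 := K1 w (B d1 (Rlt_le_trans _ _ _ Hw (Rmin_l _ _)))).
  assert (L2 := K2 w (B d2 (Rlt_le_trans _ _ _ Hw (Rmin_r _ _)))).
  eapply Rle_lt_trans; [apply Cmod_le_components|].
  change (Rabs (fst (clog w) - fst (clog z)) + Rabs (snd (clog w) - snd (clog z)) < eps).
  change (Rabs (fst (clog w) - fst (clog z)) < eps / 2) in L1.
  change (Rabs (snd (clog w) - snd (clog z)) < eps / 2) in L2.
  lra.
Qed.

(** Derivative of an inverse: [clog] is continuous and [ecx] has a nonzero derivative at [clog z],
    so an increment of the logarithm is bounded by a multiple of that of its argument. *)
Lemma cdiff_clog (z : C) : 0 < fst z -> cdiff clog z.
Proof.
  intros Hz; set (u := clog z).
  assert (HE : ecx u = z) by now apply ecx_clog.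
  assert (Hl := cderive_ecx u); set (l := (RtoC (2 * PI) * Ci * ecx u)%C) in *.
  assert (Hl0 : l <> 0%C).
  { assert (HP := PI_RGT_0); apply Cmult_neq_0; [apply Cmult_neq_0|apply ecx_neq_0].
    - intros X; apply RtoC_inj in X; lra.
    - intros X; injection X; lra. }
  destruct (cderive_neq_0_expands ecx u l Hl0 Hl) as (d0 & Hd0 & K0).
  exists (/ l)%C; intros eps Heps; apply Cmod_gt_0 in Hl0 as Hlp.
  destruct (Hl (eps * Cmod l * Cmod l / 2)) as (d1 & Hd1 & K1).
  { apply Rdiv_lt_0_compat; [|lra]; repeat apply Rmult_lt_0_compat; easy. }
  destruct (clog_continuous z Hz (Rmin d0 d1)) as (d & Hd & K); [now apply Rmin_glb_lt|].
  exists (Rmin d (fst z)); split; [now apply Rmin_glb_lt|]; intros w Hw.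
  assert (A := K w (Rlt_le_trans _ _ _ Hw (Rmin_l _ _))); fold u in A.
  assert (Hw0 : 0 < fst w).
  { assert (B := Rlt_le_trans _ _ _ Hw (Rmin_r _ _)).
    assert (B' := fst_le_Cmod (w - z)); simpl in B'; apply Rabs_le_between in B'; lra. }
  assert (A1 := K1 _ (Rlt_le_trans _ _ _ A (Rmin_r _ _))).
  assert (A0 := K0 _ (Rlt_le_trans _ _ _ A (Rmin_l _ _))).
  rewrite (ecx_clog w Hw0), HE in A0, A1; fold u.
  replace (clog w - u - / l * (w - z))%C with (- / l * (w - z - l * (clog w - u)))%C
    by (field; easy).
  rewrite Cmod_mult, Cmod_opp, Cmod_inv by easy.
  apply Rle_trans with (/ Cmod l * (eps * Cmod l * Cmod l / 2 * (2 / Cmod l * Cmod (w - z)))).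
  - apply Rmult_le_compat_l; [now apply Rlt_le, Rinv_0_lt_compat|].
    eapply Rle_trans; [exact A1|]; apply Rmult_le_compat_l; [|easy].
    apply Rlt_le, Rdiv_lt_0_compat; [|lra]; repeat apply Rmult_lt_0_compat; easy.
  - right; field; lra.
Qed.

Lemma near_1_fst (z : C) : Cmod (z - 1) <= 1 / 2 -> 1 / 2 <= fst z.
Proof.
  intros H; assert (B := fst_le_Cmod (z - 1)); simpl in B; apply Rabs_le_between in B; lra.
Qed.

(** Supplies the bound 1 for the logarithmic lift in [taylor3]; only its independence of the base
    point matters. *)
Lemma clog_bound (z : C) : Cmod (z - 1) <= 1 / 2 -> Cmod (clog z) <= 1.
Proof.
  intros H; assert (Hx := near_1_fst z H).
  assert (HP : 3 < PI) by (assert (K := PI2_3_2); lra).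
  assert (B1 := fst_le_Cmod (z - 1)); assert (B2 := snd_le_Cmod (z - 1)); simpl in B1, B2.
  apply Rabs_le_between in B1; apply Rabs_le_between in B2.
  eapply Rle_trans; [apply Cmod_le_components|]; unfold clog; cbn [fst snd].
  set (N := fst z ^ 2 + snd z ^ 2).
  assert (HN : 1 / 4 <= N <= 5 / 2) by (unfold N; nra).
  assert (HA : Rabs (atan (snd z / fst z) / (2 * PI)) <= 1 / 4).
  { assert (A := atan_bound (snd z / fst z)).
    unfold Rdiv at 1; rewrite Rabs_mult, (Rabs_pos_eq (/ _)) by (apply Rlt_le, Rinv_0_lt_compat; lra).
    apply (Rmult_le_reg_r (2 * PI)); [lra|]; rewrite Rmult_assoc, Rinv_l by lra.
    rewrite Rmult_1_r; apply Rabs_le; lra. }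
  assert (HL : Rabs (ln N) <= 3).
  { apply Rabs_le; split.
    - assert (K : ln (/ N) <= / N - 1).
      { rewrite <- (ln_exp (/ N - 1)); apply ln_le; [apply Rinv_0_lt_compat; lra|].
        assert (Q := exp_ineq1_le (/ N - 1)); lra. }
      rewrite ln_Rinv in K by lra.
      assert (/ N <= 4) by (replace 4 with (/ (1 / 4)) by field; apply Rinv_le_contravar; lra). lra.
    - assert (K : ln N <= N - 1).
      { rewrite <- (ln_exp (N - 1)); apply ln_le; [lra|].
        assert (Q := exp_ineq1_le (N - 1)); lra. }
      lra. }
  assert (HB : Rabs (- ln N / (4 * PI)) <= 1 / 4).
  { unfold Rdiv at 1; rewrite Rabs_mult, Rabs_Ropp, (Rabs_pos_eq (/ _))
      by (apply Rlt_le, Rinv_0_lt_compat; lra).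
    apply (Rmult_le_reg_r (4 * PI)); [lra|]; rewrite Rmult_assoc, Rinv_l by lra; lra. }
  lra.
Qed.

Lemma clog_1 : clog 1 = 0%C.
Proof.
  unfold clog; simpl; replace (1 * (1 * 1) + 0 * (0 * 1)) with 1 by ring.
  unfold Rdiv; rewrite ln_1, Rmult_0_l, atan_0, Ropp_0, !Rmult_0_l; easy.
Qed.

(** The condition |t| < 1 / 4 puts 2 pi t between - pi / 2 and pi / 2, where [atan] inverts
    [tan]. *)
Lemma clog_expi (t : R) : Rabs t < 1 / 4 -> clog (expi t) = RtoC t.
Proof.
  intros Ht; assert (HP := PI_RGT_0); apply Rabs_def2 in Ht.
  unfold clog, expi; cbn [fst snd].
  replace (cos (2 * PI * t) ^ 2 + sin (2 * PI * t) ^ 2) with 1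
    by (rewrite <- !Rsqr_pow2, Rplus_comm; symmetry; apply sin2_cos2).
  rewrite ln_1; change (sin (2 * PI * t) / cos (2 * PI * t)) with (tan (2 * PI * t)).
  rewrite atan_tan by nra.
  unfold RtoC; f_equal; field; lra.
Qed.

(** * Taylor expansion of the lift, uniform along the circle *)

(** Lebesgue number argument: a local radius near each point of [0, 1] gives a common one by
    compactness, and periodicity spreads it over the line. *)
Lemma uniform_radius (P : R -> R -> Prop) :
  (forall t, exists d, 0 < d /\ forall s, Rabs (s - t) < d -> P s d) ->
  (forall s d d', 0 < d' -> d' <= d -> P s d -> P s d') ->
  (forall s d (k : Z), P s d -> P (s + IZR k) d) ->
  exists d, 0 < d /\ forall s, P s d.
Proof.
  intros Hloc Hmono Hper.
  set (delta := fun t => proj1_sig (constructive_indefinite_description _ (Hloc t))).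
  assert (Hd : forall t, 0 < delta t /\ forall s, Rabs (s - t) < delta t -> P s (delta t)).
  { intros t; apply (proj2_sig (constructive_indefinite_description _ (Hloc t))). }
  destruct (compactness_value_1d 0 1 (fun t => mkposreal (delta t) (proj1 (Hd t)))) as [d H].
  exists d; split; [apply d|]; intros s.
  assert (Hf := base_fp s); unfold frac_part in Hf.
  replace s with ((s - IZR (Int_part s)) + IZR (Int_part s)) by ring.
  apply Hper; apply NNPP; intros HN.
  apply (H (s - IZR (Int_part s)) ltac:(lra)); intros (t & _ & Ht1 & Ht2).
  apply HN, (Hmono _ (delta t)); [apply d|exact Ht2|now apply Hd].
Qed.

Lemma expi_IZR (x : R) (k : Z) : expi (x + IZR k) = expi x.
Proof.
  assert (H : forall (n : nat) y, expi (y + INR n) = expi y).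
  { intros n y; rewrite expi_plus, expi_INR; ring. }
  destruct k as [|k|k].
  - now rewrite Rplus_0_r.
  - rewrite <- positive_nat_Z, <- INR_IZR_INZ; apply H.
  - change (Z.neg k) with (- Z.pos k)%Z; rewrite opp_IZR, <- positive_nat_Z, <- INR_IZR_INZ.
    rewrite <- (H (Pos.to_nat k)); f_equal; ring.
Qed.

Lemma zero_of_linear_bound (u K r : R) : 0 < r -> 0 <= K ->
  (forall s, 0 < s <= r -> Rabs u <= K * s) -> u = 0.
Proof.
  intros Hr HK H; destruct (Req_dec u 0) as [X|X]; [easy|exfalso].
  apply Rabs_pos_lt in X.
  assert (Hs : 0 < Rmin r (Rabs u / (2 * (K + 1))))
    by (apply Rmin_glb_lt; [easy|apply Rdiv_lt_0_compat; lra]).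
  specialize (H _ (conj Hs (Rmin_l _ _))).
  assert (B := Rmult_le_compat_l (K + 1) _ _ ltac:(lra) (Rmin_r r (Rabs u / (2 * (K + 1))))).
  replace ((K + 1) * (Rabs u / (2 * (K + 1)))) with (Rabs u / 2) in B by (field; lra); lra.
Qed.

(** Comparing [s] with [- s] separates the two terms; dividing out powers of [s] and letting it tend
    to 0 kills both. Applied to imaginary parts, it shows that the Taylor coefficients of the lift
    are real. *)
Lemma cubic_coefficients_zero (u v K r : R) : 0 < r -> 0 <= K ->
  (forall s, Rabs s <= r -> Rabs (u * s + v * s ^ 2) <= K * Rabs s ^ 3) -> u = 0 /\ v = 0.
Proof.
  intros Hr HK H.
  assert (H' : forall s, 0 < s <= r -> Rabs u <= K * s ^ 2 /\ Rabs v <= K * s).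
  { intros s Hs; assert (P := H s); assert (N := H (- s)).
    rewrite Rabs_Ropp, (Rabs_pos_eq s) in N by lra; rewrite (Rabs_pos_eq s) in P by lra.
    specialize (P ltac:(lra)); specialize (N ltac:(lra)).
    apply Rabs_le_between in P; apply Rabs_le_between in N.
    split; apply Rabs_le; split; [apply (Rmult_le_reg_l s)|apply (Rmult_le_reg_l s)|
      apply (Rmult_le_reg_l (s ^ 2))|apply (Rmult_le_reg_l (s ^ 2))]; try apply pow_lt; lra. }
  split.
  - apply (zero_of_linear_bound u (K * r) r Hr); [apply Rmult_le_pos; lra|]; intros s Hs.
    destruct (H' s Hs) as [B _]; eapply Rle_trans; [exact B|].
    replace (K * s ^ 2) with (K * s * s) by ring; apply Rmult_le_compat_r; [lra|].
    apply Rmult_le_compat_l; lra.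
  - apply (zero_of_linear_bound v K r Hr HK); intros s Hs; now apply H'.
Qed.

(** [uniform_radius] with the radius doubling as the lower bound: the property of [x] and [d] is
    [d <= f x]. *)
Lemma periodic_lower_bound (f : R -> R) : (forall x, continuous f x) ->
  (forall x, f (x + 1) = f x) -> (forall x, 0 < f x) -> exists m, 0 < m /\ forall x, m <= f x.
Proof.
  intros Hc Hper Hpos; apply (uniform_radius (fun x d => d <= f x)).
  - intros t; assert (Ht := Hpos t).
    destruct (proj1 (continuous_eps f t) (Hc t) (f t / 2)) as (d & Hd & K); [lra|].
    exists (Rmin d (f t / 2)); split; [apply Rmin_glb_lt; lra|]; intros s Hs.
    specialize (K s (Rlt_le_trans _ _ _ Hs (Rmin_l _ _))).
    apply Rabs_def2 in K; assert (T := Rmin_r d (f t / 2)); lra.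
  - intros; lra.
  - intros s d k H; rewrite (periodic_IZR f 0); [lra|intros; rewrite Hper; ring].
Qed.

Section Lift.

Variables (g : C -> C) (W : C -> Prop) (F : R -> R).
Hypothesis W_open : open W.
Hypothesis W_circle : forall z, unit_circle z -> W z.
Hypothesis g_diff : forall z, W z -> @ex_derive C_AbsRing C_NormedModule g z.
Hypothesis F_cont : forall x, continuous F x.
Hypothesis F_lift : forall x, g (expi x) = expi (F x).
Hypothesis F_deg1 : forall x, F (x + 1) = F x + 1.

(** Since g has modulus 1 on the circle, the bound 1 / 2 keeps g z / g (expi s) in the disk around 1
    where the principal logarithm is holomorphic. *)
Lemma annulus_radius : exists d, 0 < d /\ forall s z, Cmod (z - expi s) <= d ->
  W z /\ Cmod (g z - g (expi s)) <= 1 / 2.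
Proof.
  assert (HP := PI_RGT_0).
  apply (uniform_radius (fun s d => forall z, Cmod (z - expi s) <= d ->
    W z /\ Cmod (g z - g (expi s)) <= 1 / 2)).
  - intros t.
    assert (Wt : W (expi t)) by (apply W_circle, Cmod_expi).
    destruct (cdiff_continuous g (expi t)) with (eps := 1 / 4) as (d0 & Hd0 & Hg);
      [now apply ex_derive_cdiff, g_diff|lra|].
    destruct (W_open _ Wt) as [d1 Hd1].
    assert (Hm : 0 < Rmin d0 d1) by (apply Rmin_glb_lt; [easy|apply d1]).
    set (d := Rmin d0 d1 / (2 * (1 + 4 * PI))).
    assert (Hd : 0 < d) by (apply Rdiv_lt_0_compat; lra).
    assert (Hdd : d + 4 * PI * d < Rmin d0 d1).
    { replace (d + 4 * PI * d) with (Rmin d0 d1 / 2) by (unfold d; field; lra); lra. }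
    exists d; split; [easy|]; intros s Hs z Hz.
    assert (Hst : Cmod (expi s - expi t) <= 4 * PI * d).
    { eapply Rle_trans; [apply expi_lip|]; apply Rmult_le_compat_l; lra. }
    assert (Hzt : Cmod (z - expi t) < Rmin d0 d1).
    { replace (z - expi t)%C with ((z - expi s) + (expi s - expi t))%C by ring.
      eapply Rle_lt_trans; [apply Cmod_triangle|]; lra. }
    split.
    + apply Hd1.
      assert (B := Rlt_le_trans _ _ _ Hzt (Rmin_r _ _)).
      split; [eapply Rle_lt_trans; [apply (fst_le_Cmod (z - expi t))|easy]|
        eapply Rle_lt_trans; [apply (snd_le_Cmod (z - expi t))|easy]].
    + assert (B := Hg z (Rlt_le_trans _ _ _ Hzt (Rmin_l _ _))).
      assert (B' : Cmod (g (expi s) - g (expi t)) < 1 / 4).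
      { apply Hg; assert (X := Rmin_l d0 d1); lra. }
      replace (g z - g (expi s))%C with ((g z - g (expi t)) - (g (expi s) - g (expi t)))%C by ring.
      eapply Rle_trans; [apply Cmod_triangle|]; rewrite Cmod_opp; lra.
  - intros s d d' _ Hd' H z Hz; apply H; lra.
  - intros s d k H z Hz; rewrite expi_IZR in *; auto.
Qed.

Lemma F_uniform : exists d, 0 < d /\ forall x t, Rabs t <= d -> Rabs (F (x + t) - F x) < 1 / 4.
Proof.
  apply (uniform_radius (fun x d => forall t, Rabs t <= d -> Rabs (F (x + t) - F x) < 1 / 4)).
  - intros t0; destruct (proj1 (continuous_eps F t0) (F_cont t0) (1 / 8)) as (d & Hd & H); [lra|].
    exists (d / 2); split; [lra|]; intros x Hx t Ht.
    assert (H1 := H x ltac:(lra)).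
    assert (H2 : Rabs (F (x + t) - F t0) < 1 / 8).
    { apply H; replace (x + t - t0) with ((x - t0) + t) by ring.
      eapply Rle_lt_trans; [apply Rabs_triang|]; lra. }
    replace (F (x + t) - F x) with ((F (x + t) - F t0) - (F x - F t0)) by ring.
    eapply Rle_lt_trans; [apply Rabs_triang|]; rewrite Rabs_Ropp; lra.
  - intros x d d' _ Hd' H t Ht; apply H; lra.
  - intros x d k H t Ht; replace (x + IZR k + t) with (x + t + IZR k) by ring.
    rewrite !(periodic_IZR F 1 F_deg1).
    replace (F (x + t) + IZR k * 1 - (F x + IZR k * 1)) with (F (x + t) - F x) by ring; auto.
Qed.

(** Near [x] the lift extends holomorphically as F x + Psi, with [Psi] the logarithm of a quotient
    of values of g. The radius [r0] and the bound 1 do not depend on [x], so neither does [K]. The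
    last clause restricts the expansion to the real axis. *)
Lemma lift_taylor : exists r K, 0 < r /\ 0 <= K /\ forall x, exists A B,
  Rabs A <= K /\ Rabs B <= K /\
  (forall w, Cmod w <= r -> W (ecx (RtoC x + w)) /\
     exists w', g (ecx (RtoC x + w)) = ecx (RtoC (F x) + w') /\
       Cmod (w' - RtoC A * w - RtoC B * w ^ 2) <= K * Cmod w ^ 3) /\
  (forall s, Rabs s <= r -> Rabs (F (x + s) - F x - A * s - B * s ^ 2) <= K * Rabs s ^ 3).
Proof.
  destruct annulus_radius as (d & Hd & HW).
  destruct F_uniform as (d' & Hd' & HF).
  destruct (cdiff_continuous ecx 0 (cdiff_ecx 0) d Hd) as (d1 & Hd1 & He).
  set (r0 := d1 / 2); assert (Hr0 : 0 < r0) by (unfold r0; lra).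
  set (r := Rmin (r0 / 2) d'); assert (Hr : 0 < r) by (apply Rmin_glb_lt; lra).
  set (K := 1 / r0 + 1 / r0 ^ 2 + 2 * 1 / r0 ^ 3).
  assert (K1 : 0 <= 1 / r0) by (apply Rlt_le, Rdiv_lt_0_compat; lra).
  assert (K2 : 0 <= 1 / r0 ^ 2) by (apply Rlt_le, Rdiv_lt_0_compat; [lra|now apply pow_lt]).
  assert (K3 : 0 <= 2 * 1 / r0 ^ 3) by (apply Rlt_le, Rdiv_lt_0_compat; [lra|now apply pow_lt]).
  exists r, K; split; [easy|]; split; [unfold K; lra|]; intros x.
  set (z := fun w => (expi x * ecx w)%C).
  assert (Hz : forall w, ecx (RtoC x + w) = z w) by (intros w; now rewrite ecx_plus, ecx_RtoC).
  assert (Hgx : g (expi x) <> 0%C) by (rewrite F_lift; apply expi_neq_0).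
  assert (Hnear : forall w, Cmod w <= r0 -> W (z w) /\ Cmod (g (z w) / g (expi x) - 1) <= 1 / 2).
  { intros w Hw; destruct (HW x (z w)) as [H1 H2].
    - unfold z; replace (expi x * ecx w - expi x)%C with (expi x * (ecx w - 1))%C by ring.
      rewrite Cmod_mult, Cmod_expi, Rmult_1_l; apply Rlt_le; rewrite <- ecx_0 at 1.
      apply He; replace (w - 0)%C with w by ring; unfold r0 in *; lra.
    - split; [easy|].
      replace (g (z w) / g (expi x) - 1)%C with ((g (z w) - g (expi x)) / g (expi x))%C by (field; easy).
      rewrite Cmod_div, F_lift, Cmod_expi, <- F_lift by easy; lra. }
  set (Psi := fun w => clog (/ g (expi x) * g (z w))).
  assert (HPsi : forall w, Cmod w <= r0 -> g (z w) = ecx (RtoC (F x) + Psi w)).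
  { intros w Hw; destruct (Hnear w Hw) as [_ H].
    replace (g (z w) / g (expi x))%C with (/ g (expi x) * g (z w))%C in H by (field; easy).
    apply near_1_fst in H.
    rewrite ecx_plus; unfold Psi; rewrite ecx_clog, ecx_RtoC, <- F_lift by lra; field; easy. }
  destruct (taylor3 Psi 0 r0 1 Hr0) as (a & b & Ha & Hb & HT).
  { intros w Hw; replace (w - 0)%C with w in Hw by ring; destruct (Hnear w Hw) as [H1 H2].
    unfold Psi; apply (cdiff_comp clog (fun w => / g (expi x) * g (z w))%C).
    - apply (cdiff_comp (fun u => / g (expi x) * u)%C (fun w => g (z w))); [|apply cdiff_mult_const].
      apply (cdiff_comp g z); [|now apply ex_derive_cdiff, g_diff].
      unfold z; apply (cdiff_comp (fun u => expi x * u)%C ecx); [apply cdiff_ecx|apply cdiff_mult_const].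
    - apply cdiff_clog, Rlt_le_trans with (1 / 2); [lra|]; apply near_1_fst.
      replace (/ g (expi x) * g (z w))%C with (g (z w) / g (expi x))%C by (field; easy); easy. }
  { intros w Hw; replace (w - 0)%C with w in Hw by ring; destruct (Hnear w Hw) as [H1 H2].
    apply clog_bound.
    replace (/ g (expi x) * g (z w))%C with (g (z w) / g (expi x))%C by (field; easy); easy. }
  assert (HT' : forall w, Cmod w <= r0 / 2 -> Cmod (Psi w - a * w - b * w ^ 2) <= K * Cmod w ^ 3).
  { intros w Hw; specialize (HT w Hw).
    assert (P0 : Psi 0 = 0%C).
    { unfold Psi, z; rewrite ecx_0, Cmult_1_r, Cinv_l by easy; apply clog_1. }
    rewrite P0, Cplus_0_l in HT.
    replace (Psi w - 0 - a * w - b * w ^ 2)%C with (Psi w - a * w - b * w ^ 2)%C in HT by ring.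
    eapply Rle_trans; [exact HT|]; apply Rmult_le_compat_r; [apply pow_le, Cmod_ge_0|unfold K; lra]. }
  assert (HR : forall s, Rabs s <= r -> Psi (RtoC s) = RtoC (F (x + s) - F x)).
  { intros s Hs; unfold Psi, z; rewrite ecx_RtoC, <- expi_plus, !F_lift.
    rewrite <- expi_opp, <- expi_plus; replace (- F x + F (x + s)) with (F (x + s) - F x) by ring.
    apply clog_expi, HF; eapply Rle_trans; [exact Hs|apply Rmin_r]. }
  assert (HS : forall s, Rabs s <= r ->
    Cmod (RtoC (F (x + s) - F x) - a * RtoC s - b * RtoC s ^ 2) <= K * Rabs s ^ 3).
  { intros s Hs; rewrite <- (HR s Hs), <- Cmod_R; apply HT'.
    rewrite Cmod_R; eapply Rle_trans; [exact Hs|apply Rmin_l]. }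
  (* On the real axis [Psi] is the real number F (x + s) - F x, so the imaginary part of the
     quadratic polynomial is O(s^3). *)
  assert (Him : snd a = 0 /\ snd b = 0).
  { apply (cubic_coefficients_zero _ _ K r Hr); [unfold K; lra|]; intros s Hs.
    eapply Rle_trans; [|exact (HS s Hs)]; rewrite <- Cmod_opp.
    eapply Rle_trans; [|apply snd_le_Cmod]; right; f_equal; simpl; ring. }
  destruct a as [A a2], b as [B b2]; simpl in Him; destruct Him as [-> ->].
  exists A, B; split; [|split; [|split]].
  - change (A, 0) with (RtoC A) in Ha; rewrite Cmod_R in Ha; unfold K; lra.
  - change (B, 0) with (RtoC B) in Hb; rewrite Cmod_R in Hb; unfold K; lra.
  - intros w Hw; rewrite Hz.
    assert (Hw2 : Cmod w <= r0 / 2) by (eapply Rle_trans; [exact Hw|apply Rmin_l]).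
    split; [apply Hnear; lra|].
    exists (Psi w); split; [apply HPsi; lra|]; now apply HT'.
  - intros s Hs; specialize (HS s Hs).
    rewrite <- Cmod_R; eapply Rle_trans; [|exact HS]; right; apply (f_equal Cmod).
    change (A, 0) with (RtoC A); change (B, 0) with (RtoC B).
    rewrite !RtoC_minus, !RtoC_mult, RtoC_pow; ring.
Qed.

End Lift.

(** * Differentiability from power series and from jets *)

Lemma is_pseries_fst (a : nat -> C) (x : R) (l : C) :
  @is_pseries R_AbsRing C_R_NormedModule a x l -> is_pseries (fun n => fst (a n)) x (fst l).
Proof.
  unfold is_pseries, is_series; intros H.
  apply (filterlim_ext (fun n => fst (sum_n (fun k => scal (pow_n (K := R_AbsRing) x k) (a k)) n))).
  - intros n; induction n as [|n IH]; [rewrite !sum_O; reflexivity|].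
    rewrite !sum_Sn, <- IH; reflexivity.
  - eapply filterlim_comp; [exact H|]; apply (continuous_fst (U := R_UniformSpace)).
Qed.

Lemma is_pseries_snd (a : nat -> C) (x : R) (l : C) :
  @is_pseries R_AbsRing C_R_NormedModule a x l -> is_pseries (fun n => snd (a n)) x (snd l).
Proof.
  unfold is_pseries, is_series; intros H.
  apply (filterlim_ext (fun n => snd (sum_n (fun k => scal (pow_n (K := R_AbsRing) x k) (a k)) n))).
  - intros n; induction n as [|n IH]; [rewrite !sum_O; reflexivity|].
    rewrite !sum_Sn, <- IH; reflexivity.
  - eapply filterlim_comp; [exact H|]; apply (continuous_snd (U := R_UniformSpace)).
Qed.

(** The radius of convergence is positive: otherwise the terms at distance r / 2 would not tend to
    0, although the series converges there. *)
Lemma ex_derive_pseries (f : R -> R) (a : nat -> R) (t0 r : R) : 0 < r ->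
  (forall t, Rabs (t - t0) < r -> is_pseries a (t - t0) (f t)) -> ex_derive f t0.
Proof.
  intros Hr H.
  assert (HC : Rbar_lt (Rabs 0) (CV_radius a)).
  { rewrite Rabs_R0; destruct (Rbar_lt_le_dec 0 (CV_radius a)) as [L|L]; [easy|exfalso].
    assert (P := H (t0 + r / 2)); replace (t0 + r / 2 - t0) with (r / 2) in P by ring.
    specialize (P ltac:(rewrite Rabs_pos_eq; lra)).
    apply (CV_disk_outside a (r / 2)).
    - eapply Rbar_le_lt_trans; [exact L|]; simpl; rewrite Rabs_pos_eq; lra.
    - apply is_lim_seq_ext with (fun n => (r / 2) ^ n * a n); [intros n; apply Rmult_comm|].
      apply ex_series_lim_0; exists (f (t0 + r / 2)); revert P; apply is_series_ext.
      intros n; now rewrite pow_n_pow. }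
  assert (HD := is_derive_PSeries a 0 HC).
  exists (PSeries (PS_derive a) 0).
  apply (is_derive_ext_loc (fun t => PSeries a (t - t0))).
  - exists (mkposreal r Hr); intros t Ht; apply is_pseries_unique, H, Ht.
  - replace (PSeries (PS_derive a) 0) with (1 * PSeries (PS_derive a) (t0 - t0))
      by (rewrite Rmult_1_l; f_equal; ring).
    apply (is_derive_comp (PSeries a) (fun t => t - t0)).
    + replace (t0 - t0) with 0 by ring; exact HD.
    + auto_derive; [easy|ring].
Qed.

Lemma eps_derive (f : R -> R) (x l : R) :
  (forall eps, 0 < eps -> exists delta, 0 < delta /\ forall y, Rabs (y - x) < delta ->
    Rabs (f y - f x - l * (y - x)) <= eps * Rabs (y - x)) -> is_derive f x l.
Proof.
  intros H; split; [apply is_linear_scal_l|].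
  intros y Hy; apply (is_filter_lim_locally_unique (K := R_AbsRing) (V := R_NormedModule)) in Hy; subst y.
  intros [eps Heps]; destruct (H eps Heps) as (d & Hd & Hy).
  exists (mkposreal d Hd); intros y Hxy; specialize (Hy y Hxy).
  rewrite Rmult_comm in Hy; exact Hy.
Qed.

Section Jet.

Variables (F A B : R -> R) (r K : R).
Hypothesis r_pos : 0 < r.
Hypothesis A_bound : forall x, Rabs (A x) <= K.
Hypothesis B_bound : forall x, Rabs (B x) <= K.
Hypothesis jet : forall x s, Rabs s <= r -> Rabs (F (x + s) - F x - A x * s - B x * s ^ 2) <= K * Rabs s ^ 3.

Lemma K_nonneg : 0 <= K.
Proof. eapply Rle_trans; [apply Rabs_pos|apply (A_bound 0)]. Qed.

Lemma is_derive_quadratic (f : R -> R) (x l M d : R) : 0 < d ->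
  (forall s, Rabs s <= d -> Rabs (f (x + s) - f x - l * s) <= M * Rabs s ^ 2) -> is_derive f x l.
Proof.
  intros Hd H; apply eps_derive; intros eps Heps.
  set (M1 := Rabs M + 1); assert (HM : 0 < M1) by (unfold M1; assert (T := Rabs_pos M); lra).
  exists (Rmin d (eps / M1)); split; [apply Rmin_glb_lt; [easy|now apply Rdiv_lt_0_compat]|].
  intros z Hz.
  assert (H1 := Rlt_le_trans _ _ _ Hz (Rmin_l _ _)).
  assert (H2 := Rlt_le_trans _ _ _ Hz (Rmin_r _ _)).
  specialize (H (z - x) ltac:(lra)); replace (x + (z - x)) with z in H by ring.
  eapply Rle_trans; [exact H|].
  replace (M * Rabs (z - x) ^ 2) with (M * Rabs (z - x) * Rabs (z - x)) by ring.
  apply Rmult_le_compat_r; [apply Rabs_pos|].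
  apply Rle_trans with (M1 * (eps / M1)); [|right; field; lra].
  apply Rle_trans with (M1 * Rabs (z - x)).
  - apply Rmult_le_compat_r; [apply Rabs_pos|unfold M1; assert (T := Rle_abs M); lra].
  - apply Rmult_le_compat_l; lra.
Qed.

Lemma jet_derive (x : R) : is_derive F x (A x).
Proof.
  assert (HK := K_nonneg).
  apply (is_derive_quadratic F x (A x) (K * r + K) r r_pos); intros s Hs.
  assert (H := jet x s Hs).
  replace (F (x + s) - F x - A x * s)
    with ((F (x + s) - F x - A x * s - B x * s ^ 2) + B x * s ^ 2) by ring.
  eapply Rle_trans; [apply Rabs_triang|].
  rewrite Rabs_mult, <- RPow_abs.
  assert (P := Rabs_pos s); assert (P2 : 0 <= Rabs s ^ 2) by now apply pow_le.
  assert (Rabs (B x) * Rabs s ^ 2 <= K * Rabs s ^ 2) by now apply Rmult_le_compat_r.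
  assert (K * Rabs s ^ 3 <= K * r * Rabs s ^ 2).
  { replace (K * Rabs s ^ 3) with (K * Rabs s * Rabs s ^ 2) by ring.
    apply Rmult_le_compat_r; [easy|now apply Rmult_le_compat_l]. }
  lra.
Qed.

(** The jet at [x] predicts F (x + s) and F (x + 2 s), the jet at [x + s] predicts F (x + 2 s) and F
    x. Half the difference of the last two isolates [A (x + s)], half their sum isolates
    [B (x + s)]; the errors 8 + 2 and 8 + 2 + 2, halved, give 5 and 6. *)
Lemma jet_compare (x s : R) : Rabs s <= r / 2 ->
  Rabs (A (x + s) - A x - 2 * B x * s) <= 5 * K * Rabs s ^ 2 /\
  Rabs (B (x + s) - B x) <= 6 * K * Rabs s.
Proof.
  intros Hs; assert (HK := K_nonneg).
  assert (J1 := jet x s ltac:(lra)).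
  assert (J2 := jet x (2 * s)); rewrite Rabs_mult, (Rabs_pos_eq 2) in J2 by lra.
  specialize (J2 ltac:(lra)).
  assert (J3 := jet (x + s) s ltac:(lra)).
  assert (J4 := jet (x + s) (- s) ltac:(rewrite Rabs_Ropp; lra)); rewrite Rabs_Ropp in J4.
  replace (x + s + - s) with x in J4 by ring.
  replace (x + s + s) with (x + 2 * s) in J3 by ring.
  set (t := Rabs s) in *; assert (Ht : 0 <= t) by apply Rabs_pos.
  apply Rabs_le_between in J1; apply Rabs_le_between in J2; apply Rabs_le_between in J3;
    apply Rabs_le_between in J4.
  destruct (Req_dec s 0) as [E|E].
  { unfold t; subst s; rewrite Rabs_R0, Rplus_0_r; split.
    - replace (A x - A x - 2 * B x * 0) with 0 by ring; rewrite Rabs_R0; lra.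
    - replace (B x - B x) with 0 by ring; rewrite Rabs_R0; lra. }
  assert (Htp : 0 < t) by now apply Rabs_pos_lt.
  assert (Es : t ^ 2 = s ^ 2) by apply pow2_abs.
  split.
  - apply (Rmult_le_reg_l t); [easy|]; unfold t at 1; rewrite <- Rabs_mult.
    replace (t * (5 * K * t ^ 2)) with (5 * (K * t ^ 3)) by ring.
    apply Rabs_le; lra.
  - apply (Rmult_le_reg_l (t ^ 2)); [now apply pow_lt|].
    rewrite Es at 1; rewrite <- (Rabs_pos_eq (s ^ 2)) by apply pow2_ge_0; rewrite <- Rabs_mult.
    replace (t ^ 2 * (6 * K * t)) with (6 * (K * t ^ 3)) by ring.
    apply Rabs_le; lra.
Qed.

Lemma jet_derive2 (x : R) : is_derive A x (2 * B x).
Proof.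
  apply (is_derive_quadratic A x (2 * B x) (5 * K) (r / 2)); [lra|]; intros s Hs.
  now apply jet_compare.
Qed.

(** The summand [4 * K / r] covers points more than r / 2 apart, for which the bound 2 K on the
    difference suffices. *)
Lemma jet_lip (x y : R) : Rabs (B x - B y) <= (6 * K + 4 * K / r) * Rabs (x - y).
Proof.
  assert (HK := K_nonneg); assert (HR := Rinv_0_lt_compat r r_pos).
  assert (HKr : 0 <= K / r) by (apply Rmult_le_pos; lra).
  assert (HP := Rabs_pos (x - y)).
  destruct (Rle_lt_dec (Rabs (x - y)) (r / 2)) as [H|H].
  - destruct (jet_compare y (x - y) H) as [_ J]; replace (y + (x - y)) with x in J by ring.
    eapply Rle_trans; [exact J|]; apply Rmult_le_compat_r; lra.
  - apply Rle_trans with (K + K).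
    + unfold Rminus; eapply Rle_trans; [apply Rabs_triang|]; rewrite Rabs_Ropp.
      assert (T1 := B_bound x); assert (T2 := B_bound y); lra.
    + apply Rle_trans with (4 * K / r * (r / 2)); [right; field; lra|].
      apply Rle_trans with (4 * K / r * Rabs (x - y)); [apply Rmult_le_compat_l; lra|].
      apply Rmult_le_compat_r; lra.
Qed.

Hypothesis F_deg1 : forall x, F (x + 1) = F x + 1.
Hypothesis A_pos : forall x, 0 < A x.

Lemma A_periodic (x : R) : A (x + 1) = A x.
Proof.
  assert (H : is_derive (fun y => F (y + 1)) x (1 * A (x + 1))).
  { apply (is_derive_comp F (fun y => y + 1)); [apply jet_derive|auto_derive; [easy|ring]]. }
  assert (H' : is_derive (fun y => F y + 1) x (A x)).
  { replace (A x) with (A x + 0) by ring.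
    apply (is_derive_plus (V := R_NormedModule) F (fun _ => 1));
      [apply jet_derive|apply (is_derive_const (V := R_NormedModule))]. }
  apply (is_derive_ext _ (fun y => F y + 1)) in H; [|intros; apply F_deg1].
  apply is_derive_unique in H; apply is_derive_unique in H'; lra.
Qed.

Lemma A_lower : exists m, 0 < m /\ forall x, m <= A x.
Proof.
  apply periodic_lower_bound; [|exact A_periodic|exact A_pos]; intros x.
  apply (@ex_derive_continuous R_AbsRing R_NormedModule); eexists; apply jet_derive2.
Qed.

(** Here psi = D log DF = 2 B / A. The last clause rewrites the quadratic coefficient as
    [A * psi / 2], the form in which nonlinearities add up along an orbit. *)
Lemma log_derivative_estimates : exists psi V L,
  (forall x, is_derive (fun x => ln (A x)) x (psi x)) /\
  (forall x, Rabs (psi x) <= V) /\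
  (forall x y, Rabs (psi x - psi y) <= L * Rabs (x - y)) /\
  (forall x, A x * psi x = 2 * B x).
Proof.
  destruct A_lower as (m & Hm & HA); assert (HK := K_nonneg).
  set (L := 6 * K + 4 * K / r).
  exists (fun x => 2 * B x / A x), (2 * K / m), (2 * (K * (2 * K) + L * K) / m ^ 2).
  assert (HLip : forall x y, Rabs (A x - A y) <= 2 * K * Rabs (x - y)).
  { apply (lipschitz_of_derivative A (fun x => 2 * B x)); [apply jet_derive2|].
    intros x; rewrite Rabs_mult, (Rabs_pos_eq 2) by lra; specialize (B_bound x); lra. }
  split; [|split; [|split]].
  - intros x; replace (2 * B x / A x) with (2 * B x * / A x) by easy.
    apply (is_derive_comp ln A); [|apply jet_derive2].
    apply is_derive_Reals, derivable_pt_lim_ln, A_pos.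
  - intros x; unfold Rdiv; rewrite !Rabs_mult, (Rabs_pos_eq 2), Rabs_inv by lra.
    rewrite (Rabs_pos_eq (A x)) by (apply Rlt_le, A_pos).
    apply Rmult_le_compat.
    + apply Rmult_le_pos; [lra|apply Rabs_pos].
    + apply Rlt_le, Rinv_0_lt_compat, A_pos.
    + specialize (B_bound x); lra.
    + apply Rinv_le_contravar; auto.
  - intros x y; assert (Ax := A_pos x); assert (Ay := A_pos y).
    assert (Lx := HA x); assert (Ly := HA y).
    replace (2 * B x / A x - 2 * B y / A y)
      with (2 * (B x * (A y - A x) + (B x - B y) * A x) * / (A x * A y)) by (field; lra).
    rewrite Rabs_mult, Rabs_inv, (Rabs_pos_eq (A x * A y)) by (apply Rlt_le, Rmult_lt_0_compat; easy).
    replace (2 * (K * (2 * K) + L * K) / m ^ 2 * Rabs (x - y))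
      with (2 * (K * (2 * K * Rabs (y - x)) + L * Rabs (x - y) * K) * / (m ^ 2))
      by (rewrite (Rabs_minus_sym y x); field; lra).
    apply Rmult_le_compat; [apply Rabs_pos|apply Rlt_le, Rinv_0_lt_compat, Rmult_lt_0_compat; easy| |].
    + rewrite Rabs_mult, (Rabs_pos_eq 2) by lra; apply Rmult_le_compat_l; [lra|].
      eapply Rle_trans; [apply Rabs_triang|]; rewrite 2!Rabs_mult.
      apply Rplus_le_compat; apply Rmult_le_compat; try apply Rabs_pos; auto.
      apply jet_lip.
    + apply Rinv_le_contravar; [now apply pow_lt|]; simpl; rewrite Rmult_1_r.
      apply Rmult_le_compat; lra.
  - intros x; field; apply Rgt_not_eq, A_pos.
Qed.

End Jet.

(** * Continued fractions *)

Section Convergents.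

Variable alpha : R.
Hypothesis alpha_irr : irrational alpha.

Definition cnum (n : nat) : Z := fst (convergent alpha n).
Definition cden (n : nat) : Z := snd (convergent alpha n).
(** The prefix p means previous: this is p_(n-1), with p_(-1) = 1. *)
Definition pnum (n : nat) : Z := fst (snd (cf_pairs alpha n)).
Definition pden (n : nat) : Z := snd (snd (cf_pairs alpha n)).

Lemma cf_step (n : nat) :
  cnum (S n) = (cf_coef alpha (S n) * cnum n + pnum n)%Z /\
  cden (S n) = (cf_coef alpha (S n) * cden n + pden n)%Z /\
  pnum (S n) = cnum n /\ pden (S n) = cden n.
Proof.
  unfold cnum, cden, pnum, pden, convergent.
  change (cf_pairs alpha (S n)) with (let '((p, q), (p', q')) := cf_pairs alpha n in
      let a := cf_coef alpha (S n) in ((a * p + p', a * q + q'), (p, q))%Z).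
  destruct (cf_pairs alpha n) as [[p q] [p' q']]; easy.
Qed.

Lemma cf_det (n : nat) : IZR (cnum n) * IZR (pden n) - IZR (pnum n) * IZR (cden n) = - (-1) ^ n.
Proof.
  induction n as [|n IH].
  - unfold cnum, cden, pnum, pden; simpl; ring.
  - destruct (cf_step n) as (-> & -> & -> & ->).
    rewrite !plus_IZR, !mult_IZR; simpl; lra.
Qed.

Lemma cf_det_consecutive (n : nat) :
  IZR (cnum (S n)) * IZR (cden n) - IZR (cnum n) * IZR (cden (S n)) = (-1) ^ n.
Proof.
  assert (H := cf_det (S n)); destruct (cf_step n) as (_ & _ & E1 & E2).
  rewrite E1, E2 in H; rewrite H; simpl; ring.
Qed.

Definition theta (n : nat) : R := IZR (cden n) * alpha - IZR (cnum n).

Lemma cf_rem_bounds (n : nat) : 0 <= cf_rem alpha n < 1.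
Proof.
  destruct n; simpl; [assert (H := base_fp alpha)|assert (H := base_fp (/ cf_rem alpha n))]; lra.
Qed.

(** With theta_n = q_n alpha - p_n, the remainder is - theta_n / theta_(n-1), so the continued
    fraction is Euclid's algorithm on these errors. The signs alternate as long as no remainder
    vanishes, and a vanishing one would give theta_n = 0 and alpha rational. *)
Lemma cf_invariant (n : nat) :
  (1 <= cden n)%Z /\ (0 <= pden n)%Z /\ 0 < cf_rem alpha n /\
  theta n = - cf_rem alpha n * (IZR (pden n) * alpha - IZR (pnum n)) /\ 0 < (-1) ^ n * theta n.
Proof.
  assert (nz : forall m, (1 <= cden m)%Z -> theta m <> 0).
  { intros m Hm E; unfold theta in E; apply (alpha_irr (cnum m) (cden m)); [lia|].
    assert (1 <= IZR (cden m)) by now apply IZR_le. field_simplify_eq; lra. }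
  induction n as [|n (IH1 & IH2 & IH3 & IH4 & IH5)].
  - assert (H1 : (1 <= cden 0)%Z) by (unfold cden; simpl; lia).
    assert (E : theta 0 = cf_rem alpha 0).
    { unfold theta, cden, cnum; simpl; unfold frac_part; ring. }
    assert (B := cf_rem_bounds 0); assert (N := nz 0%nat H1).
    rewrite E in N.
    repeat split; [easy|unfold pden; simpl; lia|lra| |rewrite E; simpl pow; lra].
    rewrite E; unfold pden, pnum; simpl (fst _); simpl (snd _); ring.
  - destruct (cf_step n) as (E1 & E2 & E3 & E4).
    set (a := cf_coef alpha (S n)) in *; set (r := cf_rem alpha n) in *.
    assert (Ha : a = Int_part (/ r)) by easy.
    assert (Hr : cf_rem alpha (S n) = / r - IZR a) by easy.
    assert (B := cf_rem_bounds n); fold r in B.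
    assert (Ha1 : (1 <= a)%Z).
    { assert (K := base_Int_part (/ r)); rewrite <- Ha in K.
      assert (1 < / r) by (rewrite <- Rinv_1; apply Rinv_lt_contravar; lra).
      assert (0 < IZR a) by lra. apply lt_IZR in H0; lia. }
    assert (ET : theta (S n) = - cf_rem alpha (S n) * theta n).
    { unfold theta at 1; rewrite E1, E2, !plus_IZR, !mult_IZR, Hr.
      transitivity (IZR a * theta n + (IZR (pden n) * alpha - IZR (pnum n))); [unfold theta; ring|].
      rewrite IH4; field; lra. }
    assert (Q1 : (1 <= cden (S n))%Z) by (rewrite E2; nia).
    assert (N := nz (S n) Q1).
    assert (R0 : 0 < cf_rem alpha (S n)).
    { destruct (cf_rem_bounds (S n)) as [[R0|R0] _]; [easy|].
      rewrite ET, <- R0 in N; lra. }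
    repeat split; [easy|rewrite E4; lia|easy| |].
    + rewrite ET, E3, E4; reflexivity.
    + rewrite ET; replace ((-1) ^ S n * (- cf_rem alpha (S n) * theta n))
        with (cf_rem alpha (S n) * ((-1) ^ n * theta n)) by (simpl; ring).
      now apply Rmult_lt_0_compat.
Qed.

Lemma cden_step (n : nat) : (cden n + pden n <= cden (S n))%Z.
Proof.
  destruct (cf_invariant n) as (H1 & H2 & H3 & _).
  destruct (cf_step n) as (_ & E & _); rewrite E.
  assert (B := cf_rem_bounds n).
  assert (Ha : (1 <= cf_coef alpha (S n))%Z).
  { assert (K := base_Int_part (/ cf_rem alpha n)).
    change (Int_part (/ cf_rem alpha n)) with (cf_coef alpha (S n)) in K.
    assert (1 < / cf_rem alpha n) by (rewrite <- Rinv_1; apply Rinv_lt_contravar; lra).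
    assert (L : 0 < IZR (cf_coef alpha (S n))) by lra. apply lt_IZR in L; lia. }
  nia.
Qed.

Lemma convergent_den_Z (n : nat) : Z.of_nat (convergent_den alpha n) = cden n.
Proof.
  destruct (cf_invariant n) as (H1 & _); unfold convergent_den; fold (cden n).
  apply Z2Nat.id; lia.
Qed.

Lemma convergent_den_pos (n : nat) : (1 <= convergent_den alpha n)%nat.
Proof. assert (E := convergent_den_Z n); destruct (cf_invariant n) as (H & _); lia. Qed.

Lemma convergent_den_le (n : nat) : (convergent_den alpha n <= convergent_den alpha (S n))%nat.
Proof.
  assert (E := convergent_den_Z n); assert (E' := convergent_den_Z (S n)).
  assert (H := cden_step n); destruct (cf_invariant n) as (_ & H2 & _); lia.
Qed.

(** Strict only from index 1 on: q_0 = q_1 = 1 when the first partial quotient is 1. *)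
Lemma convergent_den_lt (n : nat) :
  (convergent_den alpha (S n) < convergent_den alpha (S (S n)))%nat.
Proof.
  assert (E := convergent_den_Z (S n)); assert (E' := convergent_den_Z (S (S n))).
  assert (H := cden_step (S n)); destruct (cf_step n) as (_ & _ & _ & E4).
  destruct (cf_invariant n) as (H1 & _); lia.
Qed.

Lemma convergent_det (n : nat) :
  IZR (cnum (S n)) * INR (convergent_den alpha n) - IZR (cnum n) * INR (convergent_den alpha (S n))
  = (-1) ^ n.
Proof. rewrite !INR_IZR_INZ, !convergent_den_Z; apply cf_det_consecutive. Qed.

Lemma convergent_sign (n : nat) : 0 < (-1) ^ n * (INR (convergent_den alpha n) * alpha - IZR (cnum n)).
Proof. rewrite INR_IZR_INZ, convergent_den_Z; apply cf_invariant. Qed.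

End Convergents.

(** * Lifts and rotation numbers *)

Lemma expi_eq (x y : R) : expi x = expi y -> exists k : Z, x = y + IZR k.
Proof.
  intros H; assert (HP := PI_RGT_0).
  assert (E : expi (x - y) = 1%C).
  { unfold Rminus; rewrite expi_plus, H, <- expi_plus, Rplus_opp_r; apply expi_0. }
  assert (E' := E); unfold expi in E; injection E as Ec Es.
  destruct (sin_eq_0_0 _ Es) as [k Hk].
  assert (Hk' : x - y = IZR k / 2) by (apply (Rmult_eq_reg_l (2 * PI)); [lra|nra]).
  destruct (Z.Even_or_Odd k) as [[m Hm]|[m Hm]].
  - exists m; rewrite Hm, mult_IZR in Hk'; lra.
  - exfalso; rewrite Hm, plus_IZR, mult_IZR in Hk'.
    replace (x - y) with (1 / 2 + IZR m) in E' by lra.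
    rewrite expi_IZR in E'; unfold expi in E'; injection E' as E1 _.
    replace (2 * PI * (1 / 2)) with PI in E1 by field; rewrite cos_PI in E1; lra.
Qed.

Lemma continuous_integer_constant (f : R -> R) :
  (forall x, continuous f x) -> (forall x, exists k : Z, f x = IZR k) -> forall x y, f x = f y.
Proof.
  intros Hf Hk.
  assert (H : forall x y, ~ f x < f y).
  { intros x y Hxy; destruct (Hk x) as [k Ex], (Hk y) as [l Ey].
    assert (Hkl : (k + 1 <= l)%Z) by (rewrite Ex, Ey in Hxy; apply lt_IZR in Hxy; lia).
    apply IZR_le in Hkl; rewrite plus_IZR in Hkl.
    destruct (IVT_gen f x y (IZR k + 1 / 2)) as (z & _ & Hz).
    - intros t; apply continuity_pt_filterlim, Hf.
    - rewrite Ex, Ey, Rmin_left, Rmax_right; lra.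
    - destruct (Hk z) as [m Em]; rewrite Em in Hz.
      assert (k < m)%Z by (apply lt_IZR; lra). assert (m < k + 1)%Z
        by (apply lt_IZR; rewrite plus_IZR; lra). lia. }
  intros x y; apply Rle_antisym; apply Rnot_lt_le, H.
Qed.

Lemma lift_difference (g : C -> C) (F G : R -> R) :
  circle_lift g F -> circle_lift g G -> exists k : Z, forall x, F x = G x + IZR k.
Proof.
  intros [CF LF] [CG LG].
  assert (H : forall x, exists k : Z, F x - G x = IZR k).
  { intros x; destruct (expi_eq (F x) (G x)) as [k Hk]; [now rewrite <- LF, <- LG|].
    exists k; lra. }
  destruct (H 0) as [k Hk]; exists k; intros x.
  assert (E : F x - G x = F 0 - G 0); [|lra].
  apply (continuous_integer_constant (fun x => F x - G x)); [|exact H].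
  intros y; apply (continuous_minus F G); auto.
Qed.

(** F (x + 1) is another lift, so it differs from F x by a constant integer, positive by
    monotonicity. If that integer were at least 2, F would reach F 0 + 1 strictly inside [0, 1] and
    g would not be injective. *)
Lemma lift_degree_one (g h : C -> C) (F : R -> R) : circle_lift g F ->
  (forall x y, x < y -> F x < F y) -> (forall z, unit_circle z -> h (g z) = z) ->
  forall x, F (x + 1) = F x + 1.
Proof.
  intros HF Hinc Hinj.
  assert (HG : circle_lift g (fun x => F (x + 1))).
  { destruct HF as [CF LF]; split.
    - intros x; apply (continuous_comp (fun x => x + 1) F); [|apply CF].
      apply (continuous_plus (fun x => x) (fun _ => 1)); [apply continuous_id|apply continuous_const].
    - intros x; rewrite <- LF; f_equal; symmetry; apply (expi_IZR x 1). }
  destruct (lift_difference g _ _ HG HF) as [k Hk]; simpl in Hk.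
  assert (Hk0 : (0 < k)%Z).
  { apply lt_IZR; assert (T := Hinc 0 (0 + 1) ltac:(lra)); rewrite Hk in T; lra. }
  destruct (Z.eq_dec k 1) as [->|Hk1]; [exact Hk|exfalso].
  assert (Hk2 : 2 <= IZR k) by (apply IZR_le; lia).
  destruct HF as [CF LF].
  destruct (IVT_gen F 0 1 (F 0 + 1)) as (y & Hy & Ey).
  - intros t; apply continuity_pt_filterlim, CF.
  - assert (E := Hk 0); rewrite Rplus_0_l in E; rewrite E, Rmin_left, Rmax_right; lra.
  - rewrite Rmin_left, Rmax_right in Hy by lra.
    assert (E : expi y = expi 0).
    { rewrite <- (Hinj (expi y)), <- (Hinj (expi 0)) by apply Cmod_expi.
      f_equal; rewrite !LF, Ey; apply (expi_IZR (F 0) 1). }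
    destruct (expi_eq _ _ E) as [m Hm]; rewrite Rplus_0_l in Hm; subst y.
    assert (M0 : (0 <= m)%Z) by (apply le_IZR; lra).
    assert (M1 : (m <= 1)%Z) by (apply le_IZR; lra).
    assert (HM : m = 0%Z \/ m = 1%Z) by lia.
    destruct HM as [-> | ->]; [lra|].
    assert (E1 := Hk 0); rewrite Rplus_0_l in E1; lra.
Qed.

Section RotationSign.

Variables (F : R -> R) (alpha : R).
Hypothesis F_inc : forall x y, x < y -> F x < F y.
Hypothesis F_deg1 : forall x, F (x + 1) = F x + 1.
Hypothesis F_rot : forall x, is_lim_seq (fun n => (Nat.iter n F x - x) / INR n) alpha.

Lemma iter_mono (k : nat) (x y : R) : x <= y -> fiter F k x <= fiter F k y.
Proof.
  intros H; induction k as [|k IH]; [easy|]; unfold fiter in *; simpl.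
  destruct IH as [IH|IH]; [now apply Rlt_le, F_inc|rewrite IH; lra].
Qed.

Lemma iter_multiple_le (q : nat) (x : R) (p : Z) : fiter F q x <= x + IZR p ->
  forall k, fiter F (k * q) x <= x + INR k * IZR p.
Proof.
  intros H; induction k as [|k IH]; [simpl; lra|].
  replace (S k * q)%nat with (q + k * q)%nat by ring.
  rewrite S_INR, fiter_add.
  eapply Rle_trans; [apply iter_mono, H|]; rewrite fiter_IZR by easy; lra.
Qed.

Lemma iter_multiple_ge (q : nat) (x : R) (p : Z) : x + IZR p <= fiter F q x ->
  forall k, x + INR k * IZR p <= fiter F (k * q) x.
Proof.
  intros H; induction k as [|k IH]; [simpl; lra|].
  replace (S k * q)%nat with (q + k * q)%nat by ring.
  rewrite S_INR, fiter_add.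
  eapply Rle_trans; [|apply iter_mono, H]; rewrite fiter_IZR by easy; lra.
Qed.

Lemma rotation_along_multiples (q : nat) (x : R) : (1 <= q)%nat ->
  is_lim_seq (fun k => (fiter F (S k * q) x - x) / INR (S k * q)) alpha.
Proof.
  intros Hq; apply (is_lim_seq_subseq (fun n => (Nat.iter n F x - x) / INR n) alpha
    (fun k => (S k * q)%nat)); [|apply F_rot].
  apply eventually_subseq; intros n; nia.
Qed.

(** By monotonicity the inequality at one point propagates to the times k q, and it survives in the
    limit of the averages. *)
Lemma rotation_upper (q : nat) (x : R) (p : Z) : (1 <= q)%nat -> fiter F q x <= x + IZR p ->
  INR q * alpha <= IZR p.
Proof.
  intros Hq H; assert (Hq0 : 0 < INR q) by (apply lt_0_INR; lia).
  assert (L : Rbar_le alpha (IZR p / INR q)).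
  { eapply is_lim_seq_le; [|apply (rotation_along_multiples q x Hq)|apply is_lim_seq_const].
    intros k; assert (K := iter_multiple_le q x p H (S k)).
    cbv beta; rewrite mult_INR; assert (Hk : 0 < INR (S k)) by (apply lt_0_INR; lia).
    apply (Rmult_le_reg_r (INR (S k) * INR q)); [now apply Rmult_lt_0_compat|].
    field_simplify; lra. }
  simpl in L; apply (Rmult_le_compat_l (INR q)) in L; [|lra].
  replace (INR q * (IZR p / INR q)) with (IZR p) in L by (field; lra); easy.
Qed.

Lemma rotation_lower (q : nat) (x : R) (p : Z) : (1 <= q)%nat -> x + IZR p <= fiter F q x ->
  IZR p <= INR q * alpha.
Proof.
  intros Hq H; assert (Hq0 : 0 < INR q) by (apply lt_0_INR; lia).
  assert (L : Rbar_le (IZR p / INR q) alpha).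
  { eapply is_lim_seq_le; [|apply is_lim_seq_const|apply (rotation_along_multiples q x Hq)].
    intros k; assert (K := iter_multiple_ge q x p H (S k)).
    cbv beta; rewrite mult_INR; assert (Hk : 0 < INR (S k)) by (apply lt_0_INR; lia).
    apply (Rmult_le_reg_r (INR (S k) * INR q)); [now apply Rmult_lt_0_compat|].
    field_simplify; lra. }
  simpl in L; apply (Rmult_le_compat_l (INR q)) in L; [|lra].
  replace (INR q * (IZR p / INR q)) with (IZR p) in L by (field; lra); easy.
Qed.

(** Contrapositive of the two preceding bounds: they need only a non-strict inequality at one point,
    so a strict sign of q alpha - p forces the strict sign at every point. *)
Lemma rotation_sign (q : nat) (x : R) (p : Z) (s : R) : s = 1 \/ s = -1 -> (1 <= q)%nat ->
  0 < s * (INR q * alpha - IZR p) -> 0 < s * (fiter F q x - IZR p - x).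
Proof.
  intros Hs Hq H; apply Rnot_le_lt; intros HN.
  destruct Hs as [-> | ->].
  - assert (K := rotation_upper q x p Hq ltac:(lra)); lra.
  - assert (K := rotation_lower q x p Hq ltac:(lra)); lra.
Qed.

End RotationSign.
(** * Complex orbits near the circle *)

(** The data of g in the coordinate w. In [al_complex] the Taylor polynomial has DF factored out, so
    that psi / 2 is D^2 F / (2 DF). *)
Record analytic_lift (g : C -> C) (W : C -> Prop) (F ld psi : R -> R) (V L r K : R) : Prop := {
  al_cont : forall x, continuous F x;
  al_lift : forall x, g (expi x) = expi (F x);
  al_inc : forall x y, x < y -> F x < F y;
  al_deg1 : forall x, F (x + 1) = F x + 1;
  al_dF : forall x, is_derive F x (exp (ld x));
  al_dld : forall x, is_derive ld x (psi x);
  al_ld1 : forall x, ld (x + 1) = ld x;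
  al_psiV : forall x, Rabs (psi x) <= V;
  al_psiL : forall x y, Rabs (psi x - psi y) <= L * Rabs (x - y);
  al_r : 0 < r;
  al_K : 0 <= K;
  al_complex : forall x w, Cmod w <= r -> W (ecx (RtoC x + w)) /\
    exists w', g (ecx (RtoC x + w)) = ecx (RtoC (F x) + w') /\
      Cmod (w' - RtoC (exp (ld x)) * (w + RtoC (psi x / 2) * w ^ 2)) <= K * Cmod w ^ 3 }.

Arguments al_cont {g W F ld psi V L r K}.
Arguments al_inc {g W F ld psi V L r K}.
Arguments al_deg1 {g W F ld psi V L r K}.
Arguments al_dF {g W F ld psi V L r K}.
Arguments al_dld {g W F ld psi V L r K}.
Arguments al_ld1 {g W F ld psi V L r K}.
Arguments al_psiV {g W F ld psi V L r K}.
Arguments al_r {g W F ld psi V L r K}.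
Arguments al_K {g W F ld psi V L r K}.
Arguments al_complex {g W F ld psi V L r K}.

Lemma derivative_nonneg (F : R -> R) (x l : R) :
  (forall x y, x < y -> F x < F y) -> is_derive F x l -> 0 <= l.
Proof.
  intros Hinc HD; apply Rnot_lt_le; intros Hl.
  destruct (derive_eps F x l HD (- l / 2)) as (d & Hd & H); [lra|].
  specialize (H (x + d / 2)); replace (x + d / 2 - x) with (d / 2) in H by ring.
  rewrite Rabs_pos_eq in H by lra; specialize (H ltac:(lra)).
  apply Rabs_le_between in H; specialize (Hinc x (x + d / 2) ltac:(lra)); nra.
Qed.

(** Since h inverts g, h (expi (F t)) = expi t. If DF vanished, the chain rule would make the
    derivatives of cosine and sine vanish together; differentiability of h on the circle comes from
    its power series. *)
Lemma derivative_nonzero (g h : C -> C) (F : R -> R) (x l : R) : circle_analytic h ->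
  (forall x, g (expi x) = expi (F x)) -> (forall z, unit_circle z -> h (g z) = z) ->
  is_derive F x l -> l <> 0.
Proof.
  intros Hh HF Hinv HD ->; assert (HP := PI_RGT_0).
  destruct (Hh (F x)) as (a & r & Hr & Ha).
  assert (E : forall t, h (expi (F t)) = expi t) by (intros t; rewrite <- HF; apply Hinv, Cmod_expi).
  destruct (ex_derive_pseries (fun t => fst (h (expi t))) (fun n => fst (a n)) (F x) r Hr) as [d1 D1].
  { intros t Ht; apply is_pseries_fst, Ha, Ht. }
  destruct (ex_derive_pseries (fun t => snd (h (expi t))) (fun n => snd (a n)) (F x) r Hr) as [d2 D2].
  { intros t Ht; apply is_pseries_snd, Ha, Ht. }
  assert (C1 := is_derive_comp _ F x _ _ D1 HD); assert (C2 := is_derive_comp _ F x _ _ D2 HD).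
  apply (is_derive_ext _ (fun t => cos (2 * PI * t))) in C1; [|intros t; now rewrite E].
  apply (is_derive_ext _ (fun t => sin (2 * PI * t))) in C2; [|intros t; now rewrite E].
  assert (S1 : is_derive (fun t => cos (2 * PI * t)) x (- (2 * PI * sin (2 * PI * x))))
    by (auto_derive; [easy|ring]).
  assert (S2 : is_derive (fun t => sin (2 * PI * t)) x (2 * PI * cos (2 * PI * x)))
    by (auto_derive; [easy|ring]).
  apply is_derive_unique in C1; apply is_derive_unique in C2.
  apply is_derive_unique in S1; apply is_derive_unique in S2.
  rewrite C1 in S1; rewrite C2 in S2.
  change (0 * d1 = - (2 * PI * sin (2 * PI * x))) in S1.
  change (0 * d2 = 2 * PI * cos (2 * PI * x)) in S2.
  assert (X1 : sin (2 * PI * x) = 0) by (apply (Rmult_eq_reg_l (2 * PI)); lra).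
  assert (X2 : cos (2 * PI * x) = 0) by (apply (Rmult_eq_reg_l (2 * PI)); lra).
  assert (T := sin2_cos2 (2 * PI * x)); rewrite X1, X2, !Rsqr_0 in T; lra.
Qed.

Lemma analytic_lift_exists (g : C -> C) (W : C -> Prop) (alpha : R) :
  analytic_circle_diffeo g -> holomorphic_near_circle W g -> rotation_number g alpha ->
  exists F ld psi V L r K, analytic_lift g W F ld psi V L r K /\
    forall x, is_lim_seq (fun n => (Nat.iter n F x - x) / INR n) alpha.
Proof.
  intros (_ & _ & (h & _ & Hh & Hhg & _) & (G & HG & HGinc)) (HWo & HWc & HWd) (F & HF & Hrot).
  (* The rotation number and the orientation may come with different lifts; these differ by an
     integer, so monotonicity passes to [F]. *)
  destruct (lift_difference g F G HF HG) as [k Hk].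
  assert (Hinc : forall x y, x < y -> F x < F y).
  { intros x y Hxy; rewrite !Hk; specialize (HGinc x y Hxy); lra. }
  assert (H1 := lift_degree_one g h F HF Hinc Hhg).
  destruct HF as [HFc HFl].
  destruct (lift_taylor g W F HWo HWc HWd HFc HFl H1) as (r & K & Hr & HK & HT).
  assert (HT' : forall x, exists AB : R * R, Rabs (fst AB) <= K /\ Rabs (snd AB) <= K /\
    (forall w, Cmod w <= r -> W (ecx (RtoC x + w)) /\
     exists w', g (ecx (RtoC x + w)) = ecx (RtoC (F x) + w') /\
       Cmod (w' - RtoC (fst AB) * w - RtoC (snd AB) * w ^ 2) <= K * Cmod w ^ 3) /\
    (forall s, Rabs s <= r -> Rabs (F (x + s) - F x - fst AB * s - snd AB * s ^ 2) <= K * Rabs s ^ 3)).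
  { intros x; destruct (HT x) as (A & B & H); now exists (A, B). }
  set (A := fun x => fst (proj1_sig (constructive_indefinite_description _ (HT' x)))).
  set (B := fun x => snd (proj1_sig (constructive_indefinite_description _ (HT' x)))).
  assert (HAB : forall x, Rabs (A x) <= K /\ Rabs (B x) <= K /\
    (forall w, Cmod w <= r -> W (ecx (RtoC x + w)) /\
     exists w', g (ecx (RtoC x + w)) = ecx (RtoC (F x) + w') /\
       Cmod (w' - RtoC (A x) * w - RtoC (B x) * w ^ 2) <= K * Cmod w ^ 3) /\
    (forall s, Rabs s <= r -> Rabs (F (x + s) - F x - A x * s - B x * s ^ 2) <= K * Rabs s ^ 3)).
  { intros x; apply (proj2_sig (constructive_indefinite_description _ (HT' x))). }
  clearbody A B; clear HT HT'.
  assert (Ab : forall x, Rabs (A x) <= K) by (intros; apply HAB).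
  assert (Bb : forall x, Rabs (B x) <= K) by (intros; apply HAB).
  assert (J : forall x s, Rabs s <= r ->
    Rabs (F (x + s) - F x - A x * s - B x * s ^ 2) <= K * Rabs s ^ 3) by (intros; now apply HAB).
  assert (dF := jet_derive F A B r K Hr Ab Bb J).
  assert (Ap : forall x, 0 < A x).
  { intros x; assert (P := derivative_nonneg F x (A x) Hinc (dF x)).
    assert (N := derivative_nonzero g h F x (A x) Hh HFl Hhg (dF x)); lra. }
  destruct (log_derivative_estimates F A B r K Hr Ab Bb J H1 Ap) as (psi & V & L & P1 & P2 & P3 & P4).
  assert (EA : forall x, exp (ln (A x)) = A x) by (intros; now apply exp_ln).
  exists F, (fun x => ln (A x)), psi, V, L, r, K; split; [|exact Hrot].
  constructor; auto.
  - intros x; rewrite EA; apply dF.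
  - intros x; now rewrite (A_periodic F A B r K Hr Ab Bb J H1).
  - intros x w Hw; destruct (HAB x) as (_ & _ & HC & _); destruct (HC w Hw) as (HW & w' & E & Hw').
    split; [easy|]; exists w'; split; [easy|].
    rewrite EA; eapply Rle_trans; [|exact Hw']; right; f_equal.
    assert (EB : RtoC (B x) = (RtoC (A x) * RtoC (psi x / 2))%C).
    { rewrite <- RtoC_mult; f_equal; specialize (P4 x); lra. }
    rewrite EB; ring.
Qed.

Section ComplexOrbit.

Variables (g : C -> C) (W : C -> Prop) (F ld psi : R -> R) (V L r K : R).
Hypothesis AL : analytic_lift g W F ld psi V L r K.

Lemma exp_ld_lower : exists m, 0 < m /\ forall x, m <= exp (ld x).
Proof.
  exists (exp (- (Rabs (ld 0) + V))); split; [apply exp_pos|]; intros x.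
  assert (H := ld_bounded ld psi V (al_dld AL) (al_ld1 AL)
    (al_psiV AL) x).
  apply exp_le_compat; apply Rabs_le_between in H; lra.
Qed.

(* In the coordinate [Z = Diter j x * w0 / w] the recursion for the displacement [w] of a complex orbit
   from the real one becomes additive up to quadratic errors, with increment minus half of
   [psi (F^j x) Diter j x w0]: the nonlinearities telescope exactly into [nonlin]. *)
Lemma complex_orbit : exists r1 K3, 0 < r1 /\ 0 <= K3 /\
  forall (x : R) (w0 : C) (N : nat) (kappa : R), w0 <> 0%C -> kappa <= 1 / 2 ->
  (forall j, (j <= N)%nat -> 2 * Diter F ld j x * Cmod w0 <= r1) ->
  (forall j, (j <= N)%nat -> Rabs (nonlin F ld psi j x) * Cmod w0 / 2
     + K3 * psum (fun i => Diter F ld i x ^ 2) j * Cmod w0 ^ 2 <= kappa) ->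
  forall j, (j <= N)%nat -> exists w : C,
    Nat.iter j g (ecx (RtoC x + w0)) = ecx (RtoC (fiter F j x) + w) /\ w <> 0%C /\
    W (ecx (RtoC (fiter F j x) + w)) /\
    Cmod (RtoC (Diter F ld j x) * w0 / w - 1) <= kappa.
Proof.
  destruct exp_ld_lower as (m & Hm & Hld).
  assert (Hr := al_r AL); assert (HK := al_K AL).
  assert (HV := V_nonneg psi V (al_psiV AL)).
  set (K1 := K / m); assert (HK1 : 0 <= K1) by (apply Rmult_le_pos; [easy|now apply Rlt_le, Rinv_0_lt_compat]).
  (* [T] bounds the relative correction [t] by [T * Cmod w], and [r1 <= 1 / (2 * T)] makes it at
     most 1 / 2. The summand 1 ensures T >= 1, so that |w| <= 1. *)
  set (T := V / 2 + K1 + 1); assert (HT : 1 <= T) by (unfold T; lra).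
  set (r1 := Rmin r (1 / (2 * T))).
  assert (Hr1 : 0 < r1) by (apply Rmin_glb_lt; [easy|apply Rdiv_lt_0_compat; lra]).
  assert (Hr1T : r1 * T <= 1 / 2).
  { apply Rle_trans with (1 / (2 * T) * T); [apply Rmult_le_compat_r; [lra|apply Rmin_r]|].
    right; field; lra. }
  assert (Hr1r : r1 <= r) by apply Rmin_l.
  (* [K1] comes from the cubic error, [2 * T ^ 2] from t^2 / (1 + t), and the outer 2 from |w| <= 2
     DF^j x |w0|. *)
  set (K3 := 2 * (K1 + 2 * T ^ 2)).
  assert (HK3 : 0 <= K3) by (unfold K3; assert (0 <= T ^ 2) by apply pow2_ge_0; lra).
  exists r1, K3; split; [easy|]; split; [easy|].
  intros x w0 N kappa Hw0 Hkap Hsmall Hkappa.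
  assert (Hm0 := proj1 (Cmod_gt_0 w0) Hw0); set (m0 := Cmod w0) in *.
  assert (main : forall j, (j <= N)%nat -> exists w : C,
    Nat.iter j g (ecx (RtoC x + w0)) = ecx (RtoC (fiter F j x) + w) /\ w <> 0%C /\
    Cmod w <= r1 /\
    Cmod (RtoC (Diter F ld j x) * w0 / w - 1) <= kappa /\
    Cmod (RtoC (Diter F ld j x) * w0 / w - 1 + w0 * RtoC (nonlin F ld psi j x / 2))
      <= K3 * psum (fun i => Diter F ld i x ^ 2) j * m0 ^ 2).
  { induction j as [|j IH]; intros Hj.
    - exists w0.
      assert (E0 : Diter F ld 0 x = 1) by (unfold Diter, logD; simpl; apply exp_0).
      assert (S0 := Hsmall 0%nat Hj); rewrite E0 in S0.
      assert (Kp := Hkappa 0%nat Hj); unfold nonlin in Kp; simpl in Kp.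
      rewrite Rabs_R0 in Kp.
      rewrite E0; unfold nonlin; simpl psum.
      replace (1 * w0 / w0 - 1)%C with (RtoC 0) by (field; easy).
      replace (0 + w0 * RtoC (0 / 2))%C with (RtoC 0)
        by (unfold Rdiv; rewrite Rmult_0_l; ring).
      rewrite Cmod_0; split; [easy|split; [easy|split; [fold m0; lra|split; lra]]].
    - destruct (IH ltac:(lia)) as (w & E & Hw & Hwr & Hk & HZ).
      set (y := fiter F j x) in *; set (Dj := Diter F ld j x) in *.
      assert (HDj : 0 < Dj) by apply Diter_pos.
      set (A := exp (ld y)); assert (HA : m <= A) by apply Hld.
      destruct (al_complex AL y w ltac:(lra)) as (_ & w' & E' & Hw').
      fold A in Hw'.
      assert (HAC : RtoC A <> 0%C) by (intros X; apply RtoC_inj in X; lra).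
      assert (Hwp : 0 < Cmod w) by now apply Cmod_gt_0.
      set (e := ((w' - RtoC A * (w + RtoC (psi y / 2) * w ^ 2)) / (RtoC A * w))%C).
      set (t := (RtoC (psi y / 2) * w + e)%C).
      assert (Ew : w' = (RtoC A * w * (1 + t))%C) by (unfold t, e; field; now split).
      assert (He : Cmod e <= K1 * Cmod w ^ 2).
      { unfold e; rewrite Cmod_div, Cmod_mult, Cmod_R, Rabs_pos_eq by (lra || now apply Cmult_neq_0).
        apply (Rmult_le_reg_r (A * Cmod w)); [apply Rmult_lt_0_compat; lra|].
        unfold Rdiv; rewrite Rmult_assoc, Rinv_l, Rmult_1_r
          by (apply Rgt_not_eq, Rmult_lt_0_compat; lra).
        eapply Rle_trans; [exact Hw'|].
        replace (K1 * Cmod w ^ 2 * (A * Cmod w)) with (K1 * A * Cmod w ^ 3) by ring.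
        apply Rmult_le_compat_r; [apply pow_le; lra|].
        apply Rle_trans with (K1 * m); [right; unfold K1; field; lra|].
        now apply Rmult_le_compat_l. }
      assert (Ht : Cmod t <= T * Cmod w).
      { unfold t; eapply Rle_trans; [apply Cmod_triangle|]; rewrite Cmod_mult, Cmod_R.
        assert (P1 : Rabs (psi y / 2) * Cmod w <= V / 2 * Cmod w).
        { apply Rmult_le_compat_r; [lra|]; unfold Rdiv; rewrite Rabs_mult, (Rabs_pos_eq (/ 2)) by lra.
          assert (Q := al_psiV AL y); lra. }
        assert (P2 : K1 * Cmod w ^ 2 <= K1 * Cmod w).
        { apply Rmult_le_compat_l; [easy|].
          assert (Cmod w <= 1) by nra. simpl; nra. }
        unfold T; nra. }
      assert (Ht2 : Cmod t <= 1 / 2).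
      { eapply Rle_trans; [exact Ht|].
        apply Rle_trans with (T * r1); [apply Rmult_le_compat_l; lra|lra]. }
      assert (H1t : 1 / 2 <= Cmod (1 + t)).
      { assert (Q := Cmod_triangle (1 + t) (- t)); rewrite Cmod_opp in Q.
        replace (1 + t + - t)%C with (RtoC 1) in Q by ring; rewrite Cmod_1 in Q; lra. }
      assert (N1t : (1 + t)%C <> 0%C) by (apply Cmod_gt_0; lra).
      assert (Hw'0 : w' <> 0%C) by (rewrite Ew; repeat apply Cmult_neq_0; easy).
      set (Z := (RtoC Dj * w0 / w)%C) in *.
      assert (EZw : Cmod Z * Cmod w = Dj * m0).
      { unfold Z; rewrite Cmod_div, Cmod_mult, Cmod_R, Rabs_pos_eq by (easy || lra).
        fold m0; field; lra. }
      assert (HZ2 : 1 / 2 <= Cmod Z).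
      { assert (Q := Cmod_triangle Z (- (Z - 1))); rewrite Cmod_opp in Q.
        replace (Z + - (Z - 1))%C with (RtoC 1) in Q by ring; rewrite Cmod_1 in Q; lra. }
      assert (Hw2 : Cmod w <= 2 * Dj * m0).
      { apply (Rmult_le_reg_l (Cmod Z)); [lra|]; rewrite EZw.
        assert (0 < Dj * m0) by now apply Rmult_lt_0_compat. nra. }
      assert (ED : Diter F ld (S j) x = Dj * A) by apply Diter_S.
      assert (EZ' : (RtoC (Diter F ld (S j) x) * w0 / w')%C = (Z / (1 + t))%C).
      { rewrite ED, Ew, RtoC_mult; unfold Z; field; repeat split; easy. }
      assert (Eph : nonlin F ld psi (S j) x = nonlin F ld psi j x + psi y * Dj) by easy.
      (* As 1 / (1 + t) = 1 - t + t^2 / (1 + t) and Z w = DF^j x w0, the linear part of [t] cancels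
         exactly against the new term of [nonlin]; what remains is quadratic. *)
      assert (Edef : (Z / (1 + t) - 1 + w0 * RtoC (nonlin F ld psi (S j) x / 2))%C
        = ((Z - 1 + w0 * RtoC (nonlin F ld psi j x / 2)) + Z * (- e + t * t / (1 + t)))%C).
      { replace (RtoC (nonlin F ld psi (S j) x / 2))
          with (RtoC (nonlin F ld psi j x / 2) + RtoC (psi y / 2) * RtoC Dj)%C
          by (rewrite Eph, <- RtoC_mult, <- RtoC_plus; f_equal; field).
        assert (Ee : e = (t - RtoC (psi y / 2) * w)%C) by (unfold t; ring).
        rewrite Ee; unfold Z; field; now split. }
      assert (Herr : Cmod (Z * (- e + t * t / (1 + t))) <= K3 * Dj ^ 2 * m0 ^ 2).
      { rewrite Cmod_mult.
        assert (Q : Cmod (- e + t * t / (1 + t)) <= (K1 + 2 * T ^ 2) * Cmod w ^ 2).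
        { eapply Rle_trans; [apply Cmod_triangle|]; rewrite Cmod_opp, Cmod_div, Cmod_mult by easy.
          assert (Q2 : Cmod t * Cmod t / Cmod (1 + t) <= 2 * T ^ 2 * Cmod w ^ 2).
          { apply (Rmult_le_reg_r (Cmod (1 + t))); [lra|].
            unfold Rdiv; rewrite Rmult_assoc, Rinv_l, Rmult_1_r by lra.
            assert (Q3 : Cmod t * Cmod t <= T * Cmod w * (T * Cmod w))
              by (apply Rmult_le_compat; try easy; apply Cmod_ge_0).
            nra. }
          lra. }
        apply Rle_trans with (Cmod Z * ((K1 + 2 * T ^ 2) * Cmod w ^ 2)).
        - apply Rmult_le_compat_l; [apply Cmod_ge_0|easy].
        - replace (Cmod Z * ((K1 + 2 * T ^ 2) * Cmod w ^ 2))
            with ((K1 + 2 * T ^ 2) * (Cmod Z * Cmod w) * Cmod w) by ring.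
          rewrite EZw.
          replace (K3 * Dj ^ 2 * m0 ^ 2) with ((K1 + 2 * T ^ 2) * (Dj * m0) * (2 * Dj * m0))
            by (unfold K3; ring).
          apply Rmult_le_compat_l; [|easy]; apply Rmult_le_pos.
          + assert (0 <= T ^ 2) by apply pow2_ge_0; lra.
          + apply Rlt_le, Rmult_lt_0_compat; lra. }
      assert (HZ' : Cmod (RtoC (Diter F ld (S j) x) * w0 / w' - 1 + w0 * RtoC (nonlin F ld psi (S j) x / 2))
        <= K3 * psum (fun i => Diter F ld i x ^ 2) (S j) * m0 ^ 2).
      { rewrite EZ', Edef; eapply Rle_trans; [apply Cmod_triangle|].
        change (psum (fun i => Diter F ld i x ^ 2) (S j))
          with (psum (fun i => Diter F ld i x ^ 2) j + Dj ^ 2).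
        rewrite Rmult_plus_distr_l, Rmult_plus_distr_r; lra. }
      assert (Hk' : Cmod (RtoC (Diter F ld (S j) x) * w0 / w' - 1) <= kappa).
      { eapply Rle_trans; [|apply (Hkappa (S j) Hj)].
        set (Y := (RtoC (Diter F ld (S j) x) * w0 / w' - 1)%C) in *.
        replace Y with ((Y + w0 * RtoC (nonlin F ld psi (S j) x / 2))
          + - (w0 * RtoC (nonlin F ld psi (S j) x / 2)))%C by ring.
        eapply Rle_trans; [apply Cmod_triangle|]; rewrite Cmod_opp, Cmod_mult, Cmod_R.
        fold m0.
        replace (Rabs (nonlin F ld psi (S j) x / 2)) with (Rabs (nonlin F ld psi (S j) x) / 2)
          by (unfold Rdiv; rewrite Rabs_mult, (Rabs_pos_eq (/ 2)); lra).
        lra. }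
      exists w'; split; [|split; [easy|split; [|split; [exact Hk'|exact HZ']]]].
      + change (Nat.iter (S j) g (ecx (RtoC x + w0))) with (g (Nat.iter j g (ecx (RtoC x + w0)))).
        rewrite E; exact E'.
      + eapply Rle_trans; [|apply (Hsmall (S j) Hj)].
        assert (HZ'2 : 1 / 2 <= Cmod (RtoC (Diter F ld (S j) x) * w0 / w')).
        { set (Y := (RtoC (Diter F ld (S j) x) * w0 / w')%C) in *.
          assert (Q := Cmod_triangle Y (- (Y - 1))); rewrite Cmod_opp in Q.
          replace (Y + - (Y - 1))%C with (RtoC 1) in Q by ring; rewrite Cmod_1 in Q; lra. }
        assert (HD' := Diter_pos F ld (S j) x).
        rewrite Cmod_div, Cmod_mult, Cmod_R, Rabs_pos_eq in HZ'2 by (lra || easy); fold m0 in HZ'2.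
        assert (Hw'p : 0 < Cmod w') by now apply Cmod_gt_0.
        apply (Rmult_le_compat_r (Cmod w')) in HZ'2; [|lra].
        unfold Rdiv in HZ'2; rewrite (Rmult_assoc _ (/ Cmod w')), Rinv_l in HZ'2 by lra.
        fold m0; lra. }
  intros j Hj; destruct (main j Hj) as (w & E & Hw & Hwr & Hk & _).
  exists w; split; [easy|]; split; [easy|]; split; [|easy].
  apply (al_complex AL); lra.
Qed.

End ComplexOrbit.

(** * Upper bounds for the Poincaré distance *)

Lemma cosh_ge_1 (x : R) : 1 <= cosh x.
Proof.
  unfold cosh; assert (H1 := exp_ineq1_le x); assert (H2 := exp_ineq1_le (- x)); lra.
Qed.

Lemma arcsinh_le_id (x : R) : 0 <= x -> arcsinh x <= x.
Proof.
  intros Hx; rewrite <- (arcsinh_sinh x) at 2; apply arcsinh_le.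
  destruct (mean_value sinh cosh 0 x) as (c & _ & E).
  - intros y; apply is_derive_Reals, derivable_pt_lim_sinh.
  - rewrite sinh_0 in E; assert (H := cosh_ge_1 c); nra.
Qed.

Lemma dist_halfplane_nonneg (u v : C) : 0 <= dist_halfplane u v.
Proof.
  unfold dist_halfplane; apply Rmult_le_pos; [lra|].
  rewrite <- arcsinh_0; apply arcsinh_le; unfold Rdiv; apply Rmult_le_pos; [apply Cmod_ge_0|].
  assert (S0 := sqrt_pos (Re u * Re v)).
  destruct S0 as [S0|S0]; [apply Rlt_le, Rinv_0_lt_compat; lra|].
  rewrite <- S0, Rmult_0_r, Rinv_0; lra.
Qed.

(** A lower bound and a member make the infimum finite, so [real] returns its true value. *)
Lemma real_Glb_le (E : R -> Prop) (d c : R) : (forall x, E x -> 0 <= x) -> E d -> d <= c ->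
  0 <= real (Glb_Rbar E) <= c.
Proof.
  intros H0 Hd Hdc; destruct (Glb_Rbar_correct E) as [L1 L2].
  assert (G0 : Rbar_le 0 (Glb_Rbar E)) by (apply L2; intros x Hx; simpl; auto).
  specialize (L1 d Hd).
  destruct (Glb_Rbar E) as [y| |]; simpl in *; lra.
Qed.

Lemma real_Glb_nonneg (E : R -> Prop) : (forall x, E x -> 0 <= x) -> 0 <= real (Glb_Rbar E).
Proof.
  intros H0; destruct (Glb_Rbar_correct E) as [L1 L2].
  assert (G0 : Rbar_le 0 (Glb_Rbar E)) by (apply L2; intros x Hx; simpl; auto).
  destruct (Glb_Rbar E) as [y| |]; simpl in *; lra.
Qed.

Lemma dist_P_nonneg (z w : C) : 0 <= dist_P z w.
Proof.
  apply real_Glb_nonneg; intros d (u & v & _ & _ & _ & _ & ->); apply dist_halfplane_nonneg.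
Qed.

(** The lifts 2 pi i u and 2 pi i w bound the infimum. The factor 2 pi cancels in the half-plane
    formula, the geometric mean of the heights is at least h / 2, and arcsinh x <= x for x >= 0. *)
Lemma dist_P_ecx_le (u w : C) (h c : R) : 0 < h -> h / 2 <= - snd u -> h / 2 <= - snd w ->
  Cmod (u - w) <= c * (h / 2) -> dist_P (ecx u) (ecx w) <= c.
Proof.
  intros Hh Hu Hw Hd; assert (HP := PI_RGT_0).
  set (lu := (RtoC (2 * PI) * Ci * u)%C); set (lw := (RtoC (2 * PI) * Ci * w)%C).
  assert (Ru : Re lu = 2 * PI * - snd u) by (unfold lu, Re, RtoC, Ci, Cmult; simpl; ring).
  assert (Rw : Re lw = 2 * PI * - snd w) by (unfold lw, Re, RtoC, Ci, Cmult; simpl; ring).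
  apply (real_Glb_le _ (dist_halfplane lu lw)).
  - intros d (a & b & _ & _ & _ & _ & ->); apply dist_halfplane_nonneg.
  - exists lu, lw; rewrite Ru, Rw.
    split; [nra|split; [nra|split; [|split; [|easy]]]]; symmetry; apply ecx_cexp.
  - unfold dist_halfplane; rewrite Ru, Rw.
    replace (2 * PI * - snd u * (2 * PI * - snd w)) with ((2 * PI) ^ 2 * (- snd u * - snd w)) by ring.
    set (s := sqrt (- snd u * - snd w)).
    assert (Hs : h / 2 <= s).
    { unfold s; rewrite <- (sqrt_pow2 (h / 2)) by lra; apply sqrt_le_1_alt.
      replace ((h / 2) ^ 2) with (h / 2 * (h / 2)) by ring; apply Rmult_le_compat; lra. }
    rewrite sqrt_mult, sqrt_pow2 by (try apply pow2_ge_0; nra); fold s.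
    replace (lu - lw)%C with (RtoC (2 * PI) * Ci * (u - w))%C by (unfold lu, lw; ring).
    rewrite !Cmod_mult, Cmod_Ci, Cmod_R, Rabs_pos_eq by lra.
    replace (2 * PI * 1 * Cmod (u - w) / (2 * (2 * PI * s))) with (Cmod (u - w) / (2 * s))
      by (field; lra).
    assert (HC := Cmod_ge_0 (u - w)).
    assert (Hq : Cmod (u - w) / (2 * s) <= c / 2).
    { apply (Rmult_le_reg_r (2 * s)); [lra|].
      unfold Rdiv at 1; rewrite Rmult_assoc, Rinv_l, Rmult_1_r by lra.
      assert (0 <= c) by (apply (Rmult_le_reg_r (h / 2)); lra). nra. }
    assert (Hq0 : 0 <= Cmod (u - w) / (2 * s))
      by (apply Rmult_le_pos; [easy|apply Rlt_le, Rinv_0_lt_compat; lra]).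
    assert (HA := arcsinh_le_id _ Hq0); lra.
Qed.

Lemma dist_P_set_le (A : C -> Prop) (z w : C) (c : R) : A w -> dist_P z w <= c -> dist_P_set z A <= c.
Proof.
  intros Hw Hc; apply (real_Glb_le _ (dist_P z w)); [|now exists w|easy].
  intros d (v & _ & ->); apply dist_P_nonneg.
Qed.

Lemma hausdorff_P_le (A B : C -> Prop) (c : R) :
  (forall a, A a -> exists b, B b /\ dist_P a b <= c) ->
  (forall b, B b -> exists a, A a /\ dist_P b a <= c) -> Rbar_le (hausdorff_P A B) c.
Proof.
  intros HA HB; unfold hausdorff_P.
  match goal with |- Rbar_le (Lub_Rbar ?E) _ => destruct (Lub_Rbar_correct E) as [_ H] end.
  apply H; intros d [(a & Ha & ->)|(b & Hb & ->)]; simpl.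
  - destruct (HA a Ha) as (b & Hb & Hd); now apply (dist_P_set_le B a b).
  - destruct (HB b Hb) as (a & Ha & Hd); now apply (dist_P_set_le A b a).
Qed.

(** * Curves that are graphs over the circle *)

Lemma continuous_C_pair (T : UniformSpace) (f : T -> C) (x : T) :
  continuous (fun x => fst (f x)) x -> continuous (fun x => snd (f x)) x -> continuous f x.
Proof.
  intros H1 H2; apply filterlim_locally; intros eps.
  assert (K1 := proj1 (filterlim_locally _ _) H1 eps).
  assert (K2 := proj1 (filterlim_locally _ _) H2 eps).
  generalize (filter_and _ _ K1 K2); apply filter_imp; intros y Hy; exact Hy.
Qed.

Lemma polar_form (z : C) : z <> 0%C -> exists x y, z = ecx (x, y).
Proof.
  intros Hz; assert (HP := PI_RGT_0); apply Cmod_gt_0 in Hz as Hm.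
  set (m := Cmod z) in *.
  set (a := fst z / m); set (b := snd z / m).
  assert (Hm2 : m ^ 2 = fst z ^ 2 + snd z ^ 2) by apply Cmod2_alt.
  assert (Hab : a ^ 2 + b ^ 2 = 1).
  { unfold a, b; replace ((fst z / m) ^ 2 + (snd z / m) ^ 2) with ((fst z ^ 2 + snd z ^ 2) / m ^ 2)
      by (field; lra); rewrite <- Hm2; field; lra. }
  assert (Ha : -1 <= a <= 1) by nra.
  assert (Hth : exists th, cos th = a /\ sin th = b).
  { destruct (Rle_lt_dec 0 b) as [Hb|Hb].
    - exists (acos a); rewrite cos_acos, sin_acos by easy; split; [easy|].
      replace (1 - Rsqr a) with (b ^ 2) by (rewrite Rsqr_pow2; lra); now apply sqrt_pow2.
    - exists (- acos a); rewrite cos_neg, sin_neg, cos_acos, sin_acos by easy; split; [easy|].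
      replace (1 - Rsqr a) with ((- b) ^ 2) by (rewrite Rsqr_pow2; lra).
      rewrite sqrt_pow2; lra. }
  destruct Hth as (th & Hc & Hs).
  exists (th / (2 * PI)), (- ln m / (2 * PI)).
  unfold ecx, expi; cbn [fst snd].
  replace (2 * PI * (th / (2 * PI))) with th by (field; lra).
  replace (- (2 * PI) * (- ln m / (2 * PI))) with (ln m) by (field; lra).
  rewrite exp_ln, Hc, Hs by easy; destruct z as [z1 z2]; unfold a, b, RtoC, Cmult; simpl.
  f_equal; field; lra.
Qed.

Section Graph.

Variable H : R -> R.
Variable M : R.
Hypothesis H_pos : forall x, 0 < H x.
Hypothesis H_per : forall x (k : Z), H (x + IZR k) = H x.
Hypothesis M_nonneg : 0 <= M.
Hypothesis H_lip : forall x y, Rabs (H x - H y) <= M * Rabs (x - y).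

(** The minus sign puts the curve in the lower half-plane, that is, outside the disk. *)
Definition graph (x : R) : C := ecx (x, - H x).

Lemma H_continuous (x : R) : continuous H x.
Proof.
  apply continuous_eps; intros eps Heps; exists (eps / (M + 1)).
  split; [apply Rdiv_lt_0_compat; lra|]; intros y Hy.
  eapply Rle_lt_trans; [apply H_lip|].
  apply Rle_lt_trans with ((M + 1) * Rabs (y - x)); [assert (T := Rabs_pos (y - x)); lra|].
  apply (Rmult_lt_compat_l (M + 1)) in Hy; [|lra].
  replace ((M + 1) * (eps / (M + 1))) with eps in Hy by (field; lra); easy.
Qed.

Lemma ecx_IZR (x y : R) (k : Z) : ecx (x + IZR k, y) = ecx (x, y).
Proof. unfold ecx; cbn [fst snd]; now rewrite expi_IZR. Qed.

Lemma graph_IZR (x : R) (k : Z) : graph (x + IZR k) = graph x.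
Proof. unfold graph; now rewrite H_per, ecx_IZR. Qed.

Lemma graph_trace (x : R) : trace graph (graph x).
Proof.
  assert (Hf := base_fp x); unfold frac_part in Hf.
  exists (x - IZR (Int_part x)); split; [split; lra|].
  rewrite <- (graph_IZR (x - IZR (Int_part x)) (Int_part x)); f_equal; ring.
Qed.

Lemma trace_graph (z : C) : trace graph z -> exists x, z = graph x.
Proof. intros (x & _ & E); now exists x. Qed.

Lemma ecx_outside (w : C) : snd w < 0 -> outside_disk (ecx w).
Proof.
  intros Hw; unfold outside_disk; rewrite Cmod_ecx, <- exp_0; apply exp_increasing.
  assert (HP := PI_RGT_0); nra.
Qed.

Lemma ecx_inj (x x' y y' : R) : ecx (x, y) = ecx (x', y') -> y = y' /\ expi x = expi x'.
Proof.
  intros E; assert (HP := PI_RGT_0).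
  assert (Ey : y = y').
  { assert (EM := f_equal Cmod E); rewrite !Cmod_ecx in EM; cbn [snd] in EM.
    apply exp_inv in EM; apply (Rmult_eq_reg_l (- (2 * PI))); lra. }
  split; [easy|]; subst y'; unfold ecx in E; cbn [fst snd] in E.
  set (e := exp (- (2 * PI) * y)) in E.
  assert (He : RtoC e <> 0%C).
  { intros X; apply RtoC_inj in X; assert (K := exp_pos (- (2 * PI) * y)); unfold e in X; lra. }
  transitivity (/ RtoC e * (RtoC e * expi x))%C; [field; easy|].
  rewrite E; field; easy.
Qed.

Lemma derivable_continuous_comp (T : UniformSpace) (g dg : R -> R) (f : T -> R) (x : T) :
  (forall y, derivable_pt_lim g y (dg y)) -> continuous f x -> continuous (fun x => g (f x)) x.
Proof.
  intros Hg Hf; apply (continuous_comp f g); [easy|].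
  apply (@ex_derive_continuous R_AbsRing R_NormedModule); eexists; apply is_derive_Reals, Hg.
Qed.

Lemma ecx_continuous_comp (T : UniformSpace) (f h : T -> R) (x : T) :
  continuous f x -> continuous h x -> continuous (fun x => ecx (f x, h x)) x.
Proof.
  intros Hf Hh.
  assert (He : continuous (fun x => exp (- (2 * PI) * h x)) x).
  { apply (derivable_continuous_comp T exp exp); [apply derivable_pt_lim_exp|].
    apply (continuous_mult (fun _ => - (2 * PI)) h); [apply continuous_const|easy]. }
  assert (Ha : continuous (fun x => 2 * PI * f x) x)
    by (apply (continuous_mult (fun _ => 2 * PI) f); [apply continuous_const|easy]).
  apply continuous_C_pair.
  - apply (continuous_ext (fun x => exp (- (2 * PI) * h x) * cos (2 * PI * f x)));
      [intros y; unfold ecx, expi, RtoC, Cmult; simpl; ring|].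
    apply (continuous_mult (fun x => exp (- (2 * PI) * h x)) (fun x => cos (2 * PI * f x)));
      [easy|]; now apply (derivable_continuous_comp T cos _ _ _ derivable_pt_lim_cos).
  - apply (continuous_ext (fun x => exp (- (2 * PI) * h x) * sin (2 * PI * f x)));
      [intros y; unfold ecx, expi, RtoC, Cmult; simpl; ring|].
    apply (continuous_mult (fun x => exp (- (2 * PI) * h x)) (fun x => sin (2 * PI * f x)));
      [easy|]; now apply (derivable_continuous_comp T sin _ _ _ derivable_pt_lim_sin).
Qed.

Lemma graph_jordan : jordan_curve graph.
Proof.
  split; [|split].
  - apply continuous_on_forall; intros x _; unfold graph; apply ecx_continuous_comp;
      [apply continuous_id|apply (continuous_opp H), H_continuous].
  - rewrite <- (graph_IZR 0 1); f_equal; ring.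
  - intros s t Hs Ht E; destruct (ecx_inj _ _ _ _ E) as [_ E']; destruct (expi_eq _ _ E') as [k Hk].
    assert (K1 : (-1 < k)%Z) by (apply lt_IZR; lra).
    assert (K2 : (k < 1)%Z) by (apply lt_IZR; lra).
    assert (K0 : k = 0%Z) by lia. rewrite K0 in Hk; lra.
Qed.

Lemma graph_outside (z : C) : trace graph z -> outside_disk z.
Proof.
  intros Hz; destruct (trace_graph z Hz) as [x ->]; apply ecx_outside; cbn [snd].
  assert (K := H_pos x); lra.
Qed.

Lemma graph_homotopic : homotopic_loops (fun z => 1 <= Cmod z) graph expi.
Proof.
  assert (HP := PI_RGT_0).
  exists (fun p => ecx (snd p, - ((1 - fst p) * H (snd p)))).
  assert (Hc : forall p : R * R, continuous (fun p : R * R => H (snd p)) p).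
  { intros p; apply (continuous_comp (fun p : R * R => snd p) H); [apply continuous_snd|].
    apply H_continuous. }
  split; [|split; [|split; [|split]]].
  - apply continuous_on_forall; intros p _; apply ecx_continuous_comp; [apply continuous_snd|].
    apply (continuous_opp (fun p : R * R => (1 - fst p) * H (snd p))).
    apply (continuous_mult (fun p : R * R => 1 - fst p) (fun p : R * R => H (snd p))); [|apply Hc].
    apply (continuous_minus (fun _ : R * R => 1) (fun p : R * R => fst p));
      [apply continuous_const|apply continuous_fst].
  - intros s t Hs Ht; rewrite Cmod_ecx; cbn [fst snd].
    apply Rle_trans with (exp 0); [rewrite exp_0; lra|apply exp_le_compat].
    unfold unit_interval in Hs; assert (K := H_pos t).
    replace (- (2 * PI) * - ((1 - s) * H t)) with (2 * PI * ((1 - s) * H t)) by ring.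
    apply Rmult_le_pos; [lra|apply Rmult_le_pos; lra].
  - intros t _; unfold graph; cbn [fst snd]; repeat f_equal; ring.
  - intros t _; cbn [fst snd]; rewrite <- ecx_RtoC; unfold RtoC; repeat f_equal; ring.
  - intros s _; cbn [fst snd]; replace (H 1) with (H 0)
      by (rewrite <- (H_per 0 1); f_equal; ring).
    rewrite <- (ecx_IZR 0 _ 1); repeat f_equal; ring.
Qed.

(** A point at height at least [H x] and off the curve could escape to infinity along its ray, on
    which the height only increases, so its component would be unbounded. *)
Lemma annulus_below (z : C) : annulus graph z -> exists x y, z = ecx (x, - y) /\ 0 < y < H x.
Proof.
  intros [Hout [Htr [B HB]]]; assert (HP := PI_RGT_0); unfold outside_disk in Hout.
  destruct (polar_form z) as (x & y' & E); [apply Cmod_gt_0; lra|].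
  exists x, (- y'); rewrite Ropp_involutive; split; [easy|].
  assert (Hy : 0 < - y').
  { rewrite E, Cmod_ecx, <- exp_0 in Hout; apply exp_lt_inv in Hout; cbn [snd] in Hout; nra. }
  split; [easy|].
  apply Rnot_le_lt; intros HH.
  (* At time 1 the path reaches modulus (1 + R0) |z| > B, since |z| > 1. *)
  set (R0 := Rabs B + 1); assert (HR0 : 0 < R0) by (unfold R0; assert (K := Rabs_pos B); lra).
  set (path := fun s : R => (RtoC (1 + s * R0) * z)%C).
  assert (Hpath : forall s, 0 <= s -> ~ trace graph (path s)).
  { intros s Hs Ht.
    assert (Hs1 : 1 <= 1 + s * R0) by (assert (0 <= s * R0) by (apply Rmult_le_pos; lra); lra).
    assert (Ep : path s = ecx (x, y' - ln (1 + s * R0) / (2 * PI))).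
    { unfold path; rewrite E; unfold ecx; cbn [fst snd].
      replace (- (2 * PI) * (y' - ln (1 + s * R0) / (2 * PI)))
        with (ln (1 + s * R0) + - (2 * PI) * y') by (field; lra).
      rewrite exp_plus, exp_ln, RtoC_mult by lra; ring. }
    destruct (trace_graph _ Ht) as [t Et]; rewrite Ep in Et.
    destruct (ecx_inj _ _ _ _ Et) as [Ey Ex]; destruct (expi_eq _ _ Ex) as [k Hk].
    assert (EH : H t = H x) by (rewrite Hk; symmetry; apply H_per).
    destruct Hs as [Hs|Hs].
    - assert (L : 0 < ln (1 + s * R0)).
      { rewrite <- ln_1; apply ln_increasing; [lra|].
        assert (0 < s * R0) by now apply Rmult_lt_0_compat. lra. }
      assert (0 < ln (1 + s * R0) / (2 * PI)) by (apply Rdiv_lt_0_compat; lra). lra.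
    - apply Htr; replace z with (path 0); [now rewrite Hs|].
      unfold path; rewrite Rmult_0_l, Rplus_0_r; ring. }
  assert (Hb : Cmod (path 1) <= B).
  { apply HB; exists path; split; [|split; [|split]].
    - apply continuous_on_forall; intros s _; apply continuous_C_pair;
        [apply (continuous_ext (fun s => (1 + s * R0) * fst z))|
         apply (continuous_ext (fun s => (1 + s * R0) * snd z))];
        try (intros t; unfold path, RtoC, Cmult; simpl; ring);
        apply (continuous_mult (fun s => 1 + s * R0) (fun _ => _)); try apply continuous_const;
        apply (continuous_plus (fun _ => 1) (fun s => s * R0)); try apply continuous_const;
        apply (continuous_mult (fun s => s) (fun _ => R0)); [apply continuous_id|apply continuous_const
          |apply continuous_id|apply continuous_const].
    - unfold path; rewrite Rmult_0_l, Rplus_0_r; ring.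
    - reflexivity.
    - intros t Ht; apply Hpath, Ht. }
  unfold path in Hb; rewrite Cmod_mult, Cmod_R, Rmult_1_l, Rabs_pos_eq in Hb by lra.
  assert (K := Rle_abs B); unfold R0 in Hb, HR0; nra.
Qed.

(** The open set is the interior of [P]. A point near the closed annulus has coordinates close to
    some (x, - y) with 0 < y < H x; it may lie slightly above the curve or inside the disk, hence
    the condition on |y| up to 2 H. *)
Lemma closed_annulus_neighbourhood (P : C -> Prop) :
  (forall x y, Rabs y <= 2 * H x -> P (ecx (x, y))) ->
  exists U : C -> Prop, open U /\ (forall z, closure (annulus graph) z -> U z) /\ forall z, U z -> P z.
Proof.
  intros HPxy; destruct (periodic_lower_bound H H_continuous (fun x => H_per x 1) H_pos) as (m & Hm & HHm).
  (* A perturbation by [eta] raises the height by at most [eta] and lowers [2 * H] by at most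
     [2 * M * eta]; together these are [m], the minimum of [H]. *)
  set (eta := m / (1 + 2 * M)).
  assert (Heta : 0 < eta) by (apply Rdiv_lt_0_compat; lra).
  destruct (clog_continuous 1 ltac:(simpl; lra) eta Heta) as (d0 & Hd0 & Hlog).
  set (d := Rmin d0 (1 / 2) / 2).
  assert (Hdd : 0 < d) by (assert (0 < Rmin d0 (1 / 2)) by (apply Rmin_glb_lt; lra); unfold d; lra).
  assert (D0 : 2 * d <= d0) by (assert (K := Rmin_l d0 (1 / 2)); unfold d; lra).
  assert (D1 : 2 * d <= 1 / 2) by (assert (K := Rmin_r d0 (1 / 2)); unfold d; lra).
  exists (fun z => exists e, 0 < e /\ forall w, Cmod (w - z) < e -> P w); split; [|split].
  - intros z (e & He & K).
    assert (He4 : 0 < e / 4) by lra; exists (mkposreal _ He4); intros z' [B1 B2].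
    exists (e / 2); split; [lra|]; intros w Hw; apply K.
    replace (w - z)%C with ((w - z') + (z' - z))%C by ring.
    eapply Rle_lt_trans; [apply Cmod_triangle|].
    assert (B := Cmod_le_components (z' - z)).
    change (Rabs (fst (z' - z)%C) < e / 4) in B1; change (Rabs (snd (z' - z)%C) < e / 4) in B2; lra.
  - intros z Hz; exists d; split; [easy|]; intros w Hw.
    destruct (Hz (fun v => Cmod (v - z) < d)) as (z1 & Hz1 & Ha).
    { assert (Hd2 : 0 < d / 2) by lra; exists (mkposreal _ Hd2); intros v [B1 B2].
      assert (B := Cmod_le_components (v - z)).
      change (Rabs (fst (v - z)%C) < d / 2) in B1; change (Rabs (snd (v - z)%C) < d / 2) in B2; lra. }
    assert (Hout : 1 < Cmod z1) by apply Ha.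
    destruct (annulus_below z1 Ha) as (x & y & E & Hy).
    assert (Hz10 : z1 <> 0%C) by (apply Cmod_gt_0; lra).
    assert (Hq : Cmod (w / z1 - 1) < 2 * d).
    { replace (w / z1 - 1)%C with ((w - z1) / z1)%C by (field; easy).
      rewrite Cmod_div by easy.
      assert (Hwz : Cmod (w - z1) < 2 * d).
      { replace (w - z1)%C with ((w - z) - (z1 - z))%C by ring.
        eapply Rle_lt_trans; [apply Cmod_triangle|]; rewrite Cmod_opp; lra. }
      apply Rle_lt_trans with (Cmod (w - z1)); [|easy].
      apply (Rmult_le_reg_r (Cmod z1)); [lra|].
      unfold Rdiv; rewrite Rmult_assoc, Rinv_l by lra; assert (K := Cmod_ge_0 (w - z1)); nra. }
    assert (Hu := Hlog (w / z1)%C ltac:(lra)); rewrite clog_1 in Hu.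
    assert (Ew : w = ecx (Cplus (x, - y) (clog (Cdiv w z1)))).
    { rewrite ecx_plus, <- E, ecx_clog; [field; easy|].
      assert (K := near_1_fst (w / z1)%C ltac:(lra)); lra. }
    replace (clog (w / z1) - 0)%C with (clog (w / z1)) in Hu by ring.
    destruct (clog (w / z1)) as [u1 u2].
    assert (U1 := Rle_lt_trans _ _ _ (fst_le_Cmod _) Hu); assert (U2 := Rle_lt_trans _ _ _ (snd_le_Cmod _) Hu).
    cbn [fst snd] in U1, U2.
    rewrite Ew; unfold Cplus; cbn [fst snd]; apply HPxy.
    assert (HL := H_lip (x + u1) x); replace (x + u1 - x) with u1 in HL by ring.
    assert (HM : M * Rabs u1 <= M * eta) by (apply Rmult_le_compat_l; lra).
    apply Rabs_le_between in HL; apply Rabs_def2 in U2.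
    assert (He : eta * (1 + 2 * M) = m) by (unfold eta; field; lra).
    specialize (HHm x); apply Rabs_le; lra.
  - intros z (e & He & K); apply K; replace (z - z)%C with (RtoC 0) by ring; now rewrite Cmod_0.
Qed.

End Graph.
(** * Quasi-invariant curves *)

Definition cpt (x y : R) : C := (x, y).

(** Intermediate values between consecutive integers. Surjectivity lets every point of the curve be
    approximated by its image, the second half of the Hausdorff estimate. *)
Lemma fiter_surjective (F : R -> R) (j : nat) (t : R) :
  (forall x, continuous F x) -> (forall x, F (x + 1) = F x + 1) -> exists x, fiter F j x = t.
Proof.
  intros HF F1.
  assert (Hc : forall x, continuous (fiter F j) x).
  { induction j as [|j IH]; intros x; [apply continuous_id|].
    apply (continuous_comp (fiter F j) F); [apply IH|apply HF]. }
  set (k := Int_part (t - fiter F j 0)).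
  assert (Hk := base_Int_part (t - fiter F j 0)); fold k in Hk.
  assert (E : forall l : Z, fiter F j (IZR l) = fiter F j 0 + IZR l).
  { intros l; rewrite <- (fiter_IZR F F1 j 0 l); f_equal; ring. }
  destruct (IVT_gen (fiter F j) (IZR k) (IZR (k + 1)) t) as (x & _ & Hx).
  - intros y; apply continuity_pt_filterlim, Hc.
  - rewrite (E k), (E (k + 1)%Z), plus_IZR, Rmin_left, Rmax_right; lra.
  - now exists x.
Qed.

Lemma iterates_real (g : C -> C) (F : R -> R) (j : nat) (x : R) :
  (forall x, g (expi x) = expi (F x)) -> Nat.iter j g (expi x) = expi (fiter F j x).
Proof.
  intros HF; induction j as [|j IH]; [easy|]; simpl; rewrite IH; apply HF.
Qed.

(** For the purely vertical displacement w0 = - i H, closeness of d w0 / w to 1 says that w is - i d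
    H up to a relative error 2 kappa. *)
Lemma displacement_estimate (d H kappa : R) (w : C) : 0 < d -> 0 < H -> 0 <= kappa <= 1 / 8 -> w <> 0%C ->
  Cmod (RtoC d * cpt 0 (- H) / w - 1) <= kappa ->
  Cmod (w - cpt 0 (- (d * H))) <= 2 * kappa * (d * H) /\ d * H * (1 - 2 * kappa) <= - snd w.
Proof.
  intros Hd HH Hk Hw HZ; set (h := d * H); assert (Hh : 0 < h) by now apply Rmult_lt_0_compat.
  assert (E : (RtoC d * cpt 0 (- H))%C = cpt 0 (- h)).
  { unfold cpt, RtoC, Cmult, h; simpl; f_equal; ring. }
  rewrite E in HZ; set (v := cpt 0 (- h) : C) in *.
  assert (Hv : Cmod v = h).
  { unfold v, cpt, Cmod; simpl; replace (0 * (0 * 1) + - h * (- h * 1)) with (h ^ 2) by ring.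
    apply sqrt_pow2; lra. }
  assert (Hw0 : 0 < Cmod w) by now apply Cmod_gt_0.
  assert (Hvw : Cmod (v - w) <= kappa * Cmod w).
  { replace (v / w - 1)%C with ((v - w) / w)%C in HZ by (field; easy).
    rewrite Cmod_div in HZ by easy; apply (Rmult_le_compat_r (Cmod w)) in HZ; [|lra].
    unfold Rdiv in HZ; rewrite Rmult_assoc, Rinv_l, Rmult_1_r in HZ by lra; easy. }
  assert (Hww : Cmod w <= 2 * h).
  { assert (T := Cmod_triangle v (- (v - w))); rewrite Cmod_opp, Hv in T.
    replace (v + - (v - w))%C with w in T by ring; nra. }
  assert (B : Cmod (w - v) <= 2 * kappa * h).
  { rewrite <- Cmod_opp; replace (- (w - v))%C with (v - w)%C by ring.
    eapply Rle_trans; [exact Hvw|]; nra. }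
  split; [exact B|].
  assert (S := Rle_trans _ _ _ (snd_le_Cmod _) B); unfold v, cpt in S; simpl in S.
  apply Rabs_le_between in S; lra.
Qed.

Lemma ecx_pair (x : R) (w : C) : (RtoC x + w)%C = cpt (x + fst w) (snd w).
Proof. unfold cpt, RtoC, Cplus; simpl; f_equal; ring. Qed.

(** The dynamical content of the theorem, pointwise along the curve. Allowing |y| up to 2 H in the
    first clause leaves room for an open neighbourhood of the closed annulus. *)
Lemma quasi_invariant_graph (g : C -> C) (W : C -> Prop) (F ld psi : R -> R) (V L r K : R)
  (q : nat -> nat) (p : nat -> Z) (C0 : R) :
  analytic_lift g W F ld psi V L r K ->
  (forall n, (1 <= q n)%nat) -> (forall n, (q n <= q (S n))%nat) ->
  (forall n, (q (S n) < q (S (S n)))%nat) ->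
  (forall n, IZR (p (S n)) * INR (q n) - IZR (p n) * INR (q (S n)) = (-1) ^ n) ->
  (forall n x, 0 < (-1) ^ n * (fiter F (q n) x - IZR (p n) - x)) -> 0 < C0 ->
  exists n0 c, 0 < c /\ forall n, (n0 <= n)%nat ->
    let H := fun x => c * gap F q p n x in
    (forall x y j, Rabs y <= 2 * H x -> (j <= q n)%nat -> iterate_defined W g j (ecx (x, y))) /\
    (forall x j, (j <= q n)%nat -> exists w, Nat.iter j g (graph H x) = ecx w /\ snd w < 0 /\
       dist_P (ecx w) (graph H (fiter F j x)) <= C0 /\ dist_P (graph H (fiter F j x)) (ecx w) <= C0) /\
    (forall x, dist_P (Nat.iter (q n) g (graph H x)) (graph H x) <= C0).
Proof.
  intros AL q1 q2 q3 q4 q5 HC0.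
  assert (AL' := AL); destruct AL' as [Fc Fl Fi F1 dF dld ld1 psiV psiL r_pos K_nn FC].
  destruct (complex_orbit g W F ld psi V L r K AL) as (r1 & K3 & Hr1 & HK3 & orbit).
  set (c0 := Rmin C0 1).
  assert (Hc0 : 0 < c0 <= 1) by (split; [apply Rmin_glb_lt; lra|apply Rmin_r]).
  assert (Hc0' : c0 <= C0) by apply Rmin_l.
  (* At height H the return may move a point by c0 H / 2. The closest return uses gap = c0 H / 4;
     the other quarter is 6 kappa H, of which 4 kappa is the orbit error and 2 kappa the deviation
     of DF^(q_n) from 1. *)
  set (c := 4 / c0); assert (Hc : 0 < c) by (apply Rdiv_lt_0_compat; lra).
  set (kappa := c0 / 24); assert (Hkap : 0 < kappa <= 1 / 24) by (unfold kappa; lra).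
  (* With |w0| <= 2 c gap, the two error terms of [complex_orbit] are at most [c * k] and
     [4 * K3 * c ^ 2 * k]. *)
  set (B := c + 4 * K3 * c ^ 2).
  assert (HB : 0 < B).
  { unfold B; assert (0 <= 4 * K3 * c ^ 2) by (apply Rmult_le_pos; [lra|apply pow2_ge_0]); lra. }
  (* In order: heights match within kappa, complex orbits stay in the disk of radius [r1], and their
     accumulated error stays below kappa. *)
  set (k := Rmin kappa (Rmin (r1 / (4 * c)) (kappa / B))).
  assert (Hk : 0 < k) by (repeat apply Rmin_glb_lt; try lra; apply Rdiv_lt_0_compat; lra).
  assert (Hk1 : k <= kappa) by apply Rmin_l.
  assert (Hk2 : 4 * c * k <= r1).
  { apply Rle_trans with (4 * c * (r1 / (4 * c))); [|right; field; lra].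
    apply Rmult_le_compat_l; [lra|]; eapply Rle_trans; [apply Rmin_r|apply Rmin_l]. }
  assert (Hk3 : B * k <= kappa).
  { apply Rle_trans with (B * (kappa / B)); [|right; field; lra].
    apply Rmult_le_compat_l; [lra|]; eapply Rle_trans; [apply Rmin_r|apply Rmin_r]. }
  destruct (eventual_estimates F ld psi V L F1 dF dld ld1 psiV psiL q p q1 q2 q3 q4 q5 k Hk)
    as (n0 & est).
  exists n0, c; split; [easy|]; intros n Hn H.
  destruct (est n Hn) as (E1 & E2 & E3 & E4 & E5); clear est.
  assert (Hgap : forall x, 0 < gap F q p n x) by (intros; apply q5).
  assert (HH : forall x, 0 < H x) by (intros; now apply Rmult_lt_0_compat).
  assert (orbit' : forall (x : R) (w0 : C), w0 <> 0%C -> Cmod w0 <= 2 * H x ->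
    forall j, (j <= q (S n))%nat -> exists w : C,
    Nat.iter j g (ecx (RtoC x + w0)) = ecx (RtoC (fiter F j x) + w) /\ w <> 0%C /\
    W (ecx (RtoC (fiter F j x) + w)) /\
    Cmod (RtoC (Diter F ld j x) * w0 / w - 1) <= kappa).
  { intros x w0 Hw0 Hb; apply orbit; [easy|lra| |].
    - intros j Hj; assert (HD := Diter_pos F ld j x); specialize (E5 x j Hj).
      apply Rle_trans with (4 * c * (Diter F ld j x * gap F q p n x)).
      + replace (4 * c * (Diter F ld j x * gap F q p n x)) with (2 * Diter F ld j x * (2 * H x))
          by (unfold H; ring); apply Rmult_le_compat_l; lra.
      + eapply Rle_trans; [apply Rmult_le_compat_l; [lra|exact E5]|easy].
    - intros j Hj; specialize (E3 x j Hj); specialize (E4 x j Hj).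
      eapply Rle_trans; [|exact Hk3].
      replace (B * k) with (c * k + K3 * (4 * c ^ 2 * k)) by (unfold B; ring).
      assert (Hm := Cmod_ge_0 w0).
      apply Rplus_le_compat.
      + apply Rle_trans with (c * (Rabs (nonlin F ld psi j x) * gap F q p n x));
          [|apply Rmult_le_compat_l; lra].
        assert (P := Rabs_pos (nonlin F ld psi j x)).
        replace (c * (Rabs (nonlin F ld psi j x) * gap F q p n x))
          with (Rabs (nonlin F ld psi j x) * (2 * H x) / 2) by (unfold H; field).
        apply Rmult_le_compat_r; [lra|]; now apply Rmult_le_compat_l.
      + rewrite Rmult_assoc; apply Rmult_le_compat_l; [easy|].
        set (S2 := psum (fun i => Diter F ld i x ^ 2) j) in *.
        assert (HS : 0 <= S2) by (apply psum_nonneg; intros; apply pow2_ge_0).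
        apply Rle_trans with (4 * c ^ 2 * (S2 * gap F q p n x ^ 2)).
        * replace (4 * c ^ 2 * (S2 * gap F q p n x ^ 2)) with (S2 * (2 * H x) ^ 2)
            by (unfold H; ring).
          apply Rmult_le_compat_l; [easy|]; apply pow_incr; lra.
        * apply Rmult_le_compat_l; [assert (0 <= c ^ 2) by apply pow2_ge_0; lra|easy]. }
  assert (vert : forall x, Nat.iter 0 g (graph H x) = ecx (RtoC x + cpt 0 (- H x))%C).
  { intros x; simpl; unfold graph; rewrite ecx_pair; unfold cpt; cbn [fst snd].
    now rewrite Rplus_0_r. }
  assert (vert0 : forall x, (cpt 0 (- H x) : C) <> 0%C).
  { intros x X; unfold cpt in X; injection X; specialize (HH x); lra. }
  assert (vertm : forall x, Cmod (cpt 0 (- H x)) = H x).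
  { intros x; unfold cpt, Cmod; simpl; replace (0 * (0 * 1) + - H x * (- H x * 1)) with (H x ^ 2) by ring.
    apply sqrt_pow2, Rlt_le, HH. }
  assert (main : forall x j, (j <= q (S n))%nat -> exists w : C,
    Nat.iter j g (graph H x) = ecx (RtoC (fiter F j x) + w) /\
    Cmod (w - cpt 0 (- (Diter F ld j x * H x))) <= 2 * kappa * (Diter F ld j x * H x) /\
    Diter F ld j x * H x * (1 - 2 * kappa) <= - snd w).
  { intros x j Hj; destruct (orbit' x (cpt 0 (- H x)) (vert0 x) ltac:(rewrite vertm; specialize (HH x); lra) j Hj)
      as (w & E & Hw & _ & HZ).
    exists w; rewrite <- vert in E; split; [exact E|].
    apply displacement_estimate; auto; [apply Diter_pos|lra]. }
  destruct (exp_small_bounds k ltac:(lra)) as [X1 X2].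
  split; [|split].
  - intros x y j Hy Hj i Hi.
    replace ((x, y) : C) with (RtoC x + cpt 0 y)%C by (unfold cpt, RtoC, Cplus; simpl; f_equal; ring).
    (* Points of the circle are handled by the real orbit, since [complex_orbit] divides by the
       displacement. *)
    destruct (Req_dec y 0) as [->|Hy0].
    + change (cpt 0 0) with (RtoC 0); rewrite Cplus_0_r, ecx_RtoC, (iterates_real g F) by easy.
      assert (W0 := proj1 (FC (fiter F i x) 0%C ltac:(rewrite Cmod_0; lra))).
      now rewrite Cplus_0_r, ecx_RtoC in W0.
    + destruct (orbit' x (cpt 0 y)) with (j := i) as (w & E & _ & HW & _).
      * intros X; unfold cpt in X; injection X; easy.
      * unfold cpt, Cmod; simpl; replace (0 * (0 * 1) + y * (y * 1)) with (Rsqr y) by (unfold Rsqr; ring).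
        rewrite sqrt_Rsqr_abs; easy.
      * specialize (q2 n); lia.
      * now rewrite E.
  - intros x j Hj; assert (Hj' : (j <= q (S n))%nat) by (specialize (q2 n); lia).
    destruct (main x j Hj') as (w & E & B1 & B2).
    set (h := Diter F ld j x * H x) in *.
    assert (Hh : 0 < h) by (apply Rmult_lt_0_compat; [apply Diter_pos|apply HH]).
    exists (RtoC (fiter F j x) + w)%C; split; [exact E|].
    assert (Hs : snd (RtoC (fiter F j x) + w)%C = snd w) by (simpl; ring).
    rewrite Hs.
    assert (Hw2 : h / 2 <= - snd w) by nra.
    assert (HHj : Rabs (H (fiter F j x) - h) <= 2 * kappa * h).
    { destruct (E1 x j Hj') as [L1 L2].
      replace (H (fiter F j x)) with (c * gap F q p n (fiter F j x)) by easy.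
      assert (Eh : h = c * (Diter F ld j x * gap F q p n x)) by (unfold h, H; ring).
      set (dg := Diter F ld j x * gap F q p n x) in *.
      assert (Hdg : 0 < dg) by (apply Rmult_lt_0_compat; [apply Diter_pos|apply Hgap]).
      assert (M1 : (1 - k) * dg <= gap F q p n (fiter F j x))
        by (eapply Rle_trans; [apply Rmult_le_compat_r; [lra|exact X2]|easy]).
      assert (M2 : gap F q p n (fiter F j x) <= (1 + 2 * k) * dg)
        by (eapply Rle_trans; [exact L2|apply Rmult_le_compat_r; lra]).
      assert (M3 : k * dg <= kappa * dg) by (apply Rmult_le_compat_r; lra).
      assert (M4 : 0 < kappa * dg) by (apply Rmult_lt_0_compat; lra).
      rewrite Eh; apply Rabs_le; split.
      - apply (Rmult_le_compat_l c) in M1; [|lra]; apply (Rmult_le_compat_l c) in M3; [|lra].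
        assert (0 < c * (kappa * dg)) by (apply Rmult_lt_0_compat; lra). lra.
      - apply (Rmult_le_compat_l c) in M2; [|lra]; apply (Rmult_le_compat_l c) in M3; [|lra]; lra. }
    assert (HH2 : h / 2 <= H (fiter F j x)) by (apply Rabs_le_between in HHj; nra).
    assert (Hd : Cmod ((RtoC (fiter F j x) + w) - cpt (fiter F j x) (- H (fiter F j x))) <= C0 * (h / 2)).
    { replace (RtoC (fiter F j x) + w - cpt (fiter F j x) (- H (fiter F j x)))%C
        with ((w - cpt 0 (- h)) + cpt 0 (H (fiter F j x) - h))%C
        by (apply injective_projections; simpl; ring).
      eapply Rle_trans; [apply Cmod_triangle|].
      assert (T := Cmod_le_components (cpt 0 (H (fiter F j x) - h))); cbn [cpt fst snd] in T.
      rewrite Rabs_R0, Rplus_0_l in T.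
      apply Rle_trans with (4 * kappa * h); [lra|].
      assert (c0 * (h / 2) <= C0 * (h / 2)) by (apply Rmult_le_compat_r; lra).
      assert (0 < c0 * h) by (apply Rmult_lt_0_compat; lra).
      unfold kappa; lra. }
    split; [lra|]; split; unfold graph; apply (dist_P_ecx_le _ _ h); cbn [cpt snd]; try lra;
      try (rewrite Hs; lra); try easy.
    rewrite <- Cmod_opp; eapply Rle_trans; [|exact Hd]; right.
    apply (f_equal Cmod), injective_projections; simpl; ring.
  - intros x; destruct (main x (q n) (q2 n)) as (w & -> & B1 & B2).
    set (dq := Diter F ld (q n) x) in *.
    assert (Hdq : 1 - k <= dq <= 1 + 2 * k).
    { assert (T := E2 x); apply Rabs_le_between in T; unfold dq, Diter; split.
      - eapply Rle_trans; [exact X2|]; apply exp_le_compat; lra.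
      - eapply Rle_trans; [|exact X1]; apply exp_le_compat; lra. }
    assert (Hx := HH x).
    (* Another lift of the same point, chosen within [gap] of [x]. *)
    set (y := fiter F (q n) x - IZR (p n)).
    assert (Ey : ecx (RtoC (fiter F (q n) x) + w) = ecx (RtoC y + w)).
    { rewrite !ecx_pair; unfold cpt; rewrite <- (ecx_IZR (y + fst w) (snd w) (p n)).
      apply (f_equal (fun t => ecx (t, snd w))); unfold y; ring. }
    rewrite Ey; unfold graph.
    assert (Hyx : Rabs (y - x) = gap F q p n x) by (apply gap_abs, q5).
    assert (Hgc : gap F q p n x = c0 / 4 * H x) by (unfold H, c; field; lra).
    assert (P1 : 2 * kappa * (dq * H x) <= 4 * kappa * H x).
    { replace (4 * kappa * H x) with (2 * kappa * (2 * H x)) by ring.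
      apply Rmult_le_compat_l; [lra|]; apply Rmult_le_compat_r; lra. }
    apply (dist_P_ecx_le _ _ (H x)); [easy| |cbn [cpt snd]; lra|].
    + rewrite ecx_pair; cbn [cpt snd].
      eapply Rle_trans; [|exact B2].
      assert ((1 - kappa) * H x <= dq * H x) by (apply Rmult_le_compat_r; lra).
      assert ((1 - kappa) * H x * (1 - 2 * kappa) <= dq * H x * (1 - 2 * kappa))
        by (apply Rmult_le_compat_r; lra).
      assert (0 <= H x * ((1 - kappa) * (1 - 2 * kappa) - 1 / 2)); [|lra].
      apply Rmult_le_pos; nra.
    + change (x, - H x) with (cpt x (- H x)).
      replace (RtoC y + w - cpt x (- H x))%C
        with (RtoC (y - x) + ((w - cpt 0 (- (dq * H x))) + cpt 0 ((1 - dq) * H x)))%C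
        by (apply injective_projections; simpl; ring).
      eapply Rle_trans; [apply Cmod_triangle|]; rewrite Cmod_R, Hyx, Hgc.
      assert (T := Cmod_triangle (w - cpt 0 (- (dq * H x))) (cpt 0 ((1 - dq) * H x))).
      assert (T' := Cmod_le_components (cpt 0 ((1 - dq) * H x))); cbn [cpt fst snd] in T'.
      rewrite Rabs_R0, Rplus_0_l, Rabs_mult, (Rabs_pos_eq (H x)) in T' by lra.
      assert (T'' : Rabs (1 - dq) * H x <= 2 * kappa * H x)
        by (apply Rmult_le_compat_r; [lra|apply Rabs_le; lra]).
      assert (c0 * (H x / 2) <= C0 * (H x / 2)) by (apply Rmult_le_compat_r; lra).
      apply Rle_trans with (c0 / 4 * H x + 6 * kappa * H x); [lra|].
      unfold kappa; lra.
Qed.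

Theorem theorem2 (g : C -> C) (W : C -> Prop) (alpha : R)
    (Hdiffeo : analytic_circle_diffeo g)
    (Hext : holomorphic_near_circle W g)
    (Hrot : rotation_number g alpha)
    (Hirr : irrational alpha)
    (C0 : R) (HC0 : 0 < C0) :
  exists (n0 : nat) (gamma : nat -> R -> C),
    forall n : nat, (n0 <= n)%nat ->
      jordan_curve (gamma n) /\
      (forall z, trace (gamma n) z -> outside_disk z) /\
      homotopic_loops (fun z => 1 <= Cmod z) (gamma n) expi /\
      (exists V : C -> Prop, open V /\
         (forall z, closure (annulus (gamma n)) z -> V z) /\
         (forall j z, (j <= convergent_den alpha n)%nat -> V z ->
            iterate_defined W g j z)) /\
      (forall j, (j <= convergent_den alpha n)%nat ->
         (forall z, trace (gamma n) z -> outside_disk (Nat.iter j g z)) /\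
         Rbar_le (hausdorff_P (image (Nat.iter j g) (trace (gamma n)))
                              (trace (gamma n))) C0) /\
      (forall z, trace (gamma n) z ->
         dist_P (Nat.iter (convergent_den alpha n) g z) z <= C0).
Proof.
  destruct (analytic_lift_exists g W alpha Hdiffeo Hext Hrot)
    as (F & ld & psi & V & L & r & K & AL & HF).
  set (q := convergent_den alpha); set (p := cnum alpha).
  assert (F1 := al_deg1 AL).
  assert (q5 : forall n x, 0 < (-1) ^ n * (fiter F (q n) x - IZR (p n) - x)).
  { intros n x; apply (rotation_sign F alpha (al_inc AL) F1 HF).
    - apply sign_cases.
    - now apply convergent_den_pos.
    - now apply convergent_sign. }
  destruct (quasi_invariant_graph g W F ld psi V L r K q p C0 AL) as (n0 & c & Hc & main); auto.
  { now apply convergent_den_pos. }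
  { now apply convergent_den_le. }
  { now apply convergent_den_lt. }
  { now apply convergent_det. }
  set (H := fun n x => c * gap F q p n x).
  exists n0, (fun n => graph (H n)); intros n Hn.
  destruct (main n Hn) as (M1 & M2 & M3); fold (H n) in M1, M2, M3; clear main.
  assert (Hpos : forall x, 0 < H n x) by (intros x; apply Rmult_lt_0_compat; [easy|apply q5]).
  assert (Hper : forall x (k : Z), H n (x + IZR k) = H n x).
  { intros x k; unfold H; now rewrite gap_periodic. }
  assert (Hlip : exists M, 0 <= M /\ forall x y, Rabs (H n x - H n y) <= M * Rabs (x - y)).
  { destruct (gap_lip F ld psi V (al_dF AL) (al_dld AL)
      (al_ld1 AL) (al_psiV AL) q p n) as (M & HM & HL).
    exists (c * M); split; [apply Rmult_le_pos; lra|]; intros x y; unfold H.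
    rewrite <- Rmult_minus_distr_l, Rabs_mult, (Rabs_pos_eq c), Rmult_assoc by lra.
    apply Rmult_le_compat_l; [lra|apply HL]. }
  destruct Hlip as (M & HM & HL).
  split; [now apply (graph_jordan (H n) M)|].
  split; [now apply graph_outside|].
  split; [now apply (graph_homotopic (H n) M)|].
  split; [|split].
  - destruct (closed_annulus_neighbourhood (H n) M Hpos Hper HM HL
      (fun z => forall j, (j <= q n)%nat -> iterate_defined W g j z)) as (U & U1 & U2 & U3).
    { intros x y Hy j Hj; now apply M1. }
    exists U; split; [easy|]; split; [easy|]; intros j z Hj Hz; now apply U3.
  - intros j Hj; split.
    + intros z Hz; destruct (trace_graph _ z Hz) as [x ->].
      destruct (M2 x j Hj) as (w & -> & Hw & _); now apply ecx_outside.
    + apply hausdorff_P_le.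
      * intros a (z & Hz & ->); destruct (trace_graph _ z Hz) as [x ->].
        destruct (M2 x j Hj) as (w & -> & _ & Hd & _).
        exists (graph (H n) (fiter F j x)); split; [now apply graph_trace|easy].
      * intros b Hb; destruct (trace_graph _ b Hb) as [t ->].
        (* Every point of the curve lies over some F^j x, so the pointwise estimate at [x] serves in
           this direction too. *)
        destruct (fiter_surjective F j t (al_cont AL) F1) as [x <-].
        exists (Nat.iter j g (graph (H n) x)); split.
        -- exists (graph (H n) x); split; [now apply graph_trace|easy].
        -- destruct (M2 x j Hj) as (w & -> & _ & _ & Hd); easy.
  - intros z Hz; destruct (trace_graph _ z Hz) as [x ->]; apply M3.
Qed.
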